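(* Let $Z=(Z_n)_{n\ge 0}$ be a subcritical Bienaymé--Galton--Watson process whose offspring distribution has mean $m\in(0,1)$. For every $\lambda>m$, the minimal $\lambda$-Martin entrance boundary of $Z$ (killed upon hitting $0$) is homeomorphic to the circle $S^1$.
   Context: $\mathbb{N}^*=\{1,2,\ldots\}$. All measures are non-negative and locally finite. $P$ denotes the restriction to $\mathbb{N}^*$ of the transition matrix of $Z$ (the transition matrix of $Z$ killed upon hitting $0$). A measure $\nu$ on $\mathbb{N}^*$, viewed as a row vector, is $\lambda$-invariant if $\nu P=\lambda\nu$. For $\lambda>m$ the $\lambda$-Green kernel $G_\lambda(x,y)=\sum_{k=0}^\infty\lambda^{-k}(P^k)_{xy}$ is finite for all $x,y\in\mathbb{N}^*$. Fix a state $o\in\mathbb{N}^*$ such that $G_\lambda(x,o)>0$ for all $x\in\mathbb{N}^*$, and define the $\lambda$-Martin kernel $K_\lambda(x,y)=G_\lambda(x,y)/G_\lambda(x,o)$. The $\lambda$-Martin entrance compactification of $\mathbb{N}^*$ is the smallest compactification $\mathcal{M}$ of the discrete set $\mathbb{N}^*$ such that the map $x\mapsto K_\lambda(x,\cdot)$ extends continuously to $\mathcal{M}$, with respect to pointwise convergence of measures seen as functions on $\mathbb{N}^*$. The $\lambda$-Martin entrance boundary is $B=\mathcal{M}\setminus\mathbb{N}^*$. Each $\xi\in B$ gives a $\lambda$-invariant measure $K_\lambda(\xi,\cdot)$ with mass $1$ at $o$. A $\lambda$-invariant measure is extremal if it cannot be written as a non-trivial convex combination of $\lambda$-invariant measures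 (measures being considered up to multiplicative constants, e.g. normalized to have mass $1$ at $o$). The minimal $\lambda$-Martin entrance boundary is the set $B^*$ of those $\xi\in B$ for which $K_\lambda(\xi,\cdot)$ is extremal, with the topology induced by $\mathcal{M}$. *)

(* Defs.v *)
From HB Require Import structures.
From mathcomp Require Import all_boot all_order all_algebra.
From mathcomp Require Import all_classical all_reals all_analysis.

Set Implicit Arguments.
Unset Strict Implicit.
Unset Printing Implicit Defensive.

Import Order.TTheory GRing.Theory Num.Theory.
Import numFieldNormedType.Exports.

Local Open Scope classical_set_scope.
Local Open Scope ring_scope.

(* The subspace topology inherited from nat is the discrete one. *)
Definition Npos : Type := set_type [set n : nat | (0 < n)%N].

Section BGW.
Variable R : realType.

Definition offspring_law (p : nat -> R) : Prop :=
  (forall k, 0 <= p k) /\ (\sum_(0 <= k <oo) (p k)%:E = 1)%E.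

Definition has_mean (p : nat -> R) (m : R) : Prop :=
  (\sum_(0 <= k <oo) (k%:R * p k)%:E = m%:E)%E.

(* [BGW_transition p x y] is the probability that x independent individuals
   with offspring law p have y children in total: the x-fold convolution power
   of p at y. *)
Fixpoint BGW_transition (p : nat -> R) (x y : nat) : R :=
  if x is x'.+1 then \sum_(j < y.+1) p j * BGW_transition p x' (y - j)%N
  else (y == 0%N)%:R.

Definition killed (P : nat -> nat -> R) (x y : Npos) : R := P (\val x) (\val y).

End BGW.

Section Martin.
Variables (R : realType) (P : Npos -> Npos -> R) (lam : R).

Fixpoint kernel_pow (k : nat) (x y : Npos) : \bar R :=
  if k is k'.+1 then
    (\esum_(z in [set: Npos]) (kernel_pow k' x z * (P z y)%:E))%E
  else ((x == y)%:R)%:E.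

Definition green (x y : Npos) : \bar R :=
  (\sum_(0 <= k <oo) ((lam ^- k)%:E * kernel_pow k x y))%E.

(* The Green kernel of the killed process is finite for lam > m, so that
   [fine] loses nothing there. *)
Definition martin_kernel (o x y : Npos) : R :=
  fine (green x y) / fine (green x o).

(* A non-negative, locally finite measure on the discrete space Npos is the
   function giving its point masses. *)
Definition lambda_invariant (nu : Npos -> R) : Prop :=
  (forall x, 0 <= nu x) /\
  (forall y, \esum_(x in [set: Npos]) (nu x * P x y)%:E = (lam * nu y)%:E).

Definition normalized_invariant (o : Npos) (nu : Npos -> R) : Prop :=
  lambda_invariant nu /\ nu o = 1.

Definition extremal_invariant (o : Npos) (nu : Npos -> R) : Prop :=
  normalized_invariant o nu /\
  forall (nu1 nu2 : Npos -> R) (t : R),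
    normalized_invariant o nu1 -> normalized_invariant o nu2 ->
    0 < t < 1 -> (forall x, nu x = t * nu1 x + (1 - t) * nu2 x) ->
    nu1 = nu2.

End Martin.

Section Compactification.

Definition topological_embedding (X Y : topologicalType) (f : X -> Y) : Prop :=
  injective f /\ @nbhs _ (@initial_topology X Y f) = @nbhs _ X.

Definition compactification (X M : topologicalType) (i : X -> M) : Prop :=
  [/\ compact [set: M], hausdorff_space M, topological_embedding i
    & dense (range i)].

Definition continuous_extension (X M Y : topologicalType) (i : X -> M)
    (f : X -> Y) (fhat : M -> Y) : Prop :=
  continuous fhat /\ (forall x, fhat (i x) = f x).

(* "Smallest" is for the usual order on compactifications of X: M is below M'
   when there is a continuous map M' -> M that is the identity on X. *)
Definition smallest_compactification_extending (X Y : topologicalType)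
    (f : X -> Y) (M : topologicalType) (i : X -> M) : Prop :=
  [/\ compactification i,
      exists fhat : M -> Y, continuous_extension i f fhat
    & forall (M' : topologicalType) (i' : X -> M'),
        compactification i' ->
        (exists fhat' : M' -> Y, continuous_extension i' f fhat') ->
        exists pi : M' -> M, continuous_extension i' i pi].

Definition homeomorphic (X Y : topologicalType) : Prop :=
  exists (f : X -> Y) (g : Y -> X),
    [/\ continuous f, continuous g, cancel f g & cancel g f].

End Compactification.

Section Boundary.
Variables (R : realType) (P : Npos -> Npos -> R) (lam : R) (o : Npos).

(* [{ptws Npos -> R}] carries the topology of pointwise convergence. *)
Definition martin_map (x : Npos) : {ptws Npos -> R} := martin_kernel P lam o x.

Definition martin_entrance_compactification (M : topologicalType)
    (i : Npos -> M) : Prop :=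
  smallest_compactification_extending martin_map i.

Definition martin_entrance_boundary (M : topologicalType) (i : Npos -> M) :
  set M := ~` range i.

(* [Khat] is the continuous extension of [martin_map] to M. *)
Definition minimal_martin_entrance_boundary (M : topologicalType)
    (i : Npos -> M) (Khat : M -> {ptws Npos -> R}) : set M :=
  [set xi | martin_entrance_boundary i xi /\
            extremal_invariant P lam o (Khat xi)].

End Boundary.

Definition circle (R : realType) : set (R * R) :=
  [set z | z.1 ^+ 2 + z.2 ^+ 2 = 1].

(* Main.v *)
Require Import Defs.
From HB Require Import structures.
From mathcomp Require Import all_boot all_order all_algebra.
From mathcomp Require Import all_classical all_reals all_analysis.
From mathcomp Require Import finmap zify ring lra.

(* Write T(s) = 1 - f(1 - s), f the offspring generating function, and
   h(t) = lim_k T^k(t) / T^k(1), so that h(T t) = m h(t) and 1 - h(1 - z) is the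
   generating function of the Yaglom law. Let pi_b be the restriction to Npos of
   the compound Poisson law of a Poisson(b) number of Yaglom clusters; its
   generating function gives pi_b P = pi_{b m}, hence the measures
   kappa_b = sum over n in Z of lam^-n pi_{b m^n}
   are lam-invariant, and kappa_{b m} is proportional to kappa_b.

   If x -> oo and x T^k(1) -> b, then lam^k G(x, y) -> kappa_b(y); since every
   large x has a k with x T^k(1) in [T(1), 1], the limit points of the Martin
   kernel are exactly the normalized kappa_b with b > 0.

   Started from pi_{b m^-k}, for k large, the variable (1 - T^k(t))^x concentrates
   at exp(-b h(t)), by Chebyshev. So b can be read off kappa_b up to powers of m:
   the pi_{a m^(n-k)} give in the limit no mass to a neighbourhood of the points
   where (1 - T^k(1))^x is near exp(-b), unless a m^n is near b. The same
   concentration shows that an invariant nu <= C kappa_b, of density g with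
   respect to kappa_b, has the same generating function as the sum of the
   lam^-n (int g d pi_{b m^n}) pi_{b m^n} far in the past, where the coefficients
   become constant by invariance; hence nu is a multiple of kappa_b, and all
   kappa_b are extremal.

   Thus t |-> kappa_{m^t} and t |-> (cos 2 pi t, sin 2 pi t) are quotient maps of
   [0, 1] that identify the same points. *)

Set Implicit Arguments.
Unset Strict Implicit.
Unset Printing Implicit Defensive.

Import Order.TTheory GRing.Theory Num.Theory.
Import numFieldNormedType.Exports.

Local Open Scope classical_set_scope.
Local Open Scope ring_scope.

(** * Sums of nonnegative families *)

(** Only a first moment is assumed, so T^k(1) need not be comparable to m^k and h may have infinite
    slope at 0. Hence populations are measured in units of 1/T^k(1), and the second moments behind
    Chebyshev rest on the slow variation of h(t)/t instead of a derivative.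

    Everything is read off the sums of nu(x) (1 - t)^x with 0 < t <= 1. P acts on these by t |->
    T(t), up to a constant in t that accounts for the mass killed at 0. The bound t > 0 is
    essential: kappa_b has infinite mass when lam >= 1, while (1 - t)^x makes the terms n -> -oo
    smaller than any exponential. The terms n -> +oo are where lam > m enters.

    Compactness is used along ultrafilters, which give limits of bounded quantities without
    extracting subsequences.

    The compactification is known only through its universal property, and x |-> K(x, .) may fail to
    embed Npos as a discrete set; the coordinate 1/x keeps the states apart and sends the boundary
    to 0. *)

Section HasSum.
Context {R : realType}.
Implicit Types I J : choiceType.

(** A relation between real numbers that carries nonnegativity and finiteness along, so that sums
    are added, subtracted and exchanged without side conditions in the extended reals. *)
Definition hassum I (f : I -> R) (v : R) : Prop :=
  (forall i, 0 <= f i) /\ \esum_(i in [set: I]) (f i)%:E = v%:E.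

(** [fine] sends a divergent sum to 0, so the value carries information only next to a proof of
    [hassum]. *)
Definition rsum I (f : I -> R) : R := fine (\esum_(i in [set: I]) (f i)%:E).

Lemma hassum_nneg I (f : I -> R) v : hassum f v -> forall i, 0 <= f i.
Proof. by case. Qed.

Lemma hassum_rsum I (f : I -> R) v : hassum f v -> rsum f = v.
Proof. by case=> _; rewrite /rsum => ->. Qed.

Lemma hassum_uniq I (f : I -> R) v w : hassum f v -> hassum f w -> v = w.
Proof. by move=> /hassum_rsum <- /hassum_rsum. Qed.

Lemma hassum_eq I (f g : I -> R) v : f =1 g -> hassum f v -> hassum g v.
Proof. by move=> /funext ->. Qed.

Lemma hassum_ge0 I (f : I -> R) v : hassum f v -> 0 <= v.
Proof.
case=> f0 fv; rewrite -lee_fin -fv; apply: esum_ge0 => x _.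
by rewrite lee_fin.
Qed.

Lemma hassum_le I (f g : I -> R) v w :
  hassum f v -> hassum g w -> (forall i, f i <= g i) -> v <= w.
Proof.
move=> [_ fv] [_ gw] fg; rewrite -lee_fin -fv -gw.
by apply: le_esum => i _; rewrite lee_fin.
Qed.

Lemma hassum_dom I (f g : I -> R) w :
  hassum g w -> (forall i, 0 <= f i <= g i) -> hassum f (rsum f) /\ rsum f <= w.
Proof.
move=> gw fg.
have f0 i : 0 <= f i by case/andP: (fg i).
have fin : (\esum_(i in [set: I]) (f i)%:E \is a fin_num)%E.
  rewrite ge0_fin_numE; last by apply: esum_ge0 => i _; rewrite lee_fin.
  apply: (@le_lt_trans _ _ w%:E); last by rewrite ltry.
  by rewrite -gw.2; apply: le_esum => i _; rewrite lee_fin; case/andP: (fg i).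
have fv : hassum f (rsum f) by split => //; rewrite /rsum fineK.
by split => //; apply: (hassum_le fv gw) => i; case/andP: (fg i).
Qed.

Lemma hassumD I (f g : I -> R) v w :
  hassum f v -> hassum g w -> hassum (fun i => f i + g i) (v + w).
Proof.
move=> [f0 fv] [g0 gw]; split => [i|]; first exact: addr_ge0.
under eq_esum do rewrite EFinD.
by rewrite esumD ?fv ?gw -?EFinD// => i _; rewrite lee_fin.
Qed.

Lemma hassum0 I : hassum (fun _ : I => 0) 0.
Proof. by split => //; rewrite esum1. Qed.

Lemma hassum_partial I (f : I -> R) v s :
  hassum f v -> uniq s -> \sum_(i <- s) f i <= v.
Proof.
move=> [f0 fv] us; rewrite -lee_fin -fv -sumEFin; apply: ereal_sup_ubound.
exists [set` s]; first by split => //; exact: finite_seq.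
by rewrite -fsbig_seq.
Qed.

Lemma hassum_adherent I (f : I -> R) v e :
  hassum f v -> 0 < e -> exists2 s, uniq s & v - e < \sum_(i <- s) f i.
Proof.
move=> [f0 fv] e0.
have [|x [X [finX _] <-]] := @ub_ereal_sup_adherent R
  [set (\sum_(i \in X) (f i)%:E)%E | X in fsets [set: I]] e e0.
  by move: fv; rewrite /esum => ->.
rewrite -[ereal_sup _]/(esum _ _) fv => vx.
exists (enum_fset (fset_set X)); first exact: fset_uniq.
by rewrite -lte_fin -sumEFin EFinB (lt_le_trans vx)// fsbig_finite.
Qed.

Lemma hassum_intro I (f : I -> R) v : (forall i, 0 <= f i) ->
  (forall s, uniq s -> \sum_(i <- s) f i <= v) ->
  (forall e, 0 < e -> exists2 s, uniq s & v - e < \sum_(i <- s) f i) ->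
  hassum f v.
Proof.
move=> f0 fs fe; split => //; apply/eqP; rewrite eq_le; apply/andP; split.
  apply: ge_ereal_sup => _ [X [finX _] <-].
  by rewrite fsbig_finite// sumEFin lee_fin; apply: fs; exact: fset_uniq.
apply/lee_addgt0Pr => e e0; have [s us vs] := fe _ e0.
rewrite -leeBlDr// -EFinB; apply: esum_ge; exists [set` s].
  by split => //; exact: finite_seq.
by rewrite -fsbig_seq// sumEFin lee_fin ltW.
Qed.

Lemma hassumZ I (f : I -> R) v c :
  0 <= c -> hassum f v -> hassum (fun i => c * f i) (c * v).
Proof.
rewrite le_eqVlt => /predU1P[<- _|c0 fv].
  by rewrite mul0r; apply: hassum_eq (hassum0 _) => i; rewrite mul0r.
apply: hassum_intro => [i|s us|e e0].
- by rewrite mulr_ge0 ?(ltW c0)//; exact: hassum_nneg fv _.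
- by rewrite -mulr_sumr ler_pM2l//; exact: hassum_partial.
- have [|s us vs] := hassum_adherent (e := e / c) fv; first exact: divr_gt0.
  exists s => //; rewrite -mulr_sumr -(ltr_pM2l c0) in vs *.
  by move: vs; rewrite mulrBr mulrCA divff ?mulr1 ?gt_eqF.
Qed.

Lemma hassumZr I (f : I -> R) v c :
  0 <= c -> hassum f v -> hassum (fun i => f i * c) (v * c).
Proof.
move=> c0 fv; rewrite mulrC; apply: hassum_eq (hassumZ c0 fv) => i.
exact: mulrC.
Qed.

Lemma hassumB I (f g : I -> R) v w : (forall i, 0 <= g i <= f i) ->
  hassum f v -> hassum g w -> hassum (fun i => f i - g i) (v - w).
Proof.
move=> gf fv gw.
have [i|d _] := hassum_dom (f := fun i => f i - g i) fv.
  by case/andP: (gf i) => ? ?; rewrite subr_ge0 lerBlDr lerDl; apply/andP.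
suff -> : v - w = rsum (fun i => f i - g i) by [].
apply/eqP; rewrite subr_eq; apply/eqP; apply: hassum_uniq fv _.
by apply: hassum_eq (hassumD d gw) => i; rewrite subrK.
Qed.

Lemma hassum_term I (f : I -> R) v i : hassum f v -> f i <= v.
Proof. by move=> fv; have := hassum_partial (s := [:: i]) fv erefl; rewrite big_seq1. Qed.

(** Tonelli: finiteness of one iterated sum gives the other. Most transforms of image measures come
    from it. *)
Lemma hassum_exchange I J (f : I -> J -> R) (r : I -> R) (c : J -> R) v :
  (forall i, hassum (f i) (r i)) -> (forall j, hassum (f^~ j) (c j)) ->
  hassum r v -> hassum c v.
Proof.
move=> fr fc [r0 rv]; split; first by move=> j; exact: hassum_ge0 (fc j).
rewrite -rv.
transitivity (\esum_(j in [set: J]) \esum_(i in [set: I]) (f i j)%:E).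
  by apply: eq_esum => j _; rewrite (fc j).2.
transitivity (\esum_(i in [set: I]) \esum_(j in [set: J]) (f i j)%:E); last first.
  by apply: eq_esum => i _; rewrite (fr i).2.
rewrite !esum_esum; try by move=> *; rewrite lee_fin; exact: hassum_nneg (fr _) _.
rewrite (reindex_esum ([set: J] `*`` (fun=> [set: I])) _ (fun x => (x.2, x.1)))//.
split => //=.
by move=> [i1 i2] [j1 j2] /= _ _ [] -> ->.
by move=> [i1 i2] _ /=; exists (i2, i1).
Qed.

Lemma hassum_col I J (f : I -> J -> R) (r : I -> R) v :
  (forall i, hassum (f i) (r i)) -> hassum r v ->
  forall j, hassum (f^~ j) (rsum (f^~ j)).
Proof.
move=> fr rv j; apply: (hassum_dom rv _).1 => i; apply/andP; split.
  exact: hassum_nneg (fr i) j.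
exact: hassum_term.
Qed.

Lemma hassum_inj I J (e : I -> J) (f : J -> R) v : injective e ->
  (forall j, ~ range e j -> f j = 0) ->
  hassum (f \o e) v <-> hassum f v.
Proof.
move=> einj f0.
have E : \esum_(j in [set: J]) (f j)%:E = \esum_(i in [set: I]) ((f \o e) i)%:E.
  rewrite -(@esum_image _ _ _ [set: I] e (EFin \o f)); last first.
    by move=> x y _ _; exact: einj.
  rewrite [RHS]esum_mkcond; apply: eq_esum => j _.
  by case: ifPn => //; rewrite notin_setE => /f0 ->.
split=> [[fe0 fv]|[fe0 fv]]; split => //; rewrite ?E// -?E//.
- move=> j; have [[i _ <-]|/f0 ->//] := pselect (range e j).
  exact: fe0.
- by move=> i; exact: fe0.
Qed.

Lemma hassum_bij I J (e : I -> J) (e' : J -> I) (f : J -> R) v :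
  cancel e e' -> cancel e' e -> hassum (f \o e) v <-> hassum f v.
Proof.
move=> ee' e'e; apply: hassum_inj; first exact: can_inj ee'.
by move=> j []; exists (e' j).
Qed.

Lemma hassum_dist I (f g : I -> R) v w d : hassum f v -> hassum g w ->
  hassum (fun i => `|f i - g i|) d -> `|v - w| <= d.
Proof.
move=> fv gw fgd; rewrite ler_distlC; apply/andP; split.
  rewrite lerBlDr; apply: (hassum_le fv (hassumD gw fgd)) => i.
  by have := ler_norm (f i - g i); lra.
apply: (hassum_le gw (hassumD fv fgd)) => i.
by have := ler_norm (g i - f i); rewrite distrC; lra.
Qed.

Lemma hassum_head (I : choiceType) (f : I -> R) v i0 : hassum f v ->
  hassum (fun i => if i == i0 then 0 else f i) (v - f i0).
Proof.
move=> fv.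
have f0 : hassum (fun i => if i == i0 then f i else 0) (f i0).
  apply/(hassum_inj (e := fun _ : unit => i0)) => [[] []//|j|].
    by move=> /= h; case: eqP => // ji; case: h; exists tt.
  split => [[]/=|]; first by rewrite eqxx; exact: hassum_nneg fv _.
  rewrite (_ : [set: unit] = [set tt]); last by apply/seteqP; split=> [[]|[]].
  rewrite esum_set1/= eqxx// lee_fin; exact: hassum_nneg fv _.
apply: hassum_eq (hassumB _ fv f0) => [i|i] /=.
  by case: eqP => _; rewrite ?subrr ?subr0.
by have := hassum_nneg fv i; case: eqP => _ ->; rewrite lexx.
Qed.

Lemma hassum_peel (f : nat -> R) v :
  hassum f v -> hassum (fun n => f n.+1) (v - f 0%N).
Proof.
move=> fv; have h0 := hassum_head 0%N fv.
apply: (iffRL (hassum_inj _ succn_inj _) h0) => -[|n] //= h.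
by case: h; exists n.
Qed.

(** A finite set that exhausts D up to e does so for every f <= D, since D - f is nonnegative. This
    uniformity in f is what dominated convergence needs. *)
Lemma hassum_approx I (D : I -> R) d e : hassum D d -> 0 < e ->
  exists s, forall f v, (forall i, f i <= D i) -> hassum f v ->
    \sum_(i <- s) f i <= v <= \sum_(i <- s) f i + e.
Proof.
move=> Dd e0; have [s us ds] := hassum_adherent Dd e0.
exists s => f v fD fv; rewrite hassum_partial//=.
have := hassum_partial (hassumB _ Dd fv) us.
rewrite sumrB => /(_ _)/wrap[|h]; last by lra.
by move=> i; rewrite fD (hassum_nneg fv).
Qed.

(** Dominated convergence along an arbitrary filter; ultrafilters and neighbourhood filters both
    occur below. *)
Lemma hassum_cvg I (T : Type) (F : set_system T) (a : T -> I -> R) (l D : I -> R)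
    (V : T -> R) v d :
  Filter F -> hassum D d -> hassum l v -> (forall i, l i <= D i) ->
  (\forall t \near F, (forall i, a t i <= D i) /\ hassum (a t) (V t)) ->
  (forall i, a t i @[t --> F] --> l i) ->
  V @ F --> v.
Proof.
move=> FF Dd lv lD aD al; apply/cvgrPdist_le => e e0.
have [s sP] := hassum_approx Dd (e := e / 2) ltac:(lra).
have /cvgrPdist_le/(_ (e / 2))/(_ _)/wrap[|cs] :
    (\sum_(i <- s) a t i) @[t --> F] --> \sum_(i <- s) l i.
- by apply: cvg_big => [|i _]; [exact: add_continuous|exact: al].
- lra.
near=> t; have [atD atV] : (forall i, a t i <= D i) /\ hassum (a t) (V t).
  by near: t.
have /ler_normlP[] : `|\sum_(i <- s) l i - \sum_(i <- s) a t i| <= e / 2.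
  by near: t.
have := sP _ _ lD lv; have := sP _ _ atD atV.
by move=> /andP[? ?] /andP[? ?] ? ?; apply/ler_normlP; split; lra.
Unshelve. all: by end_near. Qed.

Lemma hassum_dominated_cvg I (T : Type) (F : set_system T) (a : T -> I -> R)
    (l D : I -> R) d :
  ProperFilter F -> hassum D d ->
  (\forall t \near F, forall i, 0 <= a t i <= D i) ->
  (forall i, a t i @[t --> F] --> l i) ->
  hassum l (rsum l) /\ rsum (a t) @[t --> F] --> rsum l.
Proof.
move=> FF Dd aD al.
have lD i : 0 <= l i <= D i.
  apply/andP; split.
    by apply: cvgr_to_ge (al i) _; apply: filterS aD => t /(_ i)/andP[].
  by apply: cvgr_to_le (al i) _; apply: filterS aD => t /(_ i)/andP[].
have [lv _] := hassum_dom Dd lD; split => //.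
apply: (hassum_cvg FF Dd lv) (al) => [i|]; first by case/andP: (lD i).
apply: filterS aD => t aD; split => [i|]; first by case/andP: (aD i).
exact: (hassum_dom Dd aD).1.
Qed.
End HasSum.

(** * The survival map and its Koenigs function *)

(** What is kept of the concavity of T: [surv_star] says that T(t)/t is nonincreasing, [surv_le] and
    [surv_slope] that it tends to m at 0. *)
Record survival_map (R : realType) (m : R) (T : R -> R) : Prop := SurvivalMap {
  surv_range : forall t, 0 <= t <= 1 -> 0 <= T t <= 1;
  surv_gt0 : forall t, 0 < t <= 1 -> 0 < T t;
  surv_mono : forall s t, 0 <= s -> s <= t -> t <= 1 -> T s <= T t;
  surv_star : forall c t, 0 <= c <= 1 -> 0 <= t <= 1 -> c * T t <= T (c * t);
  surv_le : forall t, 0 <= t <= 1 -> T t <= m * t;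
  surv_slope : forall e, 0 < e -> exists2 d, 0 < d &
    forall t, 0 < t < d -> t <= 1 -> (m - e) * t <= T t }.

Definition koenigs (R : realType) (T : R -> R) (t : R) : R :=
  limn (fun k => iter k T t / iter k T 1).

Section SurvivalMap.
Context {R : realType} {m : R} {T : R -> R}.
Hypothesis HT : survival_map m T.
Hypothesis m01 : 0 < m < 1.

Let m0 : 0 < m. Proof. by case/andP: m01. Qed.

Lemma iter_range k t : 0 <= t <= 1 -> 0 <= iter k T t <= 1.
Proof. by move=> t01; elim: k => //= k; exact: (surv_range HT). Qed.

Lemma iter_gt0 k t : 0 < t <= 1 -> 0 < iter k T t <= 1.
Proof.
move=> /andP[t0 t1]; elim: k => [|k /andP[k0 k1]] /=; first by rewrite t0.
rewrite (surv_gt0 HT) ?k0//=.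
have k01 : 0 <= iter k T t <= 1 by rewrite ltW.
by case/andP: (surv_range HT k01).
Qed.

Lemma iter_mono k s t : 0 <= s -> s <= t -> t <= 1 -> iter k T s <= iter k T t.
Proof.
move=> s0 st t1; elim: k => //= k IH.
have /(iter_range k)/andP[ks _] : 0 <= s <= 1 by lra.
have /(iter_range k)/andP[_ kt] : 0 <= t <= 1 by lra.
exact: (surv_mono HT).
Qed.

Lemma iter_star k c t : 0 <= c <= 1 -> 0 <= t <= 1 ->
  c * iter k T t <= iter k T (c * t).
Proof.
move=> /andP[c0 c1] t01; elim: k => //= k IH.
have /andP[k0 k1] := iter_range k t01.
have /andP[t0 t1] := t01.
have ct : 0 <= c * t <= 1 by rewrite mulr_ge0//= mulr_ile1.
apply: (@le_trans _ _ (T (c * iter k T t))).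
  by apply: (surv_star HT); rewrite ?c0 ?k0.
by apply: (surv_mono HT) => //; [exact: mulr_ge0|case/andP: (iter_range k ct)].
Qed.

Lemma iter_le k t : 0 <= t <= 1 -> iter k T t <= m ^+ k * t.
Proof.
move=> t01; elim: k => /= [|k IH]; first by rewrite expr0 mul1r.
apply: le_trans (surv_le HT (iter_range k t01)) _.
by rewrite exprS -mulrA ler_pM2l.
Qed.

Lemma one_in01 : 0 < (1 : R) <= 1. Proof. by rewrite ltr01 lexx. Qed.

Lemma iter_cvg0 t : 0 <= t <= 1 -> iter k T t @[k --> \oo] --> 0.
Proof.
move=> t01; apply: (@squeeze_cvgr _ _ _ _ (fun=> 0) (fun k => m ^+ k * t)).
- by near=> k; rewrite iter_le//; case/andP: (iter_range k t01) => ->.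
- exact: cvg_cst.
- rewrite -(mul0r t); apply: cvgMr_tmp; apply: cvg_expr.
  by rewrite gtr0_norm//; case/andP: m01.
Unshelve. all: by end_near. Qed.

Lemma surv_slope_cvg (I : Type) (F : set_system I) (u : I -> R) : Filter F ->
  u @ F --> 0 -> (forall i, 0 < u i <= 1) -> T (u i) / u i @[i --> F] --> m.
Proof.
move=> FF u0 u01; apply/cvgrPdist_le => e e0.
have [d d0 dP] := surv_slope HT e0.
have /cvgrPdist_lt/(_ _ d0) ud := u0.
near=> i.
have /andP[ui0 ui1] := u01 i.
have uid : u i < d.
  have : `|0 - u i| < d by near: i.
  by rewrite sub0r normrN gtr0_norm.
have h1 := dP (u i) _ ui1; rewrite ui0 uid in h1.
have h2 : T (u i) <= m * u i by apply: (surv_le HT); rewrite ui1 ltW.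
rewrite ger0_norm ?subr_ge0 ?ler_pdivrMr//.
by rewrite lerBlDl -lerBlDr ler_pdivlMr// h1.
Unshelve. all: by end_near. Qed.

Lemma iter_slope_cvg (I : Type) (F : set_system I) (u : I -> R) j : Filter F ->
  u @ F --> 0 -> (forall i, 0 < u i <= 1) ->
  iter j T (u i) / u i @[i --> F] --> m ^+ j.
Proof.
move=> FF u0 u01; elim: j => [|j IH] /=.
  rewrite expr0; apply: cvg_near_cst; apply: nearW => i.
  by rewrite divff// gt_eqF//; case/andP: (u01 i).
rewrite exprS.
have E i : T (iter j T (u i)) / u i =
    T (iter j T (u i)) / iter j T (u i) * (iter j T (u i) / u i).
  rewrite mulrA divfK// gt_eqF//; by case/andP: (iter_gt0 j (u01 i)).
under eq_cvg do rewrite E.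
apply: cvgM => //; apply: surv_slope_cvg; last by move=> i; exact: iter_gt0.
apply: (@squeeze_cvgr _ _ _ _ (fun=> 0) u) => //.
  near=> i; have /andP[ui0 ui1] := u01 i.
  have /(iter_le j) le : 0 <= u i <= 1 by rewrite ltW.
  case/andP: (iter_gt0 j (u01 i)) => /ltW -> _ /=; apply: le_trans le _.
  rewrite ger_pMl// exprn_ile1 ?ltW//; by case/andP: m01.
exact: cvg_cst.
Unshelve. all: by end_near. Qed.

Local Notation h := (koenigs T).

(** This is [surv_star] at the point T^k(1) with the factor T^k(t)/T^k(1). *)
Lemma koenigs_nondecreasing t : 0 <= t <= 1 ->
  nondecreasing_seq (fun k => iter k T t / iter k T 1).
Proof.
move=> t01; apply/nondecreasing_seqP => k.
have /andP[k0 k1] := iter_range k t01.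
have /andP[ o0 o1] := iter_gt0 k one_in01.
have /andP[ q0 q1] := iter_gt0 k.+1 one_in01.
rewrite ler_pdivlMr//=.
set s := iter k T t; set u := iter k T 1.
have su : 0 <= s / u <= 1.
  rewrite divr_ge0 ?(ltW o0)//= ler_pdivrMr// mul1r; apply: iter_mono => //.
    by case/andP: t01.
  by case/andP: t01.
have u01 : 0 <= u <= 1 by rewrite ltW.
by have := surv_star HT su u01; rewrite divfK ?gt_eqF.
Qed.

Lemma koenigs_ratio_le1 t k : 0 <= t <= 1 -> iter k T t / iter k T 1 <= 1.
Proof.
move=> /andP[t0 t1]; have /andP[ o0 _] := iter_gt0 k one_in01.
by rewrite ler_pdivrMr// mul1r; exact: iter_mono.
Qed.

Lemma koenigs_cvg t : 0 <= t <= 1 ->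
  iter k T t / iter k T 1 @[k --> \oo] --> h t.
Proof.
move=> t01; apply: nondecreasing_is_cvgn; first exact: koenigs_nondecreasing.
by exists 1 => _ [k _ <-]; exact: koenigs_ratio_le1.
Qed.

Lemma koenigs_ge t : 0 <= t <= 1 -> t <= h t.
Proof.
move=> t01; apply: cvgr_to_ge (koenigs_cvg t01) _; apply: nearW => k.
have /andP[ o0 _] := iter_gt0 k one_in01.
by rewrite ler_pdivlMr// -[X in _ <= iter _ _ X]mulr1 iter_star// lexx ler01.
Qed.

Lemma koenigs_le1 t : 0 <= t <= 1 -> h t <= 1.
Proof.
move=> t01; apply: cvgr_to_le (koenigs_cvg t01) _; apply: nearW => k.
exact: koenigs_ratio_le1.
Qed.

Lemma koenigs1 : h 1 = 1.
Proof.
have o1 : 0 <= (1 : R) <= 1 by rewrite ler01 lexx.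
by apply/eqP; rewrite eq_le koenigs_le1// koenigs_ge.
Qed.

Lemma koenigs_gt0 t : 0 < t <= 1 -> 0 < h t.
Proof.
move=> /andP[t0 t1]; apply: (lt_le_trans t0); apply: koenigs_ge.
by rewrite ltW.
Qed.

Lemma koenigs_star c t : 0 <= c <= 1 -> 0 <= t <= 1 -> c * h t <= h (c * t).
Proof.
move=> c01 t01.
have /andP[c0 c1] := c01; have /andP[t0 t1] := t01.
have ct : 0 <= c * t <= 1 by rewrite mulr_ge0//= mulr_ile1.
have cv1 := @cvgMl_tmp _ _ _ eventually_filter _ c _ (koenigs_cvg t01).
have cv2 := koenigs_cvg ct.
apply: (ler_cvg_to cv1 cv2).
apply: nearW => k /=.
have /andP[ o0 _] := iter_gt0 k one_in01.
by rewrite mulrA ler_pM2r ?invr_gt0// iter_star.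
Qed.

(** The numerator is T^(k+j)(t) in either order of composition, so the ratio factors into the slope
    of T^j at T^k(1), which tends to m^j, and the ratio of h(t) at index k + j. *)
Lemma koenigs_iter t j : 0 <= t <= 1 -> h (iter j T t) = m ^+ j * h t.
Proof.
move=> t01.
have c1 := koenigs_cvg (iter_range j t01).
suff c2 : iter k T (iter j T t) / iter k T 1 @[k --> \oo] --> m ^+ j * h t.
  exact: (cvg_unique _ c1 c2).
have E k : iter k T (iter j T t) / iter k T 1 =
    iter j T (iter k T 1) / iter k T 1 * (iter (k + j) T t / iter (k + j) T 1).
  have /andP[+ _] := iter_gt0 (k + j) one_in01.
  rewrite -!iterD addnC => o0.
  by rewrite [RHS]mulrC mulrA divfK ?gt_eqF.
under eq_cvg do rewrite E.
apply: cvgM.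
  apply: iter_slope_cvg; last by move=> k; exact: iter_gt0 one_in01.
  by apply: iter_cvg0; rewrite ler01 lexx.
by have := koenigs_cvg t01; rewrite -(cvg_shiftn j).
Qed.

(* As t -> 0, koenigs t / t varies slowly: it is nonincreasing, and T multiplies
   it by a factor that tends to 1. *)
Lemma koenigs_double t : 0 < t <= 1 ->
  m ^- k * h (2 * iter k T t - iter k T t ^+ 2) @[k --> \oo] --> 2 * h t.
Proof.
move=> t0.
(* With m^j <= 1/2, T^j maps 2s - s^2 below s, where [koenigs_star] can compare it with s. *)
have [j j2] : exists j, m ^+ j * 2 <= 1.
  have : m ^+ j * 2 @[j --> \oo] --> 0.
    rewrite -[X in _ --> X](mul0r 2); apply: cvgMr_tmp; apply: cvg_expr.
    by rewrite gtr0_norm//; case/andP: m01.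
  move=> /cvgrPdist_le/(_ 1 ltr01)[j _ /(_ j (leqnn j))].
  by rewrite sub0r normrN ger0_norm ?mulr_ge0 ?exprn_ge0 ?(ltW m0)// => ?; exists j.
have t01 : 0 <= t <= 1 by case/andP: t0 => /ltW -> ->.
pose s k := iter k T t; pose v k := 2 * s k - s k ^+ 2.
have s01 k : 0 < s k <= 1 by exact: iter_gt0.
have v01 k : 0 < v k <= 1 by have := s01 k; rewrite /v; nra.
have s0 : s @ \oo --> 0 by exact: iter_cvg0.
have v0 : v @ \oo --> 0.
  have -> : (0 : R) = 2 * 0 - 0 * 0 by ring.
  by apply: cvgB; [apply: cvgMl_tmp|apply: cvgM].
(* From h(v) = m^-j h(T^j v) >= m^-j (T^j v / s) h(s) with v = s (2 - s). *)
pose lo k := h t * (2 - s k) * (iter j T (v k) / v k / m ^+ j).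
apply: (@squeeze_cvgr _ _ _ _ lo (fun=> 2 * h t)); last exact: cvg_cst.
  near=> k.
  have mk0 : 0 < m ^+ k by exact: exprn_gt0.
  have mj0 : 0 < m ^+ j by exact: exprn_gt0.
  have /andP[sk0 sk1] := s01 k; have /andP[vk0 vk1] := v01 k.
  have /andP[w0 w1] := iter_gt0 j (v01 k).
  have hs : h (s k) = m ^+ k * h t by exact: koenigs_iter.
  have vs : v k = s k * (2 - s k) by rewrite /v; ring.
  have ht0 : 0 < h t by exact: koenigs_gt0.
  rewrite -/(s k) -/(v k); apply/andP; split; last first.
    have c01 : 0 <= s k / v k <= 1.
      by rewrite divr_ge0 ?(ltW sk0) ?(ltW vk0)//= ler_pdivrMr// mul1r /v; nra.
    have vk01 : 0 <= v k <= 1 by rewrite vk1 ltW.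
    have := koenigs_star c01 vk01; rewrite divfK ?gt_eqF// hs => hv.
    rewrite ler_pdivrMl//.
    have -> : h (v k) = s k / v k * h (v k) * (2 - s k).
      by rewrite {2}vs; field; do !(apply/andP; split); lra.
    have mht : 0 < m ^+ k * h t by exact: mulr_gt0.
    by nra.
  have wle : iter j T (v k) <= s k.
    have /(iter_le j) : 0 <= v k <= 1 by rewrite vk1 ltW.
    move=> /le_trans; apply; rewrite vs.
    apply: (@le_trans _ _ (m ^+ j * (s k * 2))).
      by rewrite ler_pM2l// ler_pM2l//; lra.
    by rewrite mulrCA ger_pMr.
  have c01 : 0 <= iter j T (v k) / s k <= 1.
    by rewrite divr_ge0 ?(ltW sk0) ?(ltW w0)//= ler_pdivrMr// mul1r.
  have sk01 : 0 <= s k <= 1 by rewrite sk1 ltW.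
  have vk01 : 0 <= v k <= 1 by rewrite vk1 ltW.
  have := koenigs_star c01 sk01; rewrite divfK ?gt_eqF// hs koenigs_iter// => hv.
  rewrite ler_pdivlMl// /lo -(ler_pM2l mj0); apply: le_trans hv.
  rewrite vs le_eqVlt; apply/orP; left; apply/eqP.
  by field; do !(apply/andP; split); lra.
have -> : 2 * h t = h t * (2 - 0) * (m ^+ j / m ^+ j).
  by rewrite divff ?gt_eqF ?exprn_gt0//; ring.
apply: cvgM; first by apply: cvgMl_tmp; apply: cvgB => //; exact: cvg_cst.
by apply: cvgMr_tmp; exact: iter_slope_cvg.
Unshelve. all: by end_near. Qed.

End SurvivalMap.

(** * Power series *)

Section Series.
Context {R : realType}.

Lemma hassum_series (f : nat -> R) v : (forall n, 0 <= f n) ->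
  series f @ \oo --> v -> hassum f v.
Proof.
move=> f0 fv; split => //.
rewrite -nneseries_esumT; last by move=> n; rewrite lee_fin.
apply/cvg_lim => //; apply: cvg_EFin.
  by apply: nearW => n; rewrite sumEFin.
by apply: cvg_trans fv; apply: near_eq_cvg; apply: nearW => n /=; rewrite sumEFin.
Qed.

Lemma hassum_geometric (r : R) : 0 <= r < 1 ->
  hassum (fun n : nat => r ^+ n) (1 - r)^-1.
Proof.
move=> /andP[r0 r1]; apply: hassum_series => [n|]; first exact: exprn_ge0.
have := @cvg_geometric_series R 1 r; rewrite ger0_norm// mul1r => /(_ r1).
rewrite /geometric /series /=.
by under [X in X @ _ --> _ -> _]eq_fun do under eq_bigr do rewrite mul1r.
Qed.

Lemma hassum_int (f : int -> R) v w :
  hassum (fun n => f (Posz n)) v -> hassum (fun n => f (Negz n)) w ->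
  hassum f (v + w).
Proof.
move=> fv fw.
have f1 : hassum (fun n : int => if n is Posz _ then f n else 0) v.
  apply/(hassum_inj (e := Posz)) => [a b []//|[n h|//]|//].
  by case: h; exists n.
have f2 : hassum (fun n : int => if n is Posz _ then 0 else f n) w.
  apply/(hassum_inj (e := Negz)) => [a b []//|[//|n h]|//].
  by case: h; exists n.
by apply: hassum_eq (hassumD f1 f2) => -[] n; rewrite ?addr0 ?add0r.
Qed.

(** 1 + x <= exp(x) at x = y/N, raised to the power N: exp(-y) beats any power of y. *)
Lemma expRN_le (y : R) N : 0 < y -> expR (- y) <= (N%:R / y) ^+ N.
Proof.
move=> y0; case: N => [|N].
  by rewrite expr0 -expR0 ler_expR oppr_le0 ltW.
have N0 : 0 < N.+1%:R :> R by rewrite ltr0n.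
have yN : - y = - (y / N.+1%:R) * N.+1%:R by rewrite mulNr divfK// gt_eqF.
rewrite yN expRM_natr lerXn2r ?nnegrE ?expR_ge0 ?divr_ge0 ?(ltW y0)//.
rewrite expRN -[leRHS]invrK lef_pV2 ?posrE ?expR_gt0 ?invr_gt0 ?divr_gt0//.
by rewrite invf_div; apply: le_trans (expR_ge1Dx _); rewrite lerDr.
Qed.

(** With y = b m^n, the branches come from bounding exp(-y h) - exp(-y) by y for n >= 0 and by
    exp(-y h) for n < 0; c1 stands for b and c2 for b h(t). *)
Definition dominating (lam m c1 c2 : R) (n : int) : R :=
  if n is Posz _ then c1 * (m / lam) ^ n else lam ^ (- n) * expR (- (c2 * m ^ n)).

Lemma dominating_hassum (lam m c1 c2 : R) : 0 < m < 1 -> m < lam -> 0 <= c1 ->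
  0 < c2 -> hassum (dominating lam m c1 c2) (rsum (dominating lam m c1 c2)).
Proof.
move=> /andP[m0 m1] ml c10 c20.
have l0 : 0 < lam by exact: lt_trans ml.
(* This N makes the negative side summable: by [expRN_le] the term at -j is at most (N/c2)^N (lam
   m^N)^j. *)
have [N lN] : exists N, lam * m ^+ N < 1.
  have : lam * m ^+ j @[j --> \oo] --> 0.
    rewrite -[X in _ --> X](mulr0 lam); apply: cvgMl_tmp; apply: cvg_expr.
    by rewrite gtr0_norm.
  move=> /cvgrPdist_lt/(_ 1 ltr01)[j _ /(_ j (leqnn j))].
  by rewrite sub0r normrN ger0_norm ?mulr_ge0 ?exprn_ge0 ?ltW// => ?; exists j.
have h1 : hassum (fun n : nat => c1 * (m / lam) ^+ n) (c1 * (1 - m / lam)^-1).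
  apply: hassumZ => //; apply: hassum_geometric.
  by rewrite divr_ge0 ?ltW//= ltr_pdivrMr// mul1r.
pose q := lam * m ^+ N.
have h2 : hassum (fun n : nat => (N%:R / c2) ^+ N * q * q ^+ n)
    ((N%:R / c2) ^+ N * q * (1 - q)^-1).
  have qN : 0 <= (N%:R / c2) ^+ N by rewrite exprn_ge0 ?divr_ge0 ?(ltW c20).
  have q0 : 0 <= q by rewrite /q mulr_ge0 ?(ltW l0)// exprn_ge0 ?(ltW m0).
  apply: hassumZ; first exact: mulr_ge0.
  by apply: hassum_geometric; rewrite q0.
have h3 := hassum_int (f := fun n => if n is Negz j then
   (N%:R / c2) ^+ N * q * q ^+ j else c1 * (m / lam) ^ n) h1 h2.
apply: (hassum_dom h3 _).1 => -[] n /=.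
  by rewrite lexx mulr_ge0// exprn_ge0// divr_ge0 ?ltW.
rewrite mulr_ge0 ?expR_ge0 ?exprn_ge0 ?(ltW l0)//=.
have cm0 : 0 < c2 * (m ^+ n.+1)^-1 by rewrite mulr_gt0 ?invr_gt0 ?exprn_gt0.
rewrite -[- Negz n]/(Posz n.+1) -[m ^ Negz n]/((m ^+ n.+1)^-1) -[lam ^ _]/(lam ^+ n.+1).
apply: le_trans (ler_wpM2l _ (expRN_le N cm0)) _; first by rewrite exprn_ge0 ?ltW.
rewrite le_eqVlt; apply/orP; left; apply/eqP.
have -> : N%:R / (c2 / m ^+ n.+1) = N%:R / c2 * m ^+ n.+1.
  by field; rewrite !gt_eqF ?exprn_gt0.
by rewrite -[RHS]mulrA -exprS /q !exprMn -!exprM mulnC mulrCA.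
Qed.

Lemma le_dominating (lam m c1 c2 d1 d2 : R) n : 0 < lam -> 0 < m ->
  c1 <= d1 -> d2 <= c2 -> dominating lam m c1 c2 n <= dominating lam m d1 d2 n.
Proof.
move=> lam0 m0 c1d1 d2c2; case: n => n /=.
  by rewrite ler_wpM2r// exprn_ge0// divr_ge0 ?ltW.
rewrite ler_wpM2l ?exprn_ge0 ?(ltW lam0)// ler_expR lerN2 ler_wpM2r//.
by rewrite invr_ge0 exprn_ge0// ltW.
Qed.

Lemma cvg_expRN (I : Type) (F : set_system I) (f : I -> R) (a : R) : Filter F ->
  f @ F --> a -> expR (- f i) @[i --> F] --> expR (- a).
Proof.
move=> FF fa; apply: continuous_cvg; first exact: continuous_expR.
exact: cvgN.
Qed.

(** For small s, 1 - s lies between exp(-s/(1 - s)) and exp(-s). *)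
Lemma cvg_pow_expR (I : Type) (F : set_system I) (x : I -> nat) (s : I -> R) c :
  Filter F -> (forall i, 0 <= s i <= 1) -> s @ F --> 0 ->
  (x i)%:R * s i @[i --> F] --> c ->
  (1 - s i) ^+ x i @[i --> F] --> expR (- c).
Proof.
move=> FF s01 s0 xs.
apply: (@squeeze_cvgr _ _ _ _ (fun i => expR (- ((x i)%:R * s i * (1 - s i)^-1)))
  (fun i => expR (- ((x i)%:R * s i)))); last 2 first.
- apply: cvg_expRN; rewrite -[c]mulr1; apply: cvgM => //.
  have s1 : 1 - s i @[i --> F] --> (1 - 0 : R) by apply: cvgB => //; exact: cvg_cst.
  rewrite subr0 in s1; rewrite -[X in _ --> X]invr1.
  by apply: cvgV => //; exact: oner_neq0.
- exact: cvg_expRN.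
have /cvgrPdist_lt/(_ 1 ltr01) sd := s0.
near=> i; have /andP[si0 si1] := s01 i.
have : `|0 - s i| < 1 by near: i.
rewrite sub0r normrN ger0_norm// => {}si1.
have s1 : 0 < 1 - s i by rewrite subr_gt0.
apply/andP; split.
  rewrite -mulrA -mulrN mulrC expRM_natr lerXn2r ?nnegrE ?expR_ge0 ?(ltW s1)//.
  rewrite expRN -[leRHS]invrK lef_pV2 ?posrE ?expR_gt0 ?invr_gt0//.
  apply: le_trans (expR_ge1Dx _).
  by rewrite le_eqVlt; apply/orP; left; apply/eqP; field; lra.
rewrite -mulrN mulrC expRM_natr lerXn2r ?nnegrE ?expR_ge0 ?(ltW s1)//.
by have := expR_ge1Dx (- s i).
Unshelve. all: by end_near. Qed.

(** For z <= 1/2 and n >= 1, z^n <= 2z 2^-n. *)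
Lemma power_series_tail (a : nat -> R) (g : R -> R) z :
  (forall z, 0 < z < 1 -> hassum (fun n => a n * z ^+ n) (g z)) ->
  0 < z <= 2^-1 -> 0 <= g z - a 0%N <= 2 * z * g 2^-1.
Proof.
move=> ag /andP[z0 z2].
have z1 : 0 < z < 1 by rewrite z0; lra.
have h1 : 0 < (2^-1 : R) < 1 by apply/andP; split; lra.
have a0 n : 0 <= a n.
  by have := hassum_nneg (ag _ h1) n; rewrite pmulr_lge0// exprn_gt0.
have p1 := hassum_peel (ag _ z1); have p2 := hassum_peel (ag _ h1).
rewrite !expr0 !mulr1 in p1 p2; rewrite (hassum_ge0 p1)/=.
have z20 : 0 <= 2 * z by lra.
have le0 : 2 * z * (g 2^-1 - a 0%N) <= 2 * z * g 2^-1.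
  by rewrite ler_wpM2l// lerBlDr lerDl.
apply: le_trans le0; apply: (hassum_le p1 (hassumZ z20 p2)) => n.
rewrite mulrCA ler_wpM2l//.
have -> : z ^+ n.+1 = (2 * z) ^+ n.+1 * 2^-1 ^+ n.+1.
  by rewrite -exprMn mulrC mulKf.
have h0 : 0 <= (2^-1 : R) by lra.
rewrite ler_wpM2r ?exprn_ge0//.
by rewrite exprS ler_piMr// exprn_ile1//; lra.
Qed.

(** Continuity theorem for generating functions. The constant coefficient is caught at a small fixed
    z, where the tails are uniformly small; the others follow by subtracting it and dividing by
    z. *)
Lemma power_series_cvg (T : Type) (F : set_system T) (a : T -> nat -> R)
    (b : nat -> R) (g : T -> R -> R) (gb : R -> R) : ProperFilter F ->
  (forall t z, 0 < z < 1 -> hassum (fun n => a t n * z ^+ n) (g t z)) ->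
  (forall z, 0 < z < 1 -> hassum (fun n => b n * z ^+ n) (gb z)) ->
  (forall z, 0 < z < 1 -> g t z @[t --> F] --> gb z) ->
  forall n, a t n @[t --> F] --> b n.
Proof.
move=> FF ag bg gg n.
have base (a' : T -> nat -> R) (b' : nat -> R) (g' : T -> R -> R) (gb' : R -> R) :
  (forall t z, 0 < z < 1 -> hassum (fun n => a' t n * z ^+ n) (g' t z)) ->
  (forall z, 0 < z < 1 -> hassum (fun n => b' n * z ^+ n) (gb' z)) ->
  (forall z, 0 < z < 1 -> g' t z @[t --> F] --> gb' z) ->
  a' t 0%N @[t --> F] --> b' 0%N.
  move=> {}ag {}bg {}gg; apply/cvgrPdist_le => e e0.
  have h1 : 0 < (2^-1 : R) < 1 by apply/andP; split; lra.
  (* K bounds 2 (g' t (1/2) + gb' (1/2)) once g' t (1/2) is within 1 of its limit; the choice of z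
     then makes both tails together at most e/2. *)
  pose K := 4 * gb' 2^-1 + 2.
  have gb0 : 0 <= gb' 2^-1 by exact: hassum_ge0 (bg _ h1).
  have K0 : 0 < K by rewrite /K; lra.
  pose z := Num.min 2^-1 (e / 2 / K).
  have z0 : 0 < z by rewrite /z lt_min; apply/andP; split; [lra|rewrite !divr_gt0].
  have z2 : z <= 2^-1 by rewrite /z ge_min lexx.
  have zK : z * K <= e / 2 by rewrite -ler_pdivlMr// /z ge_min lexx orbT.
  have z1 : 0 < z < 1 by rewrite z0; lra.
  have zz : 0 < z <= 2^-1 by rewrite z0.
  have /cvgrPdist_le/(_ _ ltr01) g1 := gg _ h1.
  have /cvgrPdist_le/(_ (e / 2) ltac:(lra)) g2 := gg _ z1.
  near=> t.
  have := power_series_tail (ag t) zz; have := power_series_tail bg zz.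
  have /ler_normlP[? ?] : `|gb' 2^-1 - g' t 2^-1| <= 1 by near: t.
  have /ler_normlP[? ?] : `|gb' z - g' t z| <= e / 2 by near: t.
  move=> /andP[? ?] /andP[? ?].
  have ? : 2 * z * g' t 2^-1 + 2 * z * gb' 2^-1 <= z * K by rewrite /K; nra.
  by apply/ler_normlP; split; lra.
elim: n a b g gb ag bg gg => [|n IH] a b g gb ag bg gg; first exact: (base _ _ _ _ ag bg gg).
have z0 (z : R) : 0 < z < 1 -> 0 <= z^-1 by case/andP => z0 _; rewrite invr_ge0 ltW.
have peel (c : nat -> R) (G : R -> R) z : 0 < z < 1 ->
  hassum (fun n => c n * z ^+ n) (G z) ->
  hassum (fun n => c n.+1 * z ^+ n) ((G z - c 0%N) / z).
  move=> z01 /hassum_peel; rewrite expr0 mulr1 => /(hassumZr (z0 _ z01)).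
  apply: hassum_eq => k; rewrite exprSr -!mulrA divff ?mulr1// gt_eqF//.
  by case/andP: z01.
apply: (IH (fun t n => a t n.+1) (fun n => b n.+1)
  (fun t z => (g t z - a t 0%N) / z) (fun z => (gb z - b 0%N) / z)).
- by move=> t z z01; exact: peel z01 (ag t z z01).
- by move=> z z01; exact: peel z01 (bg z z01).
- move=> z z01; apply: cvgMr_tmp; apply: cvgB; first exact: gg.
  exact: (base _ _ _ _ ag bg gg).
Unshelve. all: by end_near. Qed.

End Series.

(** * Offspring generating functions *)

Section PowerInequalities.
Context {R : realType}.
Implicit Types (c t z : R) (k : nat).

(** Convexity of z^k; it makes (1 - (1 - t)^k)/t nonincreasing, hence [surv_star]. *)
Lemma expr_convex_mix c z k : 0 <= c <= 1 -> 0 <= z <= 1 ->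
  ((1 - c) + c * z) ^+ k <= (1 - c) + c * z ^+ k.
Proof.
move=> c01 z01; elim: k => [|k IH]; first by rewrite !expr0; lra.
have w01 : 0 <= z ^+ k <= 1 by rewrite exprn_ge0 ?exprn_ile1//; lra.
rewrite !exprS; apply: le_trans (ler_wpM2l _ IH) _; first by nra.
move: (z ^+ k) w01 => w w01.
rewrite -subr_ge0 (_ : _ - _ = c * (1 - c) * ((1 - z) * (1 - w))); last by ring.
by rewrite !mulr_ge0//; lra.
Qed.

Lemma one_minus_expr_range t k : 0 <= t <= 1 -> 0 <= 1 - (1 - t) ^+ k <= 1.
Proof.
move=> t01; have : 0 <= (1 - t) ^+ k <= 1 by rewrite exprn_ge0 ?exprn_ile1//; lra.
by lra.
Qed.

Lemma one_minus_expr_star c t k : 0 <= c <= 1 -> 0 <= t <= 1 ->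
  c * (1 - (1 - t) ^+ k) <= 1 - (1 - c * t) ^+ k.
Proof.
move=> c01 t01; have := @expr_convex_mix c (1 - t) k c01.
rewrite (_ : 1 - c + c * (1 - t) = 1 - c * t); last by ring.
by move=> /(_ _)/wrap[|]; lra.
Qed.

Lemma one_minus_expr_mono s t k : 0 <= s -> s <= t -> t <= 1 ->
  1 - (1 - s) ^+ k <= 1 - (1 - t) ^+ k.
Proof.
move=> s0 st t1; rewrite lerD2l lerN2; case: k => // k.
by rewrite lerXn2r ?nnegrE//; lra.
Qed.

Lemma one_minus_expr_le t k : 0 <= t <= 1 -> 1 - (1 - t) ^+ k <= k%:R * t.
Proof.
move=> t01; elim: k => [|k IH]; first by rewrite expr0; lra.
have := one_minus_expr_range k t01.
by rewrite exprS -natr1; nra.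
Qed.

Lemma one_minus_expr_ge t k : 0 <= t <= 1 ->
  k%:R * t - (k%:R * t) ^+ 2 <= 1 - (1 - t) ^+ k.
Proof.
move=> t01; elim: k => [|k IH]; first by rewrite expr0; lra.
have := one_minus_expr_le k t01.
have k0 : 0 <= k%:R :> R by [].
rewrite [(1 - t) ^+ k.+1]exprS -natr1; move: (k%:R) (_ ^+ k) k0 IH => a w a0 IH le.
have t0 : 0 <= t by lra.
have h1 := ler_wpM2l t0 le.
have h2 : 0 <= a * t ^+ 2 by rewrite mulr_ge0// exprn_ge0.
have h3 : 0 <= t ^+ 2 by rewrite exprn_ge0.
rewrite -subr_ge0 in IH; rewrite -subr_ge0 in h1; rewrite -subr_ge0.
rewrite (_ : _ - _ = (1 - w - (a * t - (a * t) ^+ 2)) +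
  (t * (a * t) - t * (1 - w)) + a * t ^+ 2 + t ^+ 2); last by ring.
exact: (addr_ge0 (addr_ge0 (addr_ge0 IH h1) h2) h3).
Qed.

End PowerInequalities.

Section Convolution.
Context {R : realType}.

Lemma hassum_finsupp (f : nat -> R) N : (forall n, 0 <= f n) ->
  (forall n, (N <= n)%N -> f n = 0) -> hassum f (\sum_(j < N) f j).
Proof.
move=> f0 fN; apply: hassum_series => //; apply: cvg_near_cst.
exists N => // k /= Nk; rewrite /series /= -(big_mkord xpredT f).
rewrite (big_cat_nat (n := N))//= [X in _ + X]big1_seq ?addr0// => j.
by rewrite mem_index_iota => /andP[_ /andP[/fN]].
Qed.

Lemma hassum_convolution (a b : nat -> R) A B : hassum a A -> hassum b B ->
  hassum (fun n => \sum_(j < n.+1) a j * b (n - j)%N) (A * B).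
Proof.
move=> aA bB; pose F j n := if (j <= n)%N then a j * b (n - j)%N else 0.
have F0 j n : 0 <= F j n.
  by rewrite /F; case: ifP => // _; rewrite mulr_ge0// ?(hassum_nneg aA) ?(hassum_nneg bB).
apply: (@hassum_exchange _ _ _ F (fun j => a j * B)).
- move=> j; apply/(hassum_inj (e := addn j)) => [|n h|].
  + exact: addnI.
  + by rewrite /F; case: leqP => // jn; case: h; exists (n - j)%N => //; rewrite subnKC.
  + apply: hassum_eq (hassumZ (hassum_nneg aA j) bB) => n.
    by rewrite /F /= leq_addr addKn.
- move=> n; have := @hassum_finsupp (F^~ n) n.+1 (F0^~ n).
  rewrite (eq_bigr (fun j : 'I_n.+1 => a j * b (n - j)%N)) => [|j _].
    apply => j nj; rewrite /F leqNgt.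
    by rewrite ifF//; apply/negbTE; rewrite negbK.
  by rewrite /F -ltnS ltn_ord.
- exact: hassumZr (hassum_ge0 bB) aA.
Qed.
End Convolution.

Definition pgf (R : realType) (p : nat -> R) (z : R) : R :=
  rsum (fun k => p k * z ^+ k).

(** The probability that at least one child is kept when each is kept with probability t; the k-th
    iterate at 1 is the probability of survival to generation k. *)
Definition survival (R : realType) (p : nat -> R) (t : R) : R :=
  1 - pgf p (1 - t).

Record subcritical (R : realType) (p : nat -> R) (m : R) : Prop := Subcritical {
  subcritical_law : offspring_law p;
  subcritical_mean : has_mean p m;
  subcritical_m01 : 0 < m < 1 }.

Section Offspring.
Context {R : realType} {p : nat -> R} {m : R}.
Hypothesis p_law : offspring_law p.
Hypothesis p_mean : has_mean p m.
Hypothesis m01 : 0 < m < 1.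

Lemma p_ge0 k : 0 <= p k. Proof. by case: p_law. Qed.

Lemma p_hassum : hassum p 1.
Proof.
split; first exact: p_ge0.
by case: p_law => p0; rewrite nneseries_esumT.
Qed.

Lemma mean_hassum : hassum (fun k => k%:R * p k) m.
Proof.
have p0 k : 0 <= k%:R * p k by rewrite mulr_ge0// p_ge0.
by split => //; have := p_mean; rewrite /has_mean nneseries_esumT.
Qed.

Lemma pgf_hassum z : 0 <= z <= 1 -> hassum (fun k => p k * z ^+ k) (pgf p z).
Proof.
move=> /andP[z0 z1]; apply: (hassum_dom p_hassum _).1 => k.
by rewrite mulr_ge0 ?p_ge0 ?exprn_ge0//= ler_piMr ?p_ge0// exprn_ile1.
Qed.

Lemma survival_hassum t : 0 <= t <= 1 ->
  hassum (fun k => p k * (1 - (1 - t) ^+ k)) (survival p t).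
Proof.
move=> t01; have z01 : 0 <= 1 - t <= 1 by lra.
apply: hassum_eq (hassumB _ p_hassum (pgf_hassum z01)) => [k|k].
  by rewrite mulrBr mulr1.
case/andP: z01 => z0 z1.
by rewrite mulr_ge0 ?p_ge0 ?exprn_ge0//= ler_piMr ?p_ge0// exprn_ile1.
Qed.

Lemma survival_survival_map : survival_map m (survival p).
Proof.
split.
- move=> t t01; have s := survival_hassum t01; rewrite (hassum_ge0 s)/=.
  apply: (hassum_le s p_hassum) => k; rewrite ler_piMr ?p_ge0//.
  by case/andP: (one_minus_expr_range k t01).
- move=> t t01; have t01' : 0 <= t <= 1 by lra.
  have s := survival_hassum t01'; apply: contrapT => /negP.
  rewrite -leNgt => s0.
  have pk k : p k.+1 = 0.
    have := hassum_term k.+1 s; have := one_minus_expr_star k.+1 t01' (t := 1).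
    rewrite subrr mulr1 exprS mul0r subr0 mulr1 => /(_ _)/wrap[|a b]; first lra.
    have := p_ge0 k.+1; rewrite le_eqVlt => /predU1P[//|pk0].
    have : 0 < p k.+1 * t by rewrite mulr_gt0//; lra.
    have : p k.+1 * t <= p k.+1 * (1 - (1 - t) ^+ k.+1) by rewrite ler_pM2l.
    lra.
  have : m = 0.
    apply: (hassum_uniq mean_hassum); apply: hassum_eq (hassum0 _) => -[|k].
      by rewrite mul0r.
    by rewrite pk mulr0.
  by case/andP: m01 => + _ => /[swap] ->; rewrite ltxx.
- move=> s t s0 st t1.
  have s1 : 0 <= s <= 1 by lra. have t01 : 0 <= t <= 1 by lra.
  apply: (hassum_le (survival_hassum s1) (survival_hassum t01)) => k.
  by rewrite ler_wpM2l ?p_ge0// one_minus_expr_mono.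
- move=> c t c01 t01.
  have ct : 0 <= c * t <= 1 by nra.
  have c0 : 0 <= c by lra.
  apply: (hassum_le (hassumZ c0 (survival_hassum t01)) (survival_hassum ct)) => k.
  by rewrite mulrCA ler_wpM2l ?p_ge0// one_minus_expr_star.
- move=> t t01; have t0 : 0 <= t by lra.
  apply: (hassum_le (survival_hassum t01) (hassumZr t0 mean_hassum)) => k.
  by rewrite (mulrC k%:R) -mulrA ler_wpM2l ?p_ge0// one_minus_expr_le.
(* Without a second moment, the mean is truncated to a finite set with loss e/2; the quadratic error
   C t^2 is then absorbed for t < d. *)
- move=> e e0; have e20 : 0 < e / 2 by lra.
  have [s us ms] := hassum_adherent mean_hassum e20.
  pose C := \sum_(k <- s) p k * k%:R ^+ 2.
  have C0 : 0 <= C by apply: sumr_ge0 => k _; rewrite mulr_ge0 ?p_ge0 ?exprn_ge0.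
  exists (e / 2 / (C + 1)); first by rewrite divr_gt0//; lra.
  move=> t /andP[t0 td] t1; have t01 : 0 <= t <= 1 by lra.
  apply: le_trans (hassum_partial (survival_hassum t01) us).
  apply: (@le_trans _ _ (\sum_(k <- s) (k%:R * p k * t - p k * k%:R ^+ 2 * t ^+ 2))).
    rewrite sumrB -!mulr_suml -/C.
    by move: td; rewrite ltr_pdivlMr; [nra|lra].
  apply: ler_sum => k _.
  have := one_minus_expr_ge k t01.
  by move=> /(ler_wpM2l (p_ge0 k)); apply: le_trans; rewrite le_eqVlt; apply/orP; left; apply/eqP; ring.
Qed.

Lemma BGW_hassum x z : 0 <= z <= 1 ->
  hassum (fun y => BGW_transition p x y * z ^+ y) (pgf p z ^+ x).
Proof.
move=> z01; elim: x => [|x IH].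
  have := @hassum_finsupp _ (fun y => (y == 0%N)%:R * z ^+ y) 1.
  rewrite big_ord1 !expr0 mulr1 /=; apply => [n|[]// n _].
    by case: eqP => [->|_]; rewrite ?expr0 ?mul0r ?mulr1.
  by rewrite mul0r.
rewrite exprS; apply: hassum_eq (hassum_convolution (pgf_hassum z01) IH) => y /=.
rewrite mulr_suml; apply: eq_bigr => j _.
rewrite mulrACA -exprD subnKC// -ltnS; exact: ltn_ord.
Qed.

End Offspring.

(** * Generating functions on Npos *)

Definition npos (n : nat) : Npos :=
  exist _ n.+1 (mem_set (isT : [set n : nat | (0 < n)%N] n.+1)).

Definition pred_npos (x : Npos) : nat := (\val x).-1.

Lemma Npos_gt0 (x : Npos) : (0 < \val x)%N.
Proof. by case: x => n /= /set_mem. Qed.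

Lemma nposK : cancel npos pred_npos.
Proof. by []. Qed.

Lemma pred_nposK : cancel pred_npos npos.
Proof. by move=> x; apply: val_inj => /=; rewrite /pred_npos prednK// Npos_gt0. Qed.

Section Survivors.
Context {R : realType}.

(* The probability that, of [x] individuals each kept independently with
   probability [t], none (resp. at least one) is kept. *)
Definition none (t : R) (x : Npos) : R := (1 - t) ^+ \val x.
Definition some (t : R) (x : Npos) : R := 1 - none t x.

Lemma none1 x : none 1 x = 0.
Proof. by rewrite /none subrr expr0n gtn_eqF// Npos_gt0. Qed.

Lemma some1 x : some 1 x = 1.
Proof. by rewrite /some none1 subr0. Qed.

Lemma none_range t x : 0 <= t <= 1 -> 0 <= none t x <= 1.
Proof. by move=> t01; rewrite /none exprn_ge0 ?exprn_ile1//; lra. Qed.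

Lemma none_gt0 t x : 0 <= t < 1 -> 0 < none t x.
Proof. by move=> t01; rewrite /none exprn_gt0//; lra. Qed.

Lemma none_mono s t x : 0 <= s -> s <= t -> t <= 1 -> none t x <= none s x.
Proof.
move=> s0 st t1; have := one_minus_expr_mono (\val x) s0 st t1.
by rewrite -/(none s x) -/(none t x); lra.
Qed.

(** Squares stay in the family, so second moments are again transforms. *)
Lemma none_sqr t x : none t x ^+ 2 = none (2 * t - t ^+ 2) x.
Proof. by rewrite /none -exprM mulnC exprM; congr (_ ^+ _); ring. Qed.

Lemma hassum_Npos (f : nat -> R) v : f 0%N = 0 ->
  hassum f v -> hassum (fun x : Npos => f (\val x)) v.
Proof.
move=> f0; apply: (iffRL (hassum_inj _ val_inj _)) => -[|n] h //.
by case: h; exists (npos n).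
Qed.

Lemma hassum_none_geometric t : 0 < t <= 1 -> hassum (none t) (rsum (none t)).
Proof.
move=> t01; have z01 : 0 <= 1 - t < 1 by lra.
have h := hassum_geometric z01.
have h1 : hassum (fun x : nat => if x is 0%N then 0 else (1 - t) ^+ x)
    (rsum (fun x : nat => if x is 0%N then 0 else (1 - t) ^+ x)).
  apply: (hassum_dom h _).1 => -[|n]; first by rewrite expr0 lexx ler01.
  by rewrite lexx exprn_ge0//; lra.
apply: (hassum_dom (hassum_Npos _ h1) _).1 => // x.
by rewrite /none; case: (\val x) (Npos_gt0 x) => // n _; rewrite lexx exprn_ge0//; lra.
Qed.

(** On Npos the series in z = 1 - t starts at z^1, so it is divided by z before [power_series_cvg]
    applies. *)
Lemma Npos_power_series_cvg (T : Type) (F : set_system T) (a : T -> Npos -> R)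
    (b : Npos -> R) (g : T -> R -> R) (gb : R -> R) : ProperFilter F ->
  (forall i t, 0 < t < 1 -> hassum (fun x => a i x * none t x) (g i t)) ->
  (forall t, 0 < t < 1 -> hassum (fun x => b x * none t x) (gb t)) ->
  (forall t, 0 < t < 1 -> g i t @[i --> F] --> gb t) ->
  forall x, a i x @[i --> F] --> b x.
Proof.
move=> FF ag bg gg x; rewrite -(pred_nposK x).
have shift (c : Npos -> R) (G : R -> R) z : 0 < z < 1 ->
  hassum (fun x => c x * none (1 - z) x) (G (1 - z)) ->
  hassum (fun n => c (npos n) * z ^+ n) (G (1 - z) / z).
  move=> z01 cG; have z0 : 0 <= z^-1 by rewrite invr_ge0; lra.
  apply/(hassum_bij (e := pred_npos) (e' := npos)); [exact: pred_nposK|exact: nposK|].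
  apply: hassum_eq (hassumZr z0 cG) => y /=.
  rewrite pred_nposK /none subKr -mulrA; congr (_ * _).
  rewrite /pred_npos; case: (\val y) (Npos_gt0 y) => // n _ /=.
  by rewrite exprSr mulfK// gt_eqF//; case/andP: z01.
apply: (power_series_cvg (g := fun i z => g i (1 - z) / z)
  (gb := fun z => gb (1 - z) / z) (a := fun i n => a i (npos n))
  (b := fun n => b (npos n))).
- by move=> i z z01; apply: (shift (a i) (g i)) => //; apply: ag; lra.
- by move=> z z01; apply: shift => //; apply: bg; lra.
- by move=> z z01; apply: cvgMr_tmp; apply: gg; lra.
Qed.

(** Uniqueness is the continuity theorem applied to a constant family. *)
Lemma Npos_power_series_inj (a b : Npos -> R) (g : R -> R) :
  (forall t, 0 < t < 1 -> hassum (fun x => a x * none t x) (g t)) ->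
  (forall t, 0 < t < 1 -> hassum (fun x => b x * none t x) (g t)) -> a =1 b.
Proof.
move=> ag bg x.
have c1 : a x @[_ --> \oo] --> b x.
  apply: (@Npos_power_series_cvg nat \oo (fun=> a) b (fun=> g) g) => // t _.
  exact: cvg_cst.
have c2 : a x @[_ --> \oo] --> a x by exact: cvg_cst.
exact: (cvg_unique _ c2 c1).
Qed.

End Survivors.

(** * Transforms of the powers of the killed kernel *)

Section Kernel.
Context {R : realType} {p : nat -> R} {m : R}.
Hypothesis pm : subcritical p m.

Let p_law := subcritical_law pm.
Let m01 := subcritical_m01 pm.

Local Notation P := (killed (BGW_transition p)).
Local Notation T := (survival p).
Let HT := survival_survival_map p_law (subcritical_mean pm) m01.

Lemma BGW_ge0 x y : 0 <= BGW_transition p x y.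
Proof.
elim: x y => [|x IH] y /=; first by [].
by apply: sumr_ge0 => j _; rewrite mulr_ge0 ?(p_ge0 p_law).
Qed.

(** 1 - (1 - t)^y vanishes at y = 0, so killing at 0 does not change the sum. *)
Lemma killed_some w t : 0 <= t <= 1 ->
  hassum (fun y => P w y * some t y) (some (T t) w).
Proof.
move=> t01; have z01 : 0 <= 1 - t <= 1 by lra.
have o01 : 0 <= (1 : R) <= 1 by lra.
have h1 := BGW_hassum p_law (\val w) o01.
have pgf1 : pgf p 1 = 1.
  apply: (hassum_uniq (pgf_hassum p_law o01)).
  by apply: hassum_eq (p_hassum p_law) => k; rewrite expr1n mulr1.
rewrite pgf1 expr1n in h1.
have h2 := BGW_hassum p_law (\val w) z01.
have h3 : hassum (fun y => BGW_transition p (\val w) y * (1 - (1 - t) ^+ y))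
    (1 - pgf p (1 - t) ^+ \val w).
  apply: hassum_eq (hassumB _ h1 h2) => [y|y].
    by rewrite expr1n mulrBr.
  have [z0 z1] := andP z01.
  by rewrite expr1n mulr_ge0 ?BGW_ge0 ?exprn_ge0//= ler_wpM2l ?BGW_ge0// exprn_ile1.
rewrite /some /none /survival subKr.
by apply: (hassum_Npos _ h3); rewrite expr0 subrr mulr0.
Qed.

Definition steps k (x y : Npos) : R := fine (kernel_pow P k x y).

(** Finiteness of the entries and the transform go through one induction: the transform at t = 1,
    where [some] is 1, bounds the sums that define the next power. *)
Lemma steps_spec k x :
  (forall y, kernel_pow P k x y = (steps k x y)%:E) /\
  forall t, 0 <= t <= 1 ->
    hassum (fun y => steps k x y * some t y) (some (iter k T t) x).
Proof.
elim: k => [|k [kE IH]].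
  split=> // t t01 /=.
  have h : hassum (fun y : Npos => if y == x then some t x else 0) (some t x).
    have s0 : 0 <= some t x by have := none_range x t01; rewrite /some; lra.
    apply/(hassum_inj (e := fun _ : unit => x)) => [[] []//|j h|].
      by case: eqP => // ji; case: h; exists tt.
    split => [[]/=|]; first by rewrite eqxx.
    rewrite (_ : [set: unit] = [set tt]); last by apply/seteqP; split=> [[]|[]].
    by rewrite esum_set1/= eqxx// lee_fin.
  apply: hassum_eq h => y; rewrite /steps /= eq_sym.
  by case: eqP => [->|_]; rewrite ?mul1r ?mul0r.
have o01 : 0 <= (1 : R) <= 1 by lra.
have s0 z : 0 <= steps k x z.
  by have := hassum_nneg (IH _ o01) z; rewrite some1 mulr1.
have row t z : 0 <= t <= 1 -> hassum (fun y => steps k x z * P z y * some t y)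
    (steps k x z * some (T t) z).
  move=> t01; apply: hassum_eq (hassumZ (s0 z) (killed_some z t01)) => y.
  by rewrite mulrA.
have tot t : 0 <= t <= 1 -> hassum (fun z => steps k x z * some (T t) z)
    (some (iter k.+1 T t) x).
  by move=> t01; rewrite iterSr; apply: IH; exact: surv_range HT _ t01.
have col y : hassum (fun z => steps k x z * P z y) (rsum (fun z => steps k x z * P z y)).
  have h := hassum_col (fun z => row 1 z o01) (tot _ o01) y.
  suff <- : (fun z => steps k x z * P z y * some 1 y) =
      (fun z => steps k x z * P z y) by [].
  by apply/funext => z; rewrite some1 mulr1.
have E y : kernel_pow P k.+1 x y = (rsum (fun z => steps k x z * P z y))%:E.
  rewrite -(col y).2 /=; apply: eq_esum => z _.
  by rewrite kE EFinM.
have SE y : steps k.+1 x y = rsum (fun z => steps k x z * P z y).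
  by rewrite /steps E.
split => [y|t t01]; first by rewrite E SE.
apply: (hassum_exchange (fun z => row t z t01)) (tot _ t01) => y.
rewrite SE; apply: hassumZr; last exact: col.
by have := none_range y t01; rewrite /some; lra.
Qed.

Lemma steps_ge0 k x y : 0 <= steps k x y.
Proof.
have o01 : 0 <= (1 : R) <= 1 by lra.
by have := hassum_nneg ((steps_spec k x).2 _ o01) y; rewrite some1 mulr1.
Qed.

Lemma steps_succ k x y :
  hassum (fun z => steps k x z * P z y) (steps k.+1 x y).
Proof.
split => [z|]; first by rewrite mulr_ge0 ?steps_ge0 ?BGW_ge0.
rewrite -(steps_spec k.+1 x).1 /=; apply: eq_esum => z _.
by rewrite (steps_spec k x).1 EFinM.
Qed.

(** The subtracted term is the probability of extinction by generation k, which the full generating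
    function puts at 0. *)
Lemma steps_none k x t : 0 <= t <= 1 ->
  hassum (fun y => steps k x y * none t y)
    (none (iter k T t) x - none (iter k T 1) x).
Proof.
move=> t01; have o01 : 0 <= (1 : R) <= 1 by lra.
have h1 := (steps_spec k x).2 _ o01; have h2 := (steps_spec k x).2 _ t01.
have -> : none (iter k T t) x - none (iter k T 1) x =
  some (iter k T 1) x - some (iter k T t) x by rewrite /some; ring.
apply: hassum_eq (hassumB _ h1 h2) => y; first by rewrite some1 /some; ring.
rewrite some1 mulr1 /some; have := none_range y t01 => ny.
apply/andP; split; first by apply: mulr_ge0; [exact: steps_ge0|lra].
by apply: ler_piMr; [exact: steps_ge0|lra].
Qed.

Lemma killed_none w t : 0 <= t <= 1 ->
  hassum (fun y => P w y * none t y) (none (T t) w - none (T 1) w).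
Proof.
move=> t01; have := steps_none 1 w t01; rewrite /=; apply: hassum_eq => y.
congr (_ * _); apply: (hassum_uniq (steps_succ 0 w y)).
have -> : P w y = (if w == w then P w y else 0) by rewrite eqxx.
apply/(hassum_inj (e := fun _ : unit => w) (f := fun z => steps 0 w z * P z y)).
- by move=> [] [].
- move=> z h; rewrite /steps /=; case: eqP => [wz|_]; last by rewrite mul0r.
  by case: h; exists tt.
split => [[]|]; first by rewrite /= mulr_ge0 ?steps_ge0 ?BGW_ge0.
rewrite (_ : [set: unit] = [set tt]); last by apply/seteqP; split=> [[]|[]].
rewrite esum_set1/= /steps /= eqxx ?mul1r// lee_fin; exact: BGW_ge0.
Qed.

End Kernel.

Arguments steps {R} p k x y.

(** * Compound Poisson laws of Yaglom clusters *)

(** Compactness of a segment along an ultrafilter, in place of a diagonal subsequence. *)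
Lemma ultra_bounded_cvg (R : realType) (I : Type) (U : set_system I)
    (u : I -> R) (a b : R) :
  UltraFilter U -> (forall i, a <= u i <= b) -> exists l : R, u @ U --> l.
Proof.
move=> UU uab.
have [|l [_ cl]] := @segment_compact R a b (fmap u U) _.
  by apply: nearW => i /=; rewrite in_itv/= uab.
exists l => V nV; have [//|h] := in_ultra_setVsetC (u @^-1` V) UU.
by have [x []] := cl (~` V) V h nV.
Qed.

Lemma hassum_bounded (R : realType) (I : choiceType) (f : I -> R) B :
  (forall i, 0 <= f i) -> (forall s, uniq s -> \sum_(i <- s) f i <= B) ->
  hassum f (rsum f) /\ rsum f <= B.
Proof.
move=> f0 fB.
have le : (\esum_(i in [set: I]) (f i)%:E <= B%:E)%E.
  apply: ge_ereal_sup => _ [X [finX _] <-].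
  by rewrite fsbig_finite// sumEFin lee_fin; apply: fB; exact: finmap.fset_uniq.
have fin : (\esum_(i in [set: I]) (f i)%:E \is a fin_num)%E.
  rewrite ge0_fin_numE; last by apply: esum_ge0 => i _; rewrite lee_fin.
  by apply: le_lt_trans le _; rewrite ltry.
split; first by split => //; rewrite /rsum fineK.
by rewrite -lee_fin /rsum fineK.
Qed.

Section CompoundPoisson.
Context {R : realType} {p : nat -> R} {m : R}.
Hypothesis pm : subcritical p m.

Let p_law := subcritical_law pm.
Let m01 := subcritical_m01 pm.

Local Notation P := (killed (BGW_transition p)).
Local Notation T := (survival p).
Local Notation h := (koenigs T).
Let HT := survival_survival_map p_law (subcritical_mean pm) m01.
Let s_gt0 k := iter_gt0 HT k one_in01.

(* The number of individuals that makes the expected number of them with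
   descendants at generation [k] close to [b]. *)
Definition critical_size (b : R) (k : nat) : Npos :=
  npos (Num.truncn (b / iter k T 1)).

Lemma critical_size_cvg b : 0 < b ->
  (\val (critical_size b k))%:R * iter k T 1 @[k --> \oo] --> b.
Proof.
move=> b0.
have s0 : iter k T 1 @[k --> \oo] --> 0 by apply: (iter_cvg0 HT m01); lra.
(* [npos] adds 1 to the integer part, whence the bounds b and b + T^k(1). *)
apply: (@squeeze_cvgr _ _ _ _ (fun=> b) (fun k => b + iter k T 1)).
- near=> k; have /andP[sk _] := s_gt0 k.
  have bs : 0 <= b / iter k T 1 by rewrite divr_ge0 ?ltW.
  have /andP[le lt] := Num.Theory.truncn_itv bs.
  rewrite /critical_size /= -ler_pdivrMr// ltW//=.
  by rewrite -natr1 mulrDl mul1r lerD2r -ler_pdivlMr.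
- exact: cvg_cst.
- by rewrite -[X in _ --> X]addr0; apply: cvgD => //; exact: cvg_cst.
Unshelve. all: by end_near. Qed.

Lemma none_iter_cvg (I : Type) (F : set_system I) (x : I -> Npos) (k : I -> nat)
    (b t : R) : ProperFilter F -> k @ F --> \oo -> 0 <= t <= 1 ->
  (\val (x i))%:R * iter (k i) T 1 @[i --> F] --> b ->
  none (iter (k i) T t) (x i) @[i --> F] --> expR (- (b * h t)).
Proof.
move=> FF koo t01 xs;
apply: (@cvg_pow_expR _ _ _ (fun i => \val (x i)) (fun i => iter (k i) T t)).
- by move=> i; exact: iter_range HT _ _ t01.
- exact: (cvg_comp _ _ koo (iter_cvg0 HT m01 t01)).
- have E i : (\val (x i))%:R * iter (k i) T t =
    ((\val (x i))%:R * iter (k i) T 1) * (iter (k i) T t / iter (k i) T 1).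
    by have /andP[sk _] := s_gt0 (k i); field; rewrite gt_eqF.
  under eq_cvg do rewrite E.
  by apply: cvgM => //; exact: (cvg_comp _ _ koo (koenigs_cvg HT t01)).
Qed.

(* Killed at 0, a Poisson number of mean [b] of independent clusters, the size of a
   cluster having the Yaglom generating function z |-> 1 - h (1 - z). *)
Definition has_cpoisson_transform (b : R) (pi : Npos -> R) : Prop :=
  forall t, 0 < t <= 1 ->
    hassum (fun x => pi x * none t x) (expR (- (b * h t)) - expR (- b)).

(** A limit of the k-step laws from [critical_size b k], so the Yaglom law itself is never built: an
    ultrafilter gives the pointwise limits, and [none t], being summable for t > 0, lets the
    transform pass to the limit. *)
Lemma cpoisson_exists b : 0 < b -> exists pi, has_cpoisson_transform b pi.
Proof.
move=> b0; pose x := critical_size b.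
have [U [UU ooU]] := @ultraFilterLemma nat \oo _.
have o01 : 0 <= (1 : R) <= 1 by lra.
have st1 k y : 0 <= steps p k (x k) y <= 1.
  rewrite (steps_ge0 pm)//=.
  have h1 := (steps_spec pm k (x k)).2 _ o01.
  have := hassum_term y h1; rewrite some1 mulr1 => /le_trans; apply.
  have := @none_range _ (iter k T 1) (x k); rewrite /some.
  by case/andP: (s_gt0 k) => /ltW -> -> /(_ isT); lra.
have /choice[pi piU] y := ultra_bounded_cvg UU (fun k => st1 k y).
exists pi => t t01; have t01' : 0 <= t <= 1 by lra.
have [hpi cpi] : hassum (fun y => pi y * none t y) (rsum (fun y => pi y * none t y)) /\
    rsum (fun y => steps p k (x k) y * none t y) @[k --> U] -->
    rsum (fun y => pi y * none t y).
  apply: hassum_dominated_cvg (hassum_none_geometric t01) _ _.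
    apply: nearW => k y; have /andP[n0 n1] := none_range y t01'.
    by case/andP: (st1 k y) => ? ?; rewrite mulr_ge0//= ler_piMl.
  by move=> y; apply: cvgMr_tmp; exact: piU.
suff <- : rsum (fun y => pi y * none t y) = expR (- (b * h t)) - expR (- b) by [].
suff cE : rsum (fun y => steps p k (x k) y * none t y) @[k --> U] -->
    (expR (- (b * h t)) - expR (- b)) by exact: (cvg_unique _ cpi cE).
have E k : rsum (fun y => steps p k (x k) y * none t y) =
    none (iter k T t) (x k) - none (iter k T 1) (x k).
  by apply: hassum_rsum; exact: steps_none pm _ _ _ t01'.
under eq_cvg do rewrite E.
apply: (cvg_trans (cvg_app _ ooU)).
rewrite -[in expR (- b)](mulr1 b) -{2}(koenigs1 HT).
by apply: cvgB; apply: none_iter_cvg => //; exact: critical_size_cvg.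
Qed.

(** For b > 0 the transform determines the measure by [Npos_power_series_inj], so the choice is
    immaterial. *)
Definition cpoisson (b : R) : Npos -> R :=
  xget (fun=> 0) [set pi | has_cpoisson_transform b pi].

Lemma cpoisson_hassum b t : 0 < b -> 0 < t <= 1 ->
  hassum (fun x => cpoisson b x * none t x) (expR (- (b * h t)) - expR (- b)).
Proof. by move=> b0; apply: (xgetPex (fun=> 0) (cpoisson_exists b0)). Qed.

Lemma cpoisson_ge0 b x : 0 < b -> 0 <= cpoisson b x.
Proof.
move=> b0; have t2 : 0 < (2^-1 : R) <= 1 by lra.
have := hassum_nneg (cpoisson_hassum b0 t2) x.
by rewrite pmulr_lge0// none_gt0//; lra.
Qed.

Lemma none_cvg1 (x : Npos) : none ((n.+2%:R : R)^-1) x @[n --> \oo] --> (1 : R).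
Proof.
have c0 : 1 - (n.+2%:R : R)^-1 @[n --> \oo] --> (1 - 0 : R).
  apply: cvgB; first exact: cvg_cst.
  by have := @cvg_harmonic R; rewrite -(cvg_shiftn 1); under eq_fun do rewrite addn1.
rewrite subr0 in c0; rewrite -[X in _ --> X](expr1n _ (\val x)).
by apply: (@continuous_cvg _ R R _ _ _ (fun u : R => u ^+ \val x) _ _ c0);
  exact: exprn_continuous.
Qed.

(** The transform of a finite partial sum is at most exp(0) - exp(-b); then t -> 0 along 1/(n +
    2). *)
Lemma cpoisson_mass b : 0 < b ->
  hassum (cpoisson b) (rsum (cpoisson b)) /\ rsum (cpoisson b) <= 1 - expR (- b).
Proof.
move=> b0; apply: hassum_bounded => [x|s us]; first exact: cpoisson_ge0.
have c1 : \sum_(x <- s) cpoisson b x * none ((n.+2%:R : R)^-1) x @[n --> \oo] -->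
    \sum_(x <- s) cpoisson b x.
  apply: cvg_big => [|x _]; first exact: add_continuous.
  rewrite -[X in _ --> X]mulr1; apply: cvgM; [exact: cvg_cst|exact: none_cvg1].
apply: cvgr_to_le c1 _; apply: nearW => n.
have t01 : 0 < (n.+2%:R : R)^-1 <= 1.
  by rewrite invr_gt0 ltr0n/= invf_le1 ?ler1n ?ltr0n.
apply: le_trans (hassum_partial (cpoisson_hassum b0 t01) us) _.
rewrite lerD2r -[leRHS]expR0 ler_expR oppr_le0 mulr_ge0 ?(ltW b0)//.
by apply: ltW; exact: (koenigs_gt0 HT t01).
Qed.

(** Since [none (1/2)] is positive everywhere, finiteness of one transform makes nu P locally
    finite. *)
Lemma measure_step (nu : Npos -> R) (N : R -> R) :
  (forall x, 0 <= nu x) ->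
  (forall t, 0 < t <= 1 ->
    hassum (fun x => nu x * (none (T t) x - none (T 1) x)) (N t)) ->
  exists nu', (forall y, hassum (fun x => nu x * P x y) (nu' y)) /\
    forall t, 0 < t <= 1 -> hassum (fun y => nu' y * none t y) (N t).
Proof.
move=> nu0 nuN.
have row t : 0 < t <= 1 -> forall x, hassum (fun y => nu x * P x y * none t y)
    (nu x * (none (T t) x - none (T 1) x)).
  move=> t01 x; have t01' : 0 <= t <= 1 by lra.
  apply: hassum_eq (hassumZ (nu0 x) (killed_none pm x t01')) => y.
  by rewrite mulrA.
have t2 : 0 < (2^-1 : R) <= 1 by lra.
have col y : hassum (fun x => nu x * P x y) (rsum (fun x => nu x * P x y)).
  have n0 : 0 < none (2^-1 : R) y by apply: none_gt0; lra.
  have n0' : 0 <= (none (2^-1 : R) y)^-1 by rewrite invr_ge0 ltW.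
  have := hassumZr n0' (hassum_col (row _ t2) (nuN _ t2) y).
  have E : (fun x => nu x * P x y * none (2^-1 : R) y * (none (2^-1 : R) y)^-1) =
    (fun x => nu x * P x y) by apply/funext => x; rewrite mulfK// gt_eqF.
  by rewrite E => H; rewrite (hassum_rsum H).
exists (fun y => rsum (fun x => nu x * P x y)); split => // t t01.
have t01' : 0 <= t <= 1 by lra.
apply: (hassum_exchange (row t t01)) (nuN t t01) => y.
by apply: hassumZr; [case/andP: (none_range y t01')|exact: col].
Qed.

Lemma cpoisson_step b y : 0 < b ->
  hassum (fun x => cpoisson b x * P x y) (cpoisson (b * m) y).
Proof.
move=> b0; have m0 : 0 < m by case/andP: m01.
have hT t : 0 <= t <= 1 -> h (T t) = m * h t.
  by move=> t01; have := koenigs_iter HT m01 1 t01; rewrite expr1.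
have o01 : 0 <= (1 : R) <= 1 by lra.
have Nb t : 0 < t <= 1 ->
  hassum (fun x => cpoisson b x * (none (T t) x - none (T 1) x))
    (expR (- (b * m * h t)) - expR (- (b * m))).
  move=> t01; have t01' : 0 <= t <= 1 by lra.
  have Tt := iter_gt0 HT 1 t01; have T1 := iter_gt0 HT 1 one_in01.
  have := hassumB _ (cpoisson_hassum b0 Tt) (cpoisson_hassum b0 T1).
  (* The transform of pi_b is evaluated at T(t) and at T(1); exp(-b) cancels in the difference. *)
  have -> : expR (- (b * m * h t)) - expR (- (b * m)) =
      expR (- (b * h (iter 1 T t))) - expR (- b) -
      (expR (- (b * h (iter 1 T 1))) - expR (- b)).
    by rewrite /= !hT// (koenigs1 HT) mulr1 !mulrA; ring.
  move=> /(_ _)/wrap[x|].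
    rewrite mulr_ge0 ?cpoisson_ge0//=; last first.
      by case/andP: T1 => /ltW T10 T11; case/andP: (@none_range _ _ x (introT andP (conj T10 T11))).
    rewrite ler_wpM2l ?cpoisson_ge0// none_mono//=.
    - by case/andP: Tt => /ltW.
    - by apply: (surv_mono HT); lra.
    - by case/andP: T1.
  by apply: hassum_eq => x; rewrite mulrBr.
have [nu' [nuP nuN]] := measure_step (fun x => cpoisson_ge0 x b0) Nb.
suff -> : cpoisson (b * m) = nu' by exact: nuP.
have bm0 : 0 < b * m by exact: mulr_gt0.
apply/funext; apply: (@Npos_power_series_inj _ _ _
  (fun t => expR (- (b * m * h t)) - expR (- (b * m)))) => t t01.
  by apply: cpoisson_hassum => //; lra.
by apply: nuN; lra.
Qed.

End CompoundPoisson.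

Arguments critical_size {R} p b k.
Arguments cpoisson {R} p b x.

(** * The invariant measures kappa *)

Section Invariant.
Context {R : realType} {p : nat -> R} {m lam : R}.
Hypothesis pm : subcritical p m.
Hypothesis ml : m < lam.

Let p_law := subcritical_law pm.
Let m01 := subcritical_m01 pm.
Let HT := survival_survival_map p_law (subcritical_mean pm) m01.
Let m0 : 0 < m. Proof. by case/andP: m01. Qed.
Let lam0 : 0 < lam. Proof. exact: lt_trans ml. Qed.
Let m_n0 : m != 0. Proof. by rewrite gt_eqF. Qed.
Let lam_n0 : lam != 0. Proof. by rewrite gt_eqF. Qed.

Local Notation P := (killed (BGW_transition p)).
Local Notation T := (survival p).
Local Notation h := (koenigs T).
Let s_gt0 k := iter_gt0 HT k one_in01.

Definition kappa_term (b t : R) (n : int) : R :=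
  lam ^ (- n) * (expR (- (b * m ^ n * h t)) - expR (- (b * m ^ n))).

Lemma bmn_gt0 (b : R) (n : int) : 0 < b -> 0 < b * m ^ n.
Proof. by move=> b0; rewrite mulr_gt0// exprz_gt0. Qed.

Lemma lamz_gt0 (n : int) : 0 < lam ^ n.
Proof. by rewrite exprz_gt0. Qed.

Lemma kappa_term_range b t n : 0 < b -> 0 < t <= 1 ->
  0 <= kappa_term b t n <= dominating lam m b (b * h t) n.
Proof.
move=> b0 t01; have t01' : 0 <= t <= 1 by lra.
have bm := bmn_gt0 n b0; have ln := lamz_gt0 (- n).
have h0 := koenigs_gt0 HT t01; have h1 := koenigs_le1 HT t01'.
rewrite /kappa_term mulr_ge0 ?(ltW ln)//=; last first.
  by rewrite subr_ge0 ler_expR lerN2 ler_piMr// ltW.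
case: n bm ln => n bm ln; rewrite /dominating.
  rewrite expfzMl exprz_inv mulrA [leRHS]mulrC ler_wpM2l ?(ltW ln)//.
  apply: (@le_trans _ _ (1 - expR (- (b * m ^ n)))).
    by rewrite lerD2r -[leRHS]expR0 ler_expR oppr_le0 mulr_ge0 ?ltW.
  by have := expR_ge1Dx (- (b * m ^ n)); lra.
rewrite ler_wpM2l ?(ltW ln)// mulrAC lerBlDr lerDl; exact: expR_ge0.
Qed.

Definition kappa_transform (b t : R) : R := rsum (kappa_term b t).

Lemma kappa_term_hassum b t : 0 < b -> 0 < t <= 1 ->
  hassum (kappa_term b t) (kappa_transform b t).
Proof.
move=> b0 t01.
have bh : 0 < b * h t by rewrite mulr_gt0// (koenigs_gt0 HT).
apply: (hassum_dom (dominating_hassum m01 ml (ltW b0) bh) _).1 => n.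
exact: kappa_term_range.
Qed.

Definition kappa (b : R) (x : Npos) : R :=
  rsum (fun n : int => lam ^ (- n) * cpoisson p (b * m ^ n) x).

Lemma kappa_row b t n : 0 < b -> 0 < t <= 1 ->
  hassum (fun x => lam ^ (- n) * cpoisson p (b * m ^ n) x * none t x)
    (kappa_term b t n).
Proof.
move=> b0 t01; have bm := bmn_gt0 n b0.
apply: hassum_eq (hassumZ (ltW (lamz_gt0 (- n))) (cpoisson_hassum pm bm t01)) => x.
by rewrite mulrA.
Qed.

Lemma kappa_hassum b x : 0 < b ->
  hassum (fun n : int => lam ^ (- n) * cpoisson p (b * m ^ n) x) (kappa b x).
Proof.
move=> b0; have t2 : 0 < (2^-1 : R) <= 1 by lra.
have n0 : 0 < none (2^-1 : R) x by apply: none_gt0; lra.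
have n0' : 0 <= (none (2^-1 : R) x)^-1 by rewrite invr_ge0 ltW.
have := hassumZr n0' (hassum_col (fun n => kappa_row n b0 t2) (kappa_term_hassum b0 t2) x).
rewrite (_ : (fun n : int => _) =
    (fun n : int => lam ^ (- n) * cpoisson p (b * m ^ n) x)); last first.
  by apply/funext => n; rewrite mulfK// gt_eqF.
by move=> H; rewrite /kappa (hassum_rsum H).
Qed.

Lemma kappa_ge0 b x : 0 < b -> 0 <= kappa b x.
Proof. by move=> b0; exact: (hassum_ge0 (kappa_hassum x b0)). Qed.

Lemma kappa_transform_hassum b t : 0 < b -> 0 < t <= 1 ->
  hassum (fun x => kappa b x * none t x) (kappa_transform b t).
Proof.
move=> b0 t01; have t01' : 0 <= t <= 1 by lra.
apply: (hassum_exchange (fun n => kappa_row n b0 t01)) (kappa_term_hassum b0 t01) => x.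
by apply: hassumZr; [case/andP: (none_range x t01')|exact: kappa_hassum].
Qed.

Lemma kappa_shift b (k : int) x : 0 < b ->
  kappa (b * m ^ k) x = lam ^ k * kappa b x.
Proof.
move=> b0; apply: (hassum_uniq (kappa_hassum x (bmn_gt0 k b0))).
have := hassumZ (ltW (lamz_gt0 k)) (kappa_hassum x b0).
move/(iffRL (hassum_bij (e := fun n : int => n + k) (e' := fun n => n - k)
  (fun n : int => lam ^ k * (lam ^ (- n) * cpoisson p (b * m ^ n) x)) _
  (fun n => addrK k n) (fun n => subrK k n))).
apply: hassum_eq => n /=.
by rewrite mulrA -expfzDr// opprD addrCA subrr addr0 -mulrA -expfzDr// (addrC k).
Qed.

Lemma kappa_invariant b y : 0 < b ->
  hassum (fun x => kappa b x * P x y) (lam * kappa b y).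
Proof.
move=> b0.
have row n : hassum (fun x => lam ^ (- n) * cpoisson p (b * m ^ n) x * P x y)
    (lam ^ (- n) * cpoisson p (b * m ^ 1 * m ^ n) y).
  have -> : b * m ^ 1 * m ^ n = b * m ^ n * m by rewrite expr1z mulrAC.
  apply: hassum_eq (hassumZ (ltW (lamz_gt0 (- n))) (cpoisson_step pm y (bmn_gt0 n b0))) => x.
  by rewrite mulrA.
have tot := kappa_hassum y (bmn_gt0 1 b0); rewrite kappa_shift// expr1z in tot.
apply: (hassum_exchange row) tot => x.
by apply: hassumZr; [exact: BGW_ge0 pm _ _|exact: kappa_hassum].
Qed.

(** * Finiteness and transform of the Green kernel *)

Section Green.

(** A visit to y at time k requires survival until k, of probability at most x m^k; so the Green
    series is dominated by a geometric one of ratio m/lam. *)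
Lemma steps_le_mean k x y : steps p k x y <= (\val x)%:R * m ^+ k.
Proof.
have o01 : 0 <= (1 : R) <= 1 by lra.
have /andP[sk0 sk1] := s_gt0 k; have sk01 : 0 <= iter k T 1 <= 1 by lra.
have := hassum_term y ((steps_spec pm k x).2 _ o01); rewrite some1 mulr1.
move=> /le_trans; apply; apply: le_trans (one_minus_expr_le (\val x) sk01) _.
by rewrite ler_wpM2l//; have := iter_le HT m01 k o01; rewrite mulr1.
Qed.

Definition real_green (x y : Npos) : R := rsum (fun k => lam ^- k * steps p k x y).

Lemma real_green_hassum x y :
  hassum (fun k => lam ^- k * steps p k x y) (real_green x y).
Proof.
have q01 : 0 <= m / lam < 1.
  by rewrite divr_ge0 ?(ltW m0) ?(ltW lam0)//= ltr_pdivrMr// mul1r.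
have x0 : 0 <= (\val x)%:R :> R by [].
apply: (hassum_dom (hassumZ x0 (hassum_geometric q01)) _).1 => k.
have lk : 0 <= lam ^- k by rewrite invr_ge0 exprn_ge0 ?(ltW lam0).
rewrite mulr_ge0//=; last exact: steps_ge0 pm _ _ _.
by rewrite expr_div_n mulrA [leRHS]mulrC ler_wpM2l// steps_le_mean.
Qed.

Lemma green_real x y : green P lam x y = (real_green x y)%:E.
Proof.
rewrite /green nneseries_esumT.
  rewrite -(real_green_hassum x y).2; apply: eq_esum => k _.
  by rewrite (steps_spec pm k x).1 EFinM.
move=> k; rewrite (steps_spec pm k x).1 -EFinM lee_fin.
exact: hassum_nneg (real_green_hassum x y) k.
Qed.

Definition green_term (x : Npos) (t : R) (k : nat) : R :=
  lam ^- k * (none (iter k T t) x - none (iter k T 1) x).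

Lemma none_le_expR (t : R) (x : Npos) : 0 <= t <= 1 ->
  none t x <= expR (- ((\val x)%:R * t)).
Proof.
move=> t01; rewrite -mulrN mulrC expRM_natr lerXn2r ?nnegrE ?expR_ge0//; first lra.
by have := expR_ge1Dx (- t).
Qed.

Lemma none_diff_range k x t : 0 < t <= 1 ->
  0 <= none (iter k T t) x - none (iter k T 1) x <= (\val x)%:R * iter k T 1.
Proof.
move=> t01; have t01' : 0 <= t <= 1 by lra.
have /andP[sk0 sk1] := s_gt0 k; have sk01 : 0 <= iter k T 1 <= 1 by lra.
have /andP[u0 u1] := iter_gt0 HT k t01; have u01 : 0 <= iter k T t <= 1 by lra.
apply/andP; split.
  by rewrite subr_ge0; apply: none_mono; [lra| |lra]; apply: (iter_mono HT); lra.
apply: le_trans (one_minus_expr_le (\val x) sk01).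
by rewrite lerD2r; case/andP: (none_range x u01).
Qed.

Lemma green_term_hassum x t : 0 < t <= 1 ->
  hassum (green_term x t) (rsum (green_term x t)).
Proof.
move=> t01; have o01 : 0 <= (1 : R) <= 1 by lra.
have q01 : 0 <= m / lam < 1.
  by rewrite divr_ge0 ?(ltW m0) ?(ltW lam0)//= ltr_pdivrMr// mul1r.
have x0 : 0 <= (\val x)%:R :> R by [].
apply: (hassum_dom (hassumZ x0 (hassum_geometric q01)) _).1 => k.
have lk : 0 <= lam ^- k by rewrite invr_ge0 exprn_ge0 ?(ltW lam0).
have /andP[d0 d1] := none_diff_range k x t01.
rewrite /green_term mulr_ge0//= expr_div_n mulrA [leRHS]mulrC ler_wpM2l//.
apply: le_trans d1 _; rewrite ler_wpM2l//.
by have := iter_le HT m01 k o01; rewrite mulr1.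
Qed.

Lemma green_transform x t : 0 < t <= 1 ->
  hassum (fun y => real_green x y * none t y) (rsum (green_term x t)).
Proof.
move=> t01; have t01' : 0 <= t <= 1 by lra.
have row k : hassum (fun y => lam ^- k * steps p k x y * none t y) (green_term x t k).
  have lk : 0 <= lam ^- k by rewrite invr_ge0 exprn_ge0 ?(ltW lam0).
  by apply: hassum_eq (hassumZ lk (steps_none pm k x t01')) => y; rewrite mulrA.
apply: (hassum_exchange row) (green_term_hassum x t01) => y.
by apply: hassumZr; [case/andP: (none_range y t01')|exact: real_green_hassum].
Qed.

End Green.

End Invariant.

Arguments kappa_term {R} p m lam b t n.
Arguments kappa_transform {R} p m lam b t.
Arguments kappa {R} p m lam b x.
Arguments real_green {R} p lam x y.
Arguments green_term {R} p lam x t k.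

(** * Asymptotics of the Green function *)

Lemma absz_addz_ge (k N : nat) (n : int) :
  (N + absz n <= k)%N -> (N <= absz (Posz k + n)%R)%N.
Proof. lia. Qed.

Lemma addz_ge0 (k : nat) (n : int) : (absz n <= k)%N -> 0 <= Posz k + n.
Proof. lia. Qed.

Lemma absz_add_Negz (k j : nat) :
  0 <= Posz k + Negz j -> (absz (Posz k + Negz j)%R + j.+1 = k)%N.
Proof. lia. Qed.

Section Asymptotics.
Context {R : realType} {p : nat -> R} {m lam : R}.
Hypothesis pm : subcritical p m.
Hypothesis ml : m < lam.

Let p_law := subcritical_law pm.
Let m01 := subcritical_m01 pm.
Let HT := survival_survival_map p_law (subcritical_mean pm) m01.
Let m0 : 0 < m. Proof. by case/andP: m01. Qed.
Let lam0 : 0 < lam. Proof. exact: lt_trans ml. Qed.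

Local Notation T := (survival p).
Local Notation h := (koenigs T).
Local Notation kappa := (kappa p m lam).
Let s_gt0 k := iter_gt0 HT k one_in01.

Lemma kappa_continuous (x : Npos) (b : R) : 0 < b ->
  kappa c x @[c --> b] --> kappa b x.
Proof.
move=> b0.
have near_b : \forall c \near b, b / 2 < c < 2 * b.
  near=> c; apply/andP; split; near: c.
    by apply: (cvgr_gt b (@cvg_id _ (nbhs b))); lra.
  by apply: (cvgr_lt b (@cvg_id _ (nbhs b))); lra.
(* [Npos_power_series_cvg] asks for transforms at every index, so c is replaced by b outside (b/2,
   2b). *)
pose cl (c : R) := if b / 2 < c < 2 * b then c else b.
have cl0 c : 0 < cl c by rewrite /cl; case: ifP => // /andP[]; lra.
have clb c : b / 2 <= cl c <= 2 * b.
  by rewrite /cl; case: ifP => [/andP[]|_]; lra.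
have clE : cl c @[c --> b] --> b.
  apply: (@cvg_trans _ (c @[c --> b])); last exact: cvg_id.
  apply: near_eq_cvg; apply: filterS near_b => c; rewrite /cl => ->//.
apply: (@cvg_trans _ (kappa (cl c) x @[c --> b])).
  by apply: near_eq_cvg; apply: filterS near_b => c; rewrite /cl => ->.
apply: (@Npos_power_series_cvg R R (nbhs b) (fun c x => kappa (cl c) x) (kappa b)
  (fun c t => kappa_transform p m lam (cl c) t) (kappa_transform p m lam b))
  => [c t t01|t t01|t t01].
- by apply: kappa_transform_hassum => //; lra.
- by apply: kappa_transform_hassum => //; lra.
have t01' : 0 < t <= 1 by lra.
have h0 := koenigs_gt0 HT t01'.
have b20 : 0 <= 2 * b by lra.
have bh0 : 0 < b / 2 * h t by rewrite mulr_gt0//; lra.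
apply: (hassum_cvg (D := dominating lam m (2 * b) (b / 2 * h t))
  (a := fun c => kappa_term p m lam (cl c) t) _ (dominating_hassum m01 ml b20 bh0)
  (kappa_term_hassum pm ml b0 t01')).
- move=> n; have /andP[_] := kappa_term_range pm ml n b0 t01'.
  have bb : b / 2 * h t <= b * h t by rewrite ler_pM2r//; lra.
  by move=> /le_trans; apply; apply: le_dominating => //; lra.
- apply: nearW => c; split; last exact: kappa_term_hassum.
  move=> n; have /andP[_] := kappa_term_range pm ml n (cl0 c) t01'.
  have /andP[c1 c2] := clb c.
  by move=> /le_trans; apply; apply: le_dominating => //; rewrite ler_pM2r.
- move=> n; rewrite /kappa_term; apply: cvgMl_tmp.
  have c1 : cl c * m ^ n @[c --> b] --> b * m ^ n by exact: cvgMr_tmp.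
  by apply: cvgB; apply: cvg_expRN => //; exact: cvgMr_tmp.
Unshelve. all: by end_near. Qed.

Section GreenLimit.
Context {I : Type} {F : set_system I} {FF : ProperFilter F}.
Variables (x : I -> Npos) (k : I -> nat) (b : R).
Hypothesis b0 : 0 < b.
Hypothesis koo : k @ F --> \oo.
Hypothesis xk : (\val (x i))%:R * iter (k i) T 1 @[i --> F] --> b.

Let b_half0 : 0 < b / 2. Proof. exact: divr_gt0. Qed.
Let b_lo : b / 2 < b. Proof. by rewrite ltr_pdivrMr// ltr_pMr// ltr1n. Qed.
Let b_hi : b < 2 * b. Proof. by rewrite ltr_pMl// ltr1n. Qed.
Let b20 : 0 <= 2 * b. Proof. exact: mulr_ge0 (ltW b0). Qed.

Let k_ge N : \forall i \near F, (N <= k i)%N.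
Proof. exact: (koo (nbhs_infty_ge N)). Qed.

Lemma absz_shift_cvg (n : int) : (fun i => (absz (Posz (k i) + n))) @ F --> \oo.
Proof.
move=> A [N _ NA]; rewrite /nbhs /= /fmap /=.
have kN := k_ge (N + absz n).
by apply: filterS kN => i kN; apply: NA; exact: absz_addz_ge.
Qed.

Lemma size_shift_cvg (n : int) :
  (\val (x i))%:R * iter (absz (Posz (k i) + n)) T 1 @[i --> F] --> b * m ^ n.
Proof.
have o01 : 0 <= (1 : R) <= 1 by lra.
suff c : iter (absz (Posz (k i) + n)) T 1 / iter (k i) T 1 @[i --> F] --> m ^ n.
  apply: cvg_trans (cvgM xk c); apply: near_eq_cvg; apply: nearW => i.
  have /andP[sk _] := s_gt0 (k i).
  by rewrite /= mulrA mulrAC mulfK// gt_eqF.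
have ratio j : iter (i + j) T 1 / iter i T 1 @[i --> \oo] --> m ^+ j.
  have := koenigs_cvg HT (iter_range HT j o01).
  rewrite (koenigs_iter HT m01)// (koenigs1 HT) mulr1.
  by under eq_cvg do rewrite -iterD.
case: n => j.
  exact: (cvg_comp _ _ koo (ratio j)).
(* For a negative shift, start from the earlier generation and invert the ratio over j + 1 steps. *)
have c1 := cvg_comp _ _ (absz_shift_cvg (Negz j)) (ratio j.+1).
have mj : m ^+ j.+1 != 0 by rewrite gt_eqF// exprn_gt0.
apply: cvg_trans (cvgV mj c1); apply: near_eq_cvg.
have kj := k_ge j.+1; apply: filterS kj => i kj /=.
by rewrite invf_div absz_add_Negz//; exact: addz_ge0.
Qed.

Lemma none_shift_cvg (n : int) (t : R) : 0 <= t <= 1 ->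
  none (iter (absz (Posz (k i) + n)) T t) (x i) @[i --> F] -->
  expR (- (b * m ^ n * h t)).
Proof.
move=> t01; apply: (none_iter_cvg pm) => //.
- exact: absz_shift_cvg.
- exact: size_shift_cvg.
Qed.

(** The Green series multiplied by lam^k and recentred at generation k, n being the time relative to
    it; the test discards generations below 0, which [absz] would fold back. *)
Let shifted_term t i (n : int) : R := if (0 <= Posz (k i) + n) then
  lam ^ (- n) * (none (iter (absz (Posz (k i) + n)) T t) (x i) -
                 none (iter (absz (Posz (k i) + n)) T 1) (x i)) else 0.

Lemma shifted_term_hassum t i : 0 < t <= 1 ->
  hassum (shifted_term t i) (lam ^+ k i * rsum (green_term p lam (x i) t)).
Proof.
move=> t01.
apply/(hassum_inj (e := fun j : nat => Posz j - Posz (k i))).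
- by move=> j1 j2 /addIr [].
- move=> n hn; rewrite /shifted_term; case: ifP => // kn.
  by case: hn; exists (absz (Posz (k i) + n)) => //; rewrite gez0_abs// addrC addKr.
have l0 : 0 <= lam ^+ k i by rewrite exprn_ge0 ?(ltW lam0).
apply: hassum_eq (hassumZ l0 (green_term_hassum pm ml (x i) t01)) => j /=.
rewrite /shifted_term (addrC (Posz (k i))) subrK.
rewrite /= /green_term mulrA; congr (_ * _).
by rewrite opprB expfzDr ?gt_eqF// exprnN.
Qed.

(** For n >= 0, survival to generation k + n has probability at most x T^k(1) m^n <= 2b m^n. For n <
    0 and k' = k + n, the chain t T^k(1) <= T^k(t) <= m^-n T^k'(t) bounds x T^k'(t) below by t (b/2)
    m^n. *)
Lemma shifted_term_le t : 0 < t <= 1 -> \forall i \near F,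
  forall n, shifted_term t i n <= dominating lam m (2 * b) (t * (b / 2)) n.
Proof.
move=> t01; have t01' : 0 <= t <= 1 by lra. have o01 : 0 <= (1 : R) <= 1 by lra.
near=> i => n.
have xlo : b / 2 < (\val (x i))%:R * iter (k i) T 1.
  by near: i; exact: (cvgr_gt b xk).
have xhi : (\val (x i))%:R * iter (k i) T 1 < 2 * b.
  by near: i; exact: (cvgr_lt b xk).
have x0 : 0 <= (\val (x i))%:R :> R by [].
rewrite /shifted_term; case: ifP => [kn|_]; last first.
  case: n => n /=; first by rewrite mulr_ge0 ?exprz_ge0 ?divr_ge0 ?(ltW m0) ?(ltW lam0).
  by rewrite mulr_ge0 ?expR_ge0 ?exprn_ge0 ?(ltW lam0).
case: n kn => n kn; rewrite /dominating.
  rewrite expfzMl exprz_inv mulrA [leRHS]mulrC ler_wpM2l ?exprz_ge0 ?(ltW lam0)//.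
  have /andP[_ d1] := none_diff_range pm (absz (Posz (k i) + Posz n)) (x i) t01.
  apply: le_trans d1 _; rewrite -PoszD absz_nat addnC.
  rewrite iterD; have := iter_le HT m01 n (iter_range HT (k i) o01).
  move=> /(ler_wpM2l x0) /le_trans; apply.
  rewrite mulrCA mulrC ler_wpM2r ?exprn_ge0 ?(ltW m0)//; exact: ltW.
rewrite ler_wpM2l ?exprz_ge0 ?(ltW lam0)//.
set k' := absz _; have kk' : k i = (n.+1 + k')%N by rewrite addnC absz_add_Negz.
have u01 := iter_range HT k' t01'.
have u1 : 0 <= iter k' T 1 <= 1 by exact: iter_range HT _ _ o01.
apply: (@le_trans _ _ (none (iter k' T t) (x i))).
  by rewrite lerBlDr lerDl; case/andP: (none_range (x i) u1).
apply: le_trans (none_le_expR _ u01) _; rewrite ler_expR lerN2.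
rewrite -[m ^ _]/((m ^+ n.+1)^-1) ler_pdivrMr ?exprn_gt0//.
have h1 := iter_le HT m01 n.+1 u01.
rewrite -iterD -kk' in h1.
have h2 := iter_star HT (k i) t01' o01; rewrite mulr1 in h2.
rewrite -mulrA [_ * m ^+ _]mulrC.
apply: le_trans (ler_wpM2l x0 (le_trans h2 h1)).
by rewrite [leRHS]mulrCA; apply: ler_wpM2l; [lra|exact: ltW].
Unshelve. all: by end_near. Qed.

Lemma shifted_term_cvg t n : 0 < t <= 1 ->
  shifted_term t i n @[i --> F] --> kappa_term p m lam b t n.
Proof.
move=> t01; have t01' : 0 <= t <= 1 by lra.
have o01 : 0 <= (1 : R) <= 1 by lra.
have c1 := none_shift_cvg (n := n) t01'.
have c2 := none_shift_cvg (n := n) o01.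
rewrite (koenigs1 HT) mulr1 in c2.
apply: cvg_trans (cvgMl_tmp (a := lam ^ (- n)) (cvgB c1 c2)).
apply: near_eq_cvg; have kn := k_ge (absz n); apply: filterS kn => i kn.
by rewrite /shifted_term ifT//; exact: addz_ge0.
Qed.

Lemma green_cvg y :
  lam ^+ k i * real_green p lam (x i) y @[i --> F] --> kappa b y.
Proof.
apply: (Npos_power_series_cvg (a := fun i y => lam ^+ k i * real_green p lam (x i) y)
  (g := fun i t => lam ^+ k i * rsum (green_term p lam (x i) t))
  (gb := kappa_transform p m lam b)) => [i t t01|t t01|t t01];
  have t01' : 0 < t <= 1 by lra.
- have l0 : 0 <= lam ^+ k i by rewrite exprn_ge0 ?(ltW lam0).
  apply: hassum_eq (hassumZ l0 (green_transform pm ml (x i) t01')) => z.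
  by rewrite mulrA.
- exact: kappa_transform_hassum.
(* The minimum gives one majorant for the shifted terms and for their limit. *)
have bt0 : 0 < Num.min (t * (b / 2)) (b * h t).
  by rewrite lt_min !mulr_gt0 ?(koenigs_gt0 HT t01')//; case/andP: t01.
apply: (hassum_cvg _ (dominating_hassum m01 ml b20 bt0)
  (kappa_term_hassum pm ml b0 t01')).
- move=> n; have /andP[_] := kappa_term_range pm ml n b0 t01'.
  move=> /le_trans; apply; apply: le_dominating => //; first exact: ltW.
  by rewrite ge_min lexx orbT.
- have := shifted_term_le t01'; apply: filterS => i le.
  split; last exact: shifted_term_hassum.
  move=> n; apply: le_trans (le n) _; apply: le_dominating => //.
  by rewrite ge_min lexx.
- by move=> n; exact: shifted_term_cvg.
Qed.

End GreenLimit.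
End Asymptotics.

(** * Concentration in the distant past *)

Section Concentration.
Context {R : realType} {p : nat -> R} {m : R}.
Hypothesis pm : subcritical p m.

Let p_law := subcritical_law pm.
Let m01 := subcritical_m01 pm.
Let HT := survival_survival_map p_law (subcritical_mean pm) m01.
Let m0 : 0 < m. Proof. by case/andP: m01. Qed.
Let m_n0 : m != 0. Proof. by rewrite gt_eqF. Qed.

Local Notation P := (killed (BGW_transition p)).
Local Notation T := (survival p).
Local Notation h := (koenigs T).
Let s_gt0 k := iter_gt0 HT k one_in01.

(* Under [past b k], [none (iter k T t)] concentrates at [expR (- (b * h t))]
   as k -> oo. *)
Definition past (b : R) (k : nat) : Npos -> R := cpoisson p (b * m ^- k).

Lemma past_param_gt0 b k : 0 < b -> 0 < b * m ^- k.
Proof. by move=> b0; rewrite divr_gt0// exprn_gt0. Qed.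

Lemma past_ge0 b k x : 0 < b -> 0 <= past b k x.
Proof. by move=> b0; exact: (cpoisson_ge0 pm x (past_param_gt0 k b0)). Qed.

(** T^k undoes the factor m^-k, as h(T^k t) = m^k h(t). *)
Lemma past_hassum b k t : 0 < b -> 0 < t <= 1 ->
  hassum (fun x => past b k x * none (iter k T t) x)
    (expR (- (b * h t)) - expR (- (b * m ^- k))).
Proof.
move=> b0 t01; have t01' : 0 <= t <= 1 by lra.
have := cpoisson_hassum pm (past_param_gt0 k b0) (iter_gt0 HT k t01).
by rewrite (koenigs_iter HT m01)// mulrA divfK// expf_neq0.
Qed.

Lemma past_mass b k : 0 < b ->
  hassum (past b k) (rsum (past b k)) /\
  rsum (past b k) <= 1 - expR (- (b * m ^- k)).
Proof. by move=> b0; exact: (cpoisson_mass pm (past_param_gt0 k b0)). Qed.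

Lemma past_mass_le1 b k : 0 < b -> rsum (past b k) <= 1.
Proof.
move=> b0; apply: le_trans (past_mass k b0).2 _.
by rewrite gerDl oppr_le0 expR_ge0.
Qed.

Definition variance (b t : R) (k : nat) : R :=
  rsum (fun x => past b k x * (none (iter k T t) x - expR (- (b * h t))) ^+ 2).

(** Expand the square: by [none_sqr] the second moment is the transform at 2S - S^2. The total mass
    enters with a plus sign, so the upper bound of [past_mass] suffices. *)
Lemma variance_spec b t k : 0 < b -> 0 < t <= 1 ->
  hassum (fun x => past b k x * (none (iter k T t) x - expR (- (b * h t))) ^+ 2)
    (variance b t k) /\
  variance b t k <=
    expR (- (b * (m ^- k * h (2 * iter k T t - iter k T t ^+ 2)))) -
    expR (- (b * h t)) ^+ 2.
Proof.
move=> b0 t01; set c := expR (- (b * h t)); set S := iter k T t.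
have bk := past_param_gt0 k b0.
have /andP[S0 S1] : 0 < S <= 1 := iter_gt0 HT k t01.
have v01 : 0 < 2 * S - S ^+ 2 <= 1 by nra.
have X1 := past_hassum k b0 t01; rewrite -/c -/S in X1.
have X2 := cpoisson_hassum pm bk v01; rewrite -mulrA -/(past b k) in X2.
have [X0 mu1] := past_mass k b0.
have c0 : 0 < c by exact: expR_gt0.
have c20 : 0 <= c ^+ 2 by rewrite exprn_ge0// ltW.
have c2 : 0 <= 2 * c by lra.
have Y := hassumD X2 (hassumZ c20 X0).
have Z := hassumZ c2 X1.
have E x : past b k x * none (2 * S - S ^+ 2) x + c ^+ 2 * past b k x -
    2 * c * (past b k x * none S x) = past b k x * (none S x - c) ^+ 2.
  by rewrite -none_sqr; ring.
have V : hassum (fun x => past b k x * (none S x - c) ^+ 2) (expR (- (b * (m ^- k *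
   h (2 * S - S ^+ 2)))) - expR (- (b * m ^- k)) + c ^+ 2 * rsum (past b k) -
   2 * c * (c - expR (- (b * m ^- k)))).
  apply: hassum_eq (hassumB _ Y Z) => x; first exact: E.
  rewrite (hassum_nneg Z)/= -subr_ge0 E.
  by rewrite mulr_ge0 ?sqr_ge0 ?past_ge0.
split; first by rewrite /variance (hassum_rsum V).
rewrite /variance (hassum_rsum V).
have e0 : 0 < expR (- (b * m ^- k)) by exact: expR_gt0.
have h1 := ler_wpM2l c20 mu1.
rewrite -subr_ge0 in h1; rewrite -subr_ge0.
move: (expR (- (b * m ^- k))) (rsum _) e0 h1 => e mu e0 h1.
have h2 : 0 <= e * (1 - c) ^+ 2 by rewrite mulr_ge0 ?sqr_ge0// ltW.
rewrite (_ : _ - _ = (c ^+ 2 * (1 - e) - c ^+ 2 * mu) + e * (1 - c) ^+ 2); last by ring.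
exact: addr_ge0.
Qed.

Lemma variance_hassum b t k : 0 < b -> 0 < t <= 1 ->
  hassum (fun x => past b k x * (none (iter k T t) x - expR (- (b * h t))) ^+ 2)
    (variance b t k).
Proof. by move=> b0 t01; exact: (variance_spec k b0 t01).1. Qed.

(** By [koenigs_double] the first exponential of the bound tends to exp(-2b h(t)), the square of the
    centre. *)
Lemma variance_cvg0 b t : 0 < b -> 0 < t <= 1 -> variance b t @ \oo --> 0.
Proof.
move=> b0 t01.
apply: (@squeeze_cvgr _ _ _ _ (fun=> 0)
  (fun k => expR (- (b * (m ^- k * h (2 * iter k T t - iter k T t ^+ 2)))) -
            expR (- (b * h t)) ^+ 2)).
- apply: nearW => k; have [v vle] := variance_spec k b0 t01.
  by rewrite (hassum_ge0 v).
- exact: cvg_cst.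
- have -> : (0 : R) = expR (- (b * (2 * h t))) - expR (- (b * h t)) ^+ 2.
    rewrite -expRM_natr.
    by rewrite (_ : - (b * h t) * 2%:R = - (b * (2 * h t))) ?subrr//; ring.
  apply: cvgB; last exact: cvg_cst.
  by apply: cvg_expRN; apply: cvgMl_tmp; exact: (koenigs_double HT m01 t01).
Qed.

Definition deviation (b t : R) (k : nat) : R :=
  rsum (fun x => past b k x * `|none (iter k T t) x - expR (- (b * h t))|).

(** From y <= e + y^2 / e, in place of Cauchy-Schwarz. *)
Lemma deviation_le b t k e : 0 < b -> 0 < t <= 1 -> 0 < e ->
  hassum (fun x => past b k x * `|none (iter k T t) x - expR (- (b * h t))|)
    (deviation b t k) /\ deviation b t k <= e + e^-1 * variance b t k.
Proof.
move=> b0 t01 e0; have e0' : 0 <= e^-1 by rewrite invr_ge0 ltW.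
have := hassumD (hassumZ (ltW e0) (past_mass k b0).1)
  (hassumZ e0' (variance_hassum k b0 t01)).
move=> /hassum_dom dom.
have [x|d dle] := dom (fun x =>
    past b k x * `|none (iter k T t) x - expR (- (b * h t))|).
  rewrite mulr_ge0 ?past_ge0//= mulrCA (mulrC e) -mulrDr ler_wpM2l ?past_ge0//.
  rewrite -real_normK ?num_real//; move: `|_| (normr_ge0 (none (iter k T t) x - expR (- (b * h t)))) => y y0.
  rewrite -(ler_pM2l e0) mulrDr mulrA divff ?gt_eqF// mul1r.
  by rewrite -subr_ge0 (_ : _ - _ = (e - y) ^+ 2 + e * y); [rewrite addr_ge0 ?sqr_ge0 ?mulr_ge0// ltW|ring].
split => //; apply: le_trans dle _.
by rewrite lerD2r ler_piMr ?(ltW e0)// past_mass_le1.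
Qed.

Lemma deviation_hassum b t k : 0 < b -> 0 < t <= 1 ->
  hassum (fun x => past b k x * `|none (iter k T t) x - expR (- (b * h t))|)
    (deviation b t k).
Proof. by move=> b0 t01; have [] := deviation_le k b0 t01 ltr01. Qed.

Lemma deviation_cvg0 b t : 0 < b -> 0 < t <= 1 -> deviation b t @ \oo --> 0.
Proof.
move=> b0 t01; apply/cvgrPdist_le => e e0.
have e20 : 0 < e / 2 by lra.
have e40 : 0 < (e / 2) ^+ 2 by rewrite exprn_gt0.
have /cvgrPdist_le/(_ _ e40) v0 := variance_cvg0 b0 t01.
near=> k.
have [d dle] := deviation_le k b0 t01 e20.
rewrite sub0r normrN ger0_norm ?(hassum_ge0 d)//; apply: le_trans dle _.
have : `|0 - variance b t k| <= (e / 2) ^+ 2 by near: k.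
rewrite sub0r normrN ger0_norm ?(hassum_ge0 (variance_hassum k b0 t01))//.
rewrite expr2 -ler_pdivrMl//; lra.
Unshelve. all: by end_near. Qed.

(** The mass is bounded below by the transform at T^(2k)(1), whose exponent b m^-k m^(2k) = b m^k
    tends to 0; [expRN_le] handles the remaining exp(-b m^-k). *)
Lemma past_mass_cvg1 b : 0 < b -> rsum (past b k) @[k --> \oo] --> (1 : R).
Proof.
move=> b0.
apply: (@squeeze_cvgr _ _ _ _ (fun k => expR (- (b * m ^+ k)) - b^-1 * m ^+ k)
  (fun=> 1)).
- apply: nearW => k; rewrite past_mass_le1// andbT.
  have [X0 _] := past_mass k b0; have o01 : 0 <= (1 : R) <= 1 by lra.
  have X := cpoisson_hassum pm (past_param_gt0 k b0) (s_gt0 (k + k)).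
  have le : expR (- (b * m ^- k * h (iter (k + k) T 1))) - expR (- (b * m ^- k))
      <= rsum (past b k).
    apply: (hassum_le X X0) => x; rewrite ler_piMr ?past_ge0//.
    by case/andP: (none_range x (iter_range HT (k + k) o01)).
  apply: le_trans le; rewrite (koenigs_iter HT m01)// (koenigs1 HT) mulr1.
  rewrite exprD mulrA divfK ?expf_neq0// lerD2l lerN2.
  apply: le_trans (expRN_le 1 (past_param_gt0 k b0)) _.
  by rewrite expr1 mul1r invfM invrK.
- have mk : m ^+ k @[k --> \oo] --> 0.
    by apply: cvg_expr; rewrite gtr0_norm//; case/andP: m01.
  have -> : (1 : R) = expR (- (b * 0)) - b^-1 * 0.
    by rewrite !mulr0 oppr0 expR0 addr0.
  by apply: cvgB; [apply: cvg_expRN|]; exact: cvgMl_tmp.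
- exact: cvg_cst.
Qed.

(** A truncated parabola in [none (iter k T 1) x]: its integral against [past b k] is bounded below
    through mass and variance alone, and with K = d^-2 it vanishes at distance d from exp(-b). *)
Definition bump (K b : R) (k : nat) (x : Npos) : R :=
  Num.max 0 (1 - K * (none (iter k T 1) x - expR (- b)) ^+ 2).

Lemma bump_ge0 K b k x : 0 <= bump K b k x.
Proof. by rewrite /bump le_max lexx. Qed.

Lemma bump_le1 K b k x : 0 <= K -> bump K b k x <= 1.
Proof.
by move=> K0; rewrite /bump ge_max ler01 gerBl mulr_ge0 ?sqr_ge0.
Qed.

Lemma bump_past_hassum K a b k : 0 <= K -> 0 < a ->
  hassum (fun x => past a k x * bump K b k x) (rsum (fun x => past a k x * bump K b k x))
  /\ rsum (fun x => past a k x * bump K b k x) <= 1.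
Proof.
move=> K0 a0; have [X0 _] := past_mass k a0.
have [|d dle] := hassum_dom (f := fun x => past a k x * bump K b k x) X0.
  move=> x; rewrite mulr_ge0 ?past_ge0 ?bump_ge0//=.
  by rewrite ler_piMr ?past_ge0 ?bump_le1.
by split => //; apply: le_trans dle (past_mass_le1 k a0).
Qed.

Lemma bump_past_cvg1 K b : 0 <= K -> 0 < b ->
  rsum (fun x => past b k x * bump K b k x) @[k --> \oo] --> (1 : R).
Proof.
move=> K0 b0; have o01 : 0 < (1 : R) <= 1 by lra.
apply: (@squeeze_cvgr _ _ _ _ (fun k => rsum (past b k) - K * variance b 1 k)
  (fun=> 1)).
- apply: nearW => k; have [X Xle] := bump_past_hassum b k K0 b0.
  rewrite Xle andbT lerBlDr.
  apply: (hassum_le (past_mass k b0).1 (hassumD X (hassumZ K0 (variance_hassum k b0 o01)))) => x.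
  rewrite (koenigs1 HT) mulr1 mulrCA -mulrDr -[leLHS]mulr1 ler_wpM2l ?past_ge0//.
  by rewrite -lerBlDr /bump le_max lexx orbT.
- rewrite -[X in _ --> X](subr0 1) -[X in 1 - X](mulr0 K).
  apply: cvgB; first exact: past_mass_cvg1.
  by apply: cvgMl_tmp; exact: variance_cvg0.
- exact: cvg_cst.
Qed.

End Concentration.

Arguments past {R} p m b k x.
Arguments bump {R} p K b k x.
Arguments deviation {R} p m b t k.
Arguments variance {R} p m b t k.

(** * Separation of the measures kappa by test functions *)

Section BumpInequalities.
Context {R : realType}.
Implicit Types c d u b y : R.

(** Where B is positive, |u - c| < d, so u, 1 - u and |u - c'| are all at least d, while B <= 1. The
    first two bounds yield summable majorants on the two sides of the orbit; the third ties the
    integral to a variance around c'. *)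
Lemma bump_poly_le c d u : 0 < d -> 2 * d <= c -> 2 * d <= 1 - c -> 0 <= u <= 1 ->
  let B := Num.max 0 (1 - d^-1 ^+ 2 * (u - c) ^+ 2) in
  [/\ B <= d^-1 * u, B <= d^-1 * (1 - u) &
      forall c', 2 * d <= `|c' - c| -> B <= d^-1 ^+ 2 * (u - c') ^+ 2].
Proof.
move=> d0 dc dc1 /andP[u0 u1] /=.
have di : 0 < d^-1 by rewrite invr_gt0.
have sq y : 0 <= d^-1 ^+ 2 * y ^+ 2 by rewrite mulr_ge0 ?sqr_ge0.
have [near_c|far_c] := ltP (`|u - c|) d; last first.
  have B0 : 1 - d^-1 ^+ 2 * (u - c) ^+ 2 <= 0.
    rewrite subr_le0 -exprMn -(real_normK (num_real _)) normrM (gtr0_norm di).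
    by rewrite exprn_ege1// ler_pdivlMl// mulr1.
  rewrite (max_idPl B0); split; first by rewrite mulr_ge0// ltW.
    by rewrite mulr_ge0 ?(ltW di)//; lra.
  by move=> c' _; exact: sq.
have B1 : Num.max 0 (1 - d^-1 ^+ 2 * (u - c) ^+ 2) <= 1.
  by rewrite ge_max ler01 gerBl sq.
have /ltr_normlP[n1 n2] := near_c.
split=> [||c' cc']; apply: le_trans B1 _.
- by rewrite ler_pdivlMl// mulr1; lra.
- by rewrite ler_pdivlMl// mulr1; lra.
- rewrite -exprMn -(real_normK (num_real _)) normrM (gtr0_norm di).
  rewrite exprn_ege1// ler_pdivlMl// mulr1.
  have := ler_distD u c' c; rewrite (distrC c' u); lra.
Qed.

Lemma expR_gap b lo hi : 0 < b -> lo < b -> b < hi ->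
  exists d, [/\ 0 < d, 2 * d <= expR (- b), 2 * d <= 1 - expR (- b) &
    forall y, y <= lo \/ hi <= y -> 2 * d <= `|expR (- y) - expR (- b)|].
Proof.
move=> b0 lob bhi.
have e0 : 0 < expR (- b) by exact: expR_gt0.
have e1 : expR (- b) < 1 by rewrite -expR0 ltr_expR oppr_lt0.
have e2 : expR (- b) < expR (- lo) by rewrite ltr_expR ltrN2.
have e3 : expR (- hi) < expR (- b) by rewrite ltr_expR ltrN2.
pose d := Num.min (Num.min (expR (- b)) (1 - expR (- b)))
                  (Num.min (expR (- lo) - expR (- b)) (expR (- b) - expR (- hi))).
have d0 : 0 < d by rewrite /d !lt_min; do !(apply/andP; split); lra.
have d1 : d <= expR (- b) by rewrite /d !ge_min lexx.
have d2 : d <= 1 - expR (- b) by rewrite /d !ge_min lexx orbT.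
have d3 : d <= expR (- lo) - expR (- b) by rewrite /d !ge_min lexx !orbT.
have d4 : d <= expR (- b) - expR (- hi) by rewrite /d !ge_min lexx !orbT.
exists (d / 2); rewrite mulrCA divff ?mulr1 ?pnatr_eq0//; split=> //; first by lra.
move=> y [ylo|hiy].
  have : expR (- lo) <= expR (- y) by rewrite ler_expR lerN2.
  by have := ler_norm (expR (- y) - expR (- b)); lra.
have : expR (- y) <= expR (- hi) by rewrite ler_expR lerN2.
by have := ler_norm (expR (- b) - expR (- y)); rewrite distrC; lra.
Qed.

End BumpInequalities.

Section Separation.
Context {R : realType} {p : nat -> R} {m lam : R}.
Hypothesis pm : subcritical p m.
Hypothesis ml : m < lam.

Let p_law := subcritical_law pm.
Let m01 := subcritical_m01 pm.
Let HT := survival_survival_map p_law (subcritical_mean pm) m01.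
Let m0 : 0 < m. Proof. by case/andP: m01. Qed.
Let lam0 : 0 < lam. Proof. exact: lt_trans ml. Qed.
Let m_n0 : m != 0. Proof. by rewrite gt_eqF. Qed.
Let lam_n0 : lam != 0. Proof. by rewrite gt_eqF. Qed.

Local Notation P := (killed (BGW_transition p)).
Local Notation T := (survival p).
Local Notation h := (koenigs T).
Local Notation kappa := (kappa p m lam).
Local Notation past := (past p m).
Local Notation bump := (bump p).

(** The contribution of the layer n - k of kappa_a to the integral of the bump, divided by lam^k;
    [J] selects the layers. *)
Definition bump_term (J : pred int) (K a b : R) (k : nat) (n : int) : R :=
  if J n then lam ^ (- n) * rsum (fun x => past (a * m ^ n) k x * bump K b k x) else 0.

(** Dominated convergence: each selected layer concentrates at exp(-a m^n), at least 2d away from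
    the centre of the bump, and the bounds linear in u and 1 - u give the majorant. *)
Lemma bump_term_cvg0 (J : pred int) (a b d : R) : 0 < a -> 0 < d ->
  2 * d <= expR (- b) -> 2 * d <= 1 - expR (- b) ->
  (forall n, J n -> 2 * d <= `|expR (- (a * m ^ n)) - expR (- b)|) ->
  (forall k, hassum (bump_term J (d^-1 ^+ 2) a b k)
                    (rsum (bump_term J (d^-1 ^+ 2) a b k))) /\
  rsum (bump_term J (d^-1 ^+ 2) a b k) @[k --> \oo] --> (0 : R).
Proof.
move=> a0 d0 db db1 dJ; set K := d^-1 ^+ 2.
have K0 : 0 <= K by rewrite exprn_ge0// invr_ge0 ltW.
have di0 : 0 < d^-1 by rewrite invr_gt0.
have o01 : 0 < (1 : R) <= 1 by lra. have o01' : 0 <= (1 : R) <= 1 by lra.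
have D := hassumZ (ltW di0) (dominating_hassum m01 ml (ltW a0) a0).
have u01 k x : 0 <= none (iter k T 1) x <= 1.
  by apply: none_range; exact: (iter_range HT k o01').
have le k n : 0 <= bump_term J K a b k n <= d^-1 * dominating lam m a a n.
  have an := bmn_gt0 pm n a0.
  have [X _] := bump_past_hassum pm b k K0 an.
  have ln : 0 < lam ^ (- n) by exact: (lamz_gt0 pm ml).
  have dom0 : 0 <= dominating lam m a a n.
    by have := hassum_nneg (dominating_hassum m01 ml (ltW a0) a0) n.
  rewrite /bump_term; case: ifP => [Jn|_]; last by rewrite lexx mulr_ge0// ltW.
  rewrite mulr_ge0 ?(ltW ln) ?(hassum_ge0 X)//=.
  have Y := past_hassum pm k an o01; rewrite (koenigs1 HT) mulr1 in Y.
  have [Z Zle] := past_mass pm k an.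
  have Bx x : bump K b k x <= d^-1 * none (iter k T 1) x /\
      bump K b k x <= d^-1 * (1 - none (iter k T 1) x).
    by have [B1 B2 _] := bump_poly_le d0 db db1 (u01 k x).
  have pa x : 0 <= past (a * m ^ n) k x by exact: (past_ge0 pm).
  case: n Jn an X ln Y Z Zle pa {dom0} => n Jn an X ln Y Z Zle pa; rewrite /dominating.
    have hB x : 0 <= past (a * m ^ Posz n) k x * none (iter k T 1) x
        <= past (a * m ^ Posz n) k x.
      by have /andP[? ?] := u01 k x; rewrite mulr_ge0//= ler_piMr.
    have W := hassumZ (ltW di0) (hassumB hB Z Y).
    have XW : rsum (fun x => past (a * m ^ Posz n) k x * bump K b k x) <=
        d^-1 * (a * m ^ Posz n).
      apply: le_trans (hassum_le X W _) _ => [x|].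
        rewrite [leRHS](_ : _ = past (a * m ^ Posz n) k x *
          (d^-1 * (1 - none (iter k T 1) x))); last by ring.
        by rewrite ler_wpM2l//; case: (Bx x).
      rewrite ler_wpM2l ?(ltW di0)//.
      have := expR_ge1Dx (- (a * m ^ Posz n)); move: Zle.
      by lra.
    apply: le_trans (ler_wpM2l (ltW ln) XW) _.
    by rewrite expfzMl exprz_inv le_eqVlt; apply/orP; left; apply/eqP; ring.
  have W := hassumZ (ltW di0) Y.
  have XW : rsum (fun x => past (a * m ^ Negz n) k x * bump K b k x) <=
      d^-1 * expR (- (a * m ^ Negz n)).
    apply: le_trans (hassum_le X W _) _ => [x|].
      by rewrite mulrCA ler_wpM2l//; case: (Bx x).
    by rewrite ler_wpM2l ?(ltW di0)// lerBlDr lerDl expR_ge0.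
  by apply: le_trans (ler_wpM2l (ltW ln) XW) _; rewrite mulrCA.
have cv n : bump_term J K a b k n @[k --> \oo] --> (0 : R).
  have an := bmn_gt0 pm n a0.
  rewrite /bump_term; case Jn : (J n); last exact: cvg_cst.
  rewrite -[X in _ --> X](mulr0 (lam ^ (- n))); apply: cvgMl_tmp.
  apply: (@squeeze_cvgr _ _ _ _ (fun=> 0) (fun k => K * variance p m (a * m ^ n) 1 k)).
  - apply: nearW => k; have [X _] := bump_past_hassum pm b k K0 an.
    rewrite (hassum_ge0 X)/=.
    apply: (hassum_le X (hassumZ K0 (variance_hassum pm k an o01))) => x.
    rewrite mulrCA ler_wpM2l ?(past_ge0 pm)// (koenigs1 HT) mulr1.
    have [_ _ B3] := bump_poly_le d0 db db1 (u01 k x).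
    by apply: B3; exact: dJ.
  - exact: cvg_cst.
  - by rewrite -[X in _ --> X](mulr0 K); apply: cvgMl_tmp; exact: variance_cvg0.
split=> [k|]; first by apply: (hassum_dom D _).1; exact: le.
have [_] := hassum_dominated_cvg eventually_filter D (nearW _ le) cv.
by rewrite (hassum_rsum (hassum0 _)).
Qed.

Lemma past_shift a (n : int) k : past (a * m ^ n) k = cpoisson p (a * m ^ (n - Posz k)).
Proof. by rewrite /past -mulrA expfzDr// exprnN. Qed.

Lemma bump_term_shift (J : pred int) (K a b : R) k v :
  hassum (bump_term J K a b k) v ->
  hassum (fun n : int => if J (n + Posz k) then
     lam ^ (- n) * rsum (fun x => cpoisson p (a * m ^ n) x * bump K b k x) else 0)
    (lam ^+ k * v).
Proof.
move=> hv; apply/(hassum_bij (e := fun n : int => n - Posz k) (e' := fun n => n + Posz k)).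
- exact: subrK.
- exact: addrK.
have lk : 0 <= lam ^+ k by rewrite exprn_ge0// ltW.
apply: hassum_eq (hassumZ lk hv) => n /=.
rewrite subrK /bump_term; case: ifP => _; last by rewrite mulr0.
by rewrite past_shift mulrA opprB (expfzDr (Posz k) (- n) lam_n0).
Qed.

Lemma kappa_bump (K a b : R) k v : 0 <= K -> 0 < a ->
  hassum (bump_term predT K a b k) v ->
  hassum (fun x => kappa a x * bump K b k x) (lam ^+ k * v).
Proof.
move=> K0 a0 /bump_term_shift /= hv.
have row (n : int) : hassum (fun x => lam ^ (- n) * cpoisson p (a * m ^ n) x * bump K b k x)
    (lam ^ (- n) * rsum (fun x => cpoisson p (a * m ^ n) x * bump K b k x)).
  have [X _] := bump_past_hassum pm b k K0 (bmn_gt0 pm (n + Posz k) a0).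
  rewrite past_shift addrK in X.
  apply: hassum_eq (hassumZ (ltW (lamz_gt0 pm ml (- n))) X) => x.
  by rewrite mulrA.
apply: (hassum_exchange row) hv => x.
by apply: hassumZr; [exact: bump_ge0|exact: (kappa_hassum pm ml)].
Qed.

Lemma kappa_ge_past b k x : 0 < b -> lam ^+ k * past b k x <= kappa b x.
Proof.
move=> b0; have := hassum_term (- Posz k) (kappa_hassum pm ml x b0).
by rewrite opprK /past exprnN.
Qed.

(** Integrate the bump at exp(-b) against both sides: the layer [past b k] of kappa_b contributes
    lam^k times a quantity tending to 1, while no layer of kappa_a concentrates there and its total
    is o(lam^k). *)
Lemma kappa_separated (a b lo hi r : R) : 0 < a -> 0 < b -> 0 < r ->
  lo < b -> b < hi -> (forall n : int, a * m ^ n <= lo \/ hi <= a * m ^ n) ->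
  ~ (forall x, kappa a x = r * kappa b x).
Proof.
move=> a0 b0 r0 lob bhi gap ab.
have [d [d0 db db1 dJ]] := expR_gap b0 lob bhi.
have [E Ecv] := @bump_term_cvg0 predT a b d a0 d0 db db1 (fun n _ => dJ _ (gap n)).
set K := d^-1 ^+ 2 in E Ecv.
have K0 : 0 <= K by rewrite exprn_ge0// invr_ge0 ltW.
have peak := bump_past_cvg1 pm K0 b0.
suff : r * 1 <= 0 by rewrite mulr1 leNgt r0.
apply: (@ler_cvg_to _ \oo _ R
  (fun k => r * rsum (fun x => past b k x * bump K b k x))
  (fun k => rsum (bump_term predT K a b k)) (r * 1) 0).
- exact: cvgMl_tmp.
- exact: Ecv.
apply: nearW => k.
have A := kappa_bump K0 a0 (E k).
have ri : 0 <= r^-1 by rewrite invr_ge0 ltW.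
have B : hassum (fun x => kappa b x * bump K b k x)
    (r^-1 * (lam ^+ k * rsum (bump_term predT K a b k))).
  apply: hassum_eq (hassumZ ri A) => x.
  by rewrite ab mulrA mulKf// gt_eqF.
have [X _] := bump_past_hassum pm b k K0 b0.
have lk : 0 < lam ^+ k by exact: exprn_gt0.
have le := hassum_le (hassumZ (ltW lk) X) B.
rewrite -(ler_pM2l lk) mulrCA -ler_pdivlMl//; apply: le => x.
rewrite mulrA ler_wpM2r ?bump_ge0//; exact: kappa_ge_past.
Qed.

End Separation.

Arguments bump_term {R} p m lam J K a b k n.

(** * Extremality *)

Lemma addz1_neq_opp (n : int) (k : nat) :
  (n + 1 != - Posz k) = (n != - Posz k.+1).
Proof. lia. Qed.

Lemma shift_past_Posz (j k : nat) : (j <= k)%N ->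
  Posz j - Posz k = - Posz (k - j)%N.
Proof. lia. Qed.

Lemma shift_past_Negz (j k : nat) : Negz j - Posz k = - Posz (k + j.+1)%N.
Proof. lia. Qed.

Lemma oppzS_add1 (k : nat) : - Posz k.+1 + 1 = - Posz k.
Proof. lia. Qed.

Section Minimality.
Context {R : realType} {p : nat -> R} {m lam : R}.
Hypothesis pm : subcritical p m.
Hypothesis ml : m < lam.

Let p_law := subcritical_law pm.
Let m01 := subcritical_m01 pm.
Let HT := survival_survival_map p_law (subcritical_mean pm) m01.
Let m0 : 0 < m. Proof. by case/andP: m01. Qed.
Let lam0 : 0 < lam. Proof. exact: lt_trans ml. Qed.
Let m_n0 : m != 0. Proof. by rewrite gt_eqF. Qed.
Let lam_n0 : lam != 0. Proof. by rewrite gt_eqF. Qed.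

Local Notation P := (killed (BGW_transition p)).
Local Notation T := (survival p).
Local Notation h := (koenigs T).
Local Notation kappa := (kappa p m lam).
Local Notation past := (past p m).
Local Notation bump := (bump p).

Variables (a C : R) (nu : Npos -> R).
Hypothesis a0 : 0 < a.
Hypothesis C0 : 0 <= C.
Hypothesis nu0 : forall x, 0 <= nu x.
Hypothesis nuP : forall y, hassum (fun x => nu x * P x y) (lam * nu y).
Hypothesis nu_kappa : forall x, nu x <= C * kappa a x.

Let pi (n : int) : Npos -> R := cpoisson p (a * m ^ n).
Let an0 n : 0 < a * m ^ n. Proof. exact: (bmn_gt0 pm). Qed.
Let pi0 n x : 0 <= pi n x. Proof. exact: (cpoisson_ge0 pm). Qed.
Let ln0 (n : int) : 0 < lam ^ n. Proof. exact: (lamz_gt0 pm ml). Qed.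

(** Where kappa_a vanishes so does nu, and division by 0 gives 0, so [nuE] holds everywhere. *)
Let density (x : Npos) : R := nu x / kappa a x.

Let density_ge0 x : 0 <= density x.
Proof. by rewrite divr_ge0// (kappa_ge0 pm ml). Qed.

Let density_le x : density x <= C.
Proof.
rewrite /density; have := kappa_ge0 pm ml x a0.
rewrite le_eqVlt => /predU1P[<-|k0]; first by rewrite invr0 mulr0.
by rewrite ler_pdivrMr.
Qed.

Let nuE x : nu x = density x * kappa a x.
Proof.
rewrite /density; have := kappa_ge0 pm ml x a0.
rewrite le_eqVlt => /predU1P[k0|k0]; last by rewrite divfK// gt_eqF.
rewrite -k0 mulr0; apply/eqP; rewrite eq_le nu0 andbT.
by have := nu_kappa x; rewrite -k0 mulr0.
Qed.

(** The share of the layer [pi n] in the integral of f against nu, before the weight lam^-n. *)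
Let part (n : int) (f : Npos -> R) : R := rsum (fun x => density x * (pi n x * f x)).

Let part_spec n f v : (forall x, 0 <= f x) -> hassum (fun x => pi n x * f x) v ->
  hassum (fun x => density x * (pi n x * f x)) (part n f) /\ part n f <= C * v.
Proof.
move=> f0 fv; apply: (hassum_dom (hassumZ C0 fv)) => x.
have pf0 : 0 <= pi n x * f x by exact: mulr_ge0.
by rewrite mulr_ge0//= ler_wpM2r.
Qed.

Let part_ge0 n f : (forall x, 0 <= f x) -> 0 <= part n f.
Proof.
move=> f0; apply: fine_ge0; apply: esum_ge0 => x _.
by rewrite lee_fin mulr_ge0 ?density_ge0// mulr_ge0 ?pi0 ?f0.
Qed.

Let part_total f v (w : int -> R) : (forall x, 0 <= f x) ->
  (forall n, hassum (fun x => pi n x * f x) (w n)) ->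
  hassum (fun x => nu x * f x) v ->
  hassum (fun n : int => lam ^ (- n) * part n f) v.
Proof.
move=> f0 fw nuf.
apply: (@hassum_exchange _ _ _
  (fun x (n : int) => lam ^ (- n) * (density x * (pi n x * f x)))
  (fun x => nu x * f x)) nuf => [x|n].
  have df0 : 0 <= density x * f x by exact: mulr_ge0.
  rewrite nuE mulrAC; apply: hassum_eq (hassumZ df0 (kappa_hassum pm ml x a0)) => n.
  by rewrite /pi; ring.
by apply: hassumZ; [exact: ltW|exact: (part_spec f0 (fw n)).1].
Qed.

Let mass (n : int) : R := part n (fun=> 1).

Let pi_mass n : hassum (fun x => pi n x * 1) (rsum (pi n)) /\ rsum (pi n) <= 1.
Proof.
have [X Xle] := cpoisson_mass pm (an0 n); split.
  by apply: hassum_eq X => x; rewrite mulr1.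
by apply: le_trans Xle _; rewrite gerDl oppr_le0 expR_ge0.
Qed.

Let mass_range n : 0 <= mass n <= C.
Proof.
have [X Xle] := pi_mass n.
rewrite part_ge0//=; apply: le_trans (part_spec (fun=> ler01) X).2 _.
by rewrite ler_piMr.
Qed.

(** The density is at most C and [pi n] has mass at most 1, so replacing f by 1 costs at most C (1 -
    v). *)
Let mass_approx n f v : (forall x, 0 <= f x <= 1) ->
  hassum (fun x => pi n x * f x) v -> part n f <= mass n <= part n f + C * (1 - v).
Proof.
move=> f01 fv; have [X Xle] := pi_mass n.
have f0 x : 0 <= f x by case/andP: (f01 x).
have g0 x : 0 <= 1 - f x by rewrite subr_ge0; case/andP: (f01 x).
have Y : hassum (fun x => pi n x * (1 - f x)) (rsum (pi n) - v).
  apply: hassum_eq (hassumB _ X fv) => x; first by rewrite mulrBr.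
  by have /andP[? ?] := f01 x; rewrite mulr_ge0//= ler_wpM2l.
have [A _] := part_spec f0 fv; have [B Ble] := part_spec g0 Y.
have [D _] := part_spec (fun=> ler01) X.
have -> : mass n = part n f + part n (fun x => 1 - f x).
  apply: (hassum_uniq D); apply: hassum_eq (hassumD A B) => x.
  by rewrite -mulrDr -mulrDr addrC subrK.
rewrite lerDl part_ge0//= lerD2l; apply: le_trans Ble _.
by rewrite ler_wpM2l// lerD2r.
Qed.

Section Step.
Variables (d : R) (k : nat) (E : R).
Hypothesis d0 : 0 < d.
Hypothesis da : 2 * d <= expR (- a).
Hypothesis da1 : 2 * d <= 1 - expR (- a).
Let K := d^-1 ^+ 2.
Hypothesis hE : hassum (bump_term p m lam (fun n => n != 0) K a a k) E.

Let phi : Npos -> R := bump K a k.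
Let K0 : 0 <= K. Proof. by rewrite exprn_ge0// invr_ge0 ltW. Qed.
Let phi01 x : 0 <= phi x <= 1. Proof. by rewrite bump_ge0 bump_le1. Qed.
Let phi0 x : 0 <= phi x. Proof. by case/andP: (phi01 x). Qed.
Let Phi (n : int) : R := rsum (fun x => pi n x * phi x).

Let Phi_hassum n : hassum (fun x => pi n x * phi x) (Phi n).
Proof.
have [X _] := bump_past_hassum pm a k K0 (an0 (n + Posz k)).
by rewrite past_shift // addrK in X.
Qed.

Let o01 : 0 <= (1 : R) <= 1. Proof. by rewrite ler01 lexx. Qed.

Let Pphi (x : Npos) : R := rsum (fun y => P x y * phi y).

Let Pphi_spec x : hassum (fun y => P x y * phi y) (Pphi x) /\ Pphi x <= 1.
Proof.
have X := killed_some pm x o01.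
have [y|Y Yle] := hassum_dom (f := fun y => P x y * phi y) X.
  rewrite some1 mulr1 mulr_ge0 ?(BGW_ge0 pm)//=.
  by case/andP: (phi01 y) => _; apply: ler_piMr; exact: (BGW_ge0 pm).
split => //; apply: le_trans Yle _.
by rewrite /some gerBl; case/andP: (none_range x (surv_range HT o01)).
Qed.

Let Pphi01 x : 0 <= Pphi x <= 1.
Proof. by have [X ->] := Pphi_spec x; rewrite (hassum_ge0 X). Qed.

Let Pphi0 x : 0 <= Pphi x. Proof. by case/andP: (Pphi01 x). Qed.

Let Pphi_hassum n : hassum (fun x => pi n x * Pphi x) (Phi (n + 1)).
Proof.
apply: (@hassum_exchange _ _ _ (fun y x => pi n x * P x y * phi y)
  (fun y => pi (n + 1) y * phi y)) (Phi_hassum (n + 1)) => [y|x].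
  apply: hassumZr => //.
  have := cpoisson_step pm y (an0 n).
  by rewrite /pi expfzDr// expr1z mulrA.
by apply: hassum_eq (hassumZ (pi0 n x) (Pphi_spec x).1) => y; rewrite mulrA.
Qed.

Let S : R := rsum (fun x => nu x * phi x).

Let S_hassum : hassum (fun x => nu x * phi x) S.
Proof.
have di : 0 <= d^-1 by rewrite invr_ge0 ltW.
have sk := iter_gt0 HT k one_in01.
have X := hassumZ C0 (hassumZ di (kappa_transform_hassum pm ml a0 sk)).
apply: (hassum_dom X _).1 => x; rewrite mulr_ge0//=.
have sk' : 0 <= iter k T 1 <= 1 by case/andP: sk => /ltW -> ->.
have [B _ _] := bump_poly_le d0 da da1 (none_range x sk').
rewrite [leRHS](_ : _ = (C * kappa a x) * (d^-1 * none (iter k T 1) x)); last by ring.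
by apply: ler_pM.
Qed.

Let S_hassum' : hassum (fun x => nu x * Pphi x) (lam * S).
Proof.
apply: (@hassum_exchange _ _ _ (fun y x => nu x * P x y * phi y)
  (fun y => lam * nu y * phi y)).
- by move=> y; apply: hassumZr.
- move=> x; apply: hassum_eq (hassumZ (nu0 x) (Pphi_spec x).1) => y.
  by rewrite mulrA.
- apply: hassum_eq (hassumZ (ltW lam0) S_hassum) => y.
  by rewrite mulrA.
Qed.

Let off : hassum (fun n : int => if n != - Posz k then lam ^ (- n) * Phi n else 0)
  (lam ^+ k * E).
Proof.
apply: hassum_eq (bump_term_shift pm ml hE) => n.
by rewrite addr_eq0.
Qed.

Let S_phi : lam ^+ k * part (- Posz k) phi <= S <=
  lam ^+ k * part (- Posz k) phi + C * (lam ^+ k * E).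
Proof.
have X := hassum_head (- Posz k) (part_total phi0 Phi_hassum S_hassum).
rewrite opprK in X.
have := hassum_ge0 X; rewrite subr_ge0 => -> /=.
rewrite addrC -lerBlDr; apply: (hassum_le X (hassumZ C0 off)) => n.
case: eqP => _ /=; first by rewrite mulr0.
by rewrite mulrCA ler_wpM2l ?(ltW (ln0 _))// (part_spec phi0 (Phi_hassum n)).2.
Qed.

Let S_Pphi : lam ^+ k * part (- Posz k.+1) Pphi <= S <=
  lam ^+ k * part (- Posz k.+1) Pphi + C * (lam ^+ k * E).
Proof.
have X := hassum_head (- Posz k.+1) (part_total Pphi0 Pphi_hassum S_hassum').
rewrite opprK in X.
have l0 := lam0.
have := hassum_ge0 X; rewrite subr_ge0 -[lam ^ Posz k.+1]/(lam ^+ k.+1).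
rewrite exprS -mulrA ler_pM2l// => -> /=.
have off' : hassum (fun n : int => if n + 1 != - Posz k then
    lam ^ (- (n + 1)) * Phi (n + 1) else 0) (lam ^+ k * E).
  apply: (iffRL (hassum_bij (e := fun n : int => n + 1) (e' := fun n => n - 1)
    (fun n => if n != - Posz k then lam ^ (- n) * Phi n else 0) _
    (addrK 1) (subrK 1)) off).
rewrite addrC -lerBlDr -(ler_pM2l lam0) mulrBr.
rewrite -[lam ^ Posz k.+1]/(lam ^+ k.+1) exprS -mulrA in X.
rewrite [leRHS]mulrCA; apply: (hassum_le X (hassumZ C0 (hassumZ (ltW lam0) off'))) => n.
rewrite addz1_neq_opp.
case: eqP => _ /=; first by rewrite !mulr0.
apply: le_trans (ler_wpM2l (ltW (ln0 _)) (part_spec Pphi0 (Pphi_hassum n)).2) _.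
have -> : lam ^ (- n) = lam * lam ^ (- (n + 1)).
  by rewrite opprD (expfzDr _ _ lam_n0) exprN1 mulrCA divff// mulr1.
by rewrite le_eqVlt; apply/orP; left; apply/eqP; ring.
Qed.

(** The integral S of phi against nu is computed twice. Directly, it comes from the layer -k, up to
    C lam^k E. By invariance lam S is the integral of P phi, and as P carries layer n to n + 1, it
    comes from the layer -(k + 1). On these layers phi and P phi have the same integral, near 1, so
    both computations give lam^k times the mass of the layer, nearly. *)
Lemma mass_step : `|mass (- Posz k.+1) - mass (- Posz k)| <=
  C * (E + (1 - rsum (fun x => past a k x * bump K a k x))).
Proof.
have lk : 0 < lam ^+ k by exact: exprn_gt0.
have PhiE : Phi (- Posz k) = rsum (fun x => past a k x * bump K a k x).
  by rewrite /Phi /pi /past exprnN.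
have /andP[S1 S2] := S_phi; have /andP[S3 S4] := S_Pphi.
have /andP[M1 M2] := mass_approx phi01 (Phi_hassum (- Posz k)).
have X := Pphi_hassum (- Posz k.+1).
rewrite oppzS_add1 in X.
have /andP[M3 M4] := mass_approx Pphi01 X.
have := le_trans S1 S4; have := le_trans S3 S2.
rewrite !(mulrCA C) -!mulrDr !ler_pM2l// -PhiE.
by move=> ? ?; rewrite mulrDr ler_distlC; apply/andP; split; lra.
Qed.

End Step.

Let mass_step_cvg0 : mass (- Posz k.+1) - mass (- Posz k) @[k --> \oo] --> (0 : R).
Proof.
have ma : a * m < a by rewrite gtr_pMr//; case/andP: m01.
have am : a < a * m^-1 by rewrite ltr_pMr// invf_gt1//; case/andP: m01.
(* Of the orbit a m^n only n = 0 lies strictly between a m and a/m, whence the margin d. *)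
have [d [d0 da da1 dgap]] := expR_gap a0 ma am.
have gap (n : int) : n != 0 -> 2 * d <= `|expR (- (a * m ^ n)) - expR (- a)|.
  have /andP[_ m1] := m01.
  case: n => [[//|n]|n] _; apply: dgap; [left|right].
    by rewrite ler_pM2l// -[m ^ _]/(m ^+ n.+1) exprS ler_piMr ?exprn_ile1// ltW.
  rewrite ler_pM2l// -[m ^ _]/((m ^+ n.+1)^-1) lef_pV2 ?posrE ?exprn_gt0//.
  by rewrite exprS ler_piMr ?exprn_ile1// ltW.
have [E Ecv] := bump_term_cvg0 pm ml a0 d0 da da1 gap.
have K0 : 0 <= d^-1 ^+ 2 by rewrite exprn_ge0// invr_ge0 ltW.
have peak := bump_past_cvg1 pm K0 a0.
apply/cvgr0Pnorm_le => e e0.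
have c0 : C * (rsum (bump_term p m lam (fun n => n != 0) (d^-1 ^+ 2) a a k) +
   (1 - rsum (fun x => past a k x * bump (d^-1 ^+ 2) a k x))) @[k --> \oo] --> (0 : R).
  rewrite -[X in _ --> X](mulr0 C); apply: cvgMl_tmp.
  rewrite -[X in _ --> X](addr0 0) -[X in 0 + X](subrr 1).
  by apply: cvgD => //; apply: cvgB => //; exact: cvg_cst.
have /cvgr0Pnorm_le/(_ _ e0) := c0; apply: filterS => k.
by apply: le_trans; apply: le_trans (ler_norm _); exact: mass_step.
Qed.

Let mass_shift_cvg0 (n : int) :
  mass (n - Posz k) - mass (- Posz k) @[k --> \oo] --> (0 : R).
Proof.
have shift j : mass (- Posz (k + j)%N) - mass (- Posz k) @[k --> \oo] --> (0 : R).
  elim: j => [|j IH].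
    by under eq_cvg do rewrite addn0 subrr; exact: (@cvg_cst _ (0 : R)).
  have S := mass_step_cvg0; rewrite -(cvg_shiftn j) in S.
  rewrite -[X in _ --> X](addr0 0); apply: cvg_trans (cvgD S IH); apply: near_eq_cvg.
  by apply: nearW => k; rewrite !fctE /= addnS; ring.
case: n => j; last first.
  by under eq_cvg do rewrite shift_past_Negz; exact: shift.
rewrite -(cvg_shiftn j) /=.
have s' : - (mass (- Posz (k + j)%N) - mass (- Posz k)) @[k --> \oo] --> - (0 : R).
  by apply: cvgN; exact: shift.
rewrite oppr0 in s'; apply: cvg_trans s'; apply: near_eq_cvg.
by apply: nearW => k; rewrite ?fctE /= shift_past_Posz ?leq_addl// addnK; ring.
Qed.

Let N (t : R) : R := rsum (fun x => nu x * none t x).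

Let N_hassum t : 0 < t <= 1 -> hassum (fun x => nu x * none t x) (N t).
Proof.
move=> t01; have t01' : 0 <= t <= 1 by case/andP: t01 => /ltW -> ->.
apply: (hassum_dom (hassumZ C0 (kappa_transform_hassum pm ml a0 t01)) _).1 => x.
have /andP[n0 _] := none_range x t01'.
by rewrite mulr_ge0//= mulrA ler_wpM2r.
Qed.

(** This is P^k applied to [none t], by [steps_none]. *)
Let none_diff (t : R) (k : nat) (x : Npos) : R :=
  none (iter k T t) x - none (iter k T 1) x.

Let none_diff_ge0 t k x : 0 < t <= 1 -> 0 <= none_diff t k x.
Proof. by move=> t01; case/andP: (none_diff_range pm k x t01). Qed.

(** Invariance on transforms reads N(T s) - N(T 1) = lam N(s); the constants telescope along the
    iteration. *)
Let N_iter t k : 0 < t <= 1 -> N (iter k T t) - N (iter k T 1) = lam ^+ k * N t.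
Proof.
move=> t01.
have N1 : N 1 = 0.
  apply: hassum_rsum; apply: hassum_eq (hassum0 _) => x.
  by rewrite none1 mulr0.
have step s : 0 < s <= 1 -> N (T s) - N (T 1) = lam * N s.
  move=> s01; have s01' : 0 <= s <= 1 by case/andP: s01 => /ltW -> ->.
  have Ts := iter_gt0 HT 1 s01; have T1 := iter_gt0 HT 1 one_in01.
  have X : hassum (fun x => nu x * (none (T s) x - none (T 1) x)) (lam * N s).
    apply: (@hassum_exchange _ _ _ (fun y x => nu x * P x y * none s y)
      (fun y => lam * nu y * none s y)).
    - by move=> y; apply: hassumZr => //; case/andP: (none_range y s01').
    - move=> x; apply: hassum_eq (hassumZ (nu0 x) (killed_none pm x s01')) => y.
      by rewrite mulrA.
    - by apply: hassum_eq (hassumZ (ltW lam0) (N_hassum s01)) => y; rewrite mulrA.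
  have Y := hassumD X (N_hassum T1).
  have -> : N (T s) = lam * N s + N (T 1).
    apply: (hassum_uniq (N_hassum Ts)); apply: hassum_eq Y => x.
    by rewrite /=; ring.
  by rewrite addrK.
elim: k => [|k IH]; first by rewrite /= N1 subr0 mul1r.
rewrite !iterS exprS -mulrA -IH mulrBr.
rewrite -(step _ (iter_gt0 HT k t01)) -(step _ (iter_gt0 HT k one_in01)).
by ring.
Qed.

Let none_diff_hassum t k : 0 < t <= 1 ->
  hassum (fun x => nu x * none_diff t k x) (lam ^+ k * N t).
Proof.
move=> t01; rewrite -N_iter//.
have X := N_hassum (iter_gt0 HT k t01); have Y := N_hassum (iter_gt0 HT k one_in01).
apply: hassum_eq (hassumB _ X Y) => x; first by rewrite mulrBr.
have := none_diff_ge0 k x t01; rewrite /none_diff subr_ge0 => le.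
rewrite ler_wpM2l// andbT mulr_ge0//.
have sk : 0 <= iter k T 1 <= 1 by case/andP: (iter_gt0 HT k one_in01) => /ltW -> ->.
by case/andP: (none_range x sk).
Qed.

Let weight (t : R) (n : int) : R := expR (- (a * m ^ n * h t)) - expR (- (a * m ^ n)).

Let pi_none_diff t k n : 0 < t <= 1 ->
  hassum (fun x => pi (n - Posz k) x * none_diff t k x) (weight t n).
Proof.
move=> t01.
have X := past_hassum pm k (an0 n) t01.
have Y := past_hassum pm k (an0 n) one_in01; rewrite (koenigs1 HT) mulr1 in Y.
rewrite past_shift// in X Y.
have -> : weight t n = expR (- (a * m ^ n * h t)) - expR (- (a * m ^ n * m ^- k)) -
    (expR (- (a * m ^ n)) - expR (- (a * m ^ n * m ^- k))) by rewrite /weight; ring.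
apply: hassum_eq (hassumB _ X Y) => x.
  by rewrite -mulrBr.
have := none_diff_ge0 k x t01; rewrite /none_diff subr_ge0 => le.
rewrite ler_wpM2l ?andbT//; last exact: pi0.
exact: hassum_nneg Y x.
Qed.

Let part_sum t k : 0 < t <= 1 ->
  hassum (fun n : int => lam ^ (- n) * part (n - Posz k) (none_diff t k)) (N t).
Proof.
move=> t01.
have w n : hassum (fun x => pi n x * none_diff t k x) (weight t (n + Posz k)).
  by have := pi_none_diff k (n + Posz k) t01; rewrite addrK.
have X := part_total (fun x => none_diff_ge0 k x t01) w (none_diff_hassum k t01).
have li : 0 <= (lam ^+ k)^-1 by rewrite invr_ge0 exprn_ge0// ltW.
have lk : lam ^+ k != 0 by rewrite expf_neq0.
have := hassumZ li X; rewrite mulKf//.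
move/(iffRL (hassum_bij (e := fun n : int => n - Posz k) (e' := fun n => n + Posz k)
  _ _ (subrK (Posz k)) (addrK (Posz k)))).
apply: hassum_eq => n /=.
by rewrite mulrA opprB (expfzDr (Posz k) (- n) lam_n0) mulKf.
Qed.

(** The layer n - k is [past (a m^n) k], under which [none_diff] tends in L^1 to [weight t n]; the
    density costs at most a factor C. *)
Let part_approx t n : 0 < t <= 1 ->
  part (n - Posz k) (none_diff t k) - mass (n - Posz k) * weight t n @[k --> \oo]
    --> (0 : R).
Proof.
move=> t01.
pose B k := C * (deviation p m (a * m ^ n) t k + deviation p m (a * m ^ n) 1 k).
have Bcv : B @ \oo --> (0 : R).
  rewrite -[X in _ --> X](mulr0 C); apply: cvgMl_tmp.
  by rewrite -[X in _ --> X](addr0 0); apply: cvgD; apply: (deviation_cvg0 pm) => //; exact: one_in01.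
apply/cvgr0Pnorm_le => e e0.
have /cvgr0Pnorm_le/(_ _ e0) := Bcv; apply: filterS => k.
apply: le_trans; apply: le_trans (ler_norm _).
have D1 := deviation_hassum pm k (an0 n) t01.
have D2 := deviation_hassum pm k (an0 n) one_in01.
rewrite past_shift// (koenigs1 HT) mulr1 in D1 D2.
have w0 : 0 <= weight t n.
  exact: hassum_ge0 (pi_none_diff 0 n t01).
have [x|F Fle] := hassum_dom
  (f := fun x => pi (n - Posz k) x * `|none_diff t k x - weight t n|) (hassumD D1 D2).
  rewrite mulr_ge0//= -mulrDr ler_wpM2l//.
  have -> : none_diff t k x - weight t n =
      (none (iter k T t) x - expR (- (a * m ^ n * h t))) -
      (none (iter k T 1) x - expR (- (a * m ^ n))) by rewrite /none_diff /weight; ring.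
  exact: ler_normB.
have [G Gle] := part_spec (fun x => normr_ge0 _) F.
have [H _] := part_spec (fun x => none_diff_ge0 k x t01) (pi_none_diff k n t01).
have [J _] := part_spec (fun=> ler01) (pi_mass (n - Posz k)).1.
have J' := hassumZr w0 J.
have d : hassum (fun x => `|density x * (pi (n - Posz k) x * none_diff t k x) -
    density x * (pi (n - Posz k) x * 1) * weight t n|)
    (part (n - Posz k) (fun x => `|none_diff t k x - weight t n|)).
  apply: hassum_eq G => x.
  rewrite mulr1 -[density x * pi _ _ * _]mulrA -mulrBr -mulrBr.
  by rewrite normrM (ger0_norm (density_ge0 x)) normrM (ger0_norm (pi0 _ x)).
apply: le_trans (hassum_dist H J' d) _; apply: le_trans Gle _.
by rewrite ler_wpM2l.
Qed.

(** Sum [part_approx] over n, all masses being replaced by that of the layer -k through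
    [mass_shift_cvg0]; C times [kappa_term] dominates. *)
Let N_approx t : 0 < t <= 1 ->
  N t - mass (- Posz k) * kappa_transform p m lam a t @[k --> \oo] --> (0 : R).
Proof.
move=> t01.
pose Z k (n : int) := `|lam ^ (- n) * part (n - Posz k) (none_diff t k) -
  mass (- Posz k) * kappa_term p m lam a t n|.
have D := hassumZ C0 (kappa_term_hassum pm ml a0 t01).
have kt n : 0 <= kappa_term p m lam a t n.
  by case/andP: (kappa_term_range pm ml n a0 t01).
have ZD k n : 0 <= Z k n <= C * kappa_term p m lam a t n.
  rewrite normr_ge0/=.
  have /andP[M0 M1] := mass_range (- Posz k).
  have [_ ple] := part_spec (fun x => none_diff_ge0 k x t01) (pi_none_diff k n t01).
  have p0 := part_ge0 (n - Posz k) (fun x => none_diff_ge0 k x t01).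
  have h1 : lam ^ (- n) * part (n - Posz k) (none_diff t k) <=
      C * kappa_term p m lam a t n.
    rewrite /kappa_term -/(weight t n) mulrCA.
    by apply: ler_wpM2l => //; exact: ltW.
  have h2 : mass (- Posz k) * kappa_term p m lam a t n <= C * kappa_term p m lam a t n.
    exact: ler_wpM2r.
  have h3 : 0 <= lam ^ (- n) * part (n - Posz k) (none_diff t k).
    by rewrite mulr_ge0// ltW.
  have h4 : 0 <= mass (- Posz k) * kappa_term p m lam a t n by rewrite mulr_ge0.
  rewrite ler_norml; move: h1 h2 h3 h4.
  move: (lam ^ _ * _) (mass _ * _) (C * _) => x y z ? ? ? ?.
  by apply/andP; split; lra.
have Zcv n : Z k n @[k --> \oo] --> (0 : R).
  rewrite -(normr0 R); apply: cvg_norm.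
  rewrite -[X in _ --> X](mulr0 (lam ^ (- n))).
  have c1 := part_approx n t01.
  have c2 := @cvgMr_tmp _ _ _ eventually_filter _ _ (weight t n) (mass_shift_cvg0 n).
  rewrite mul0r in c2.
  rewrite -(addr0 0).
  apply: cvg_trans (cvgMl_tmp (a := lam ^ (- n)) (cvgD c1 c2)).
  apply: near_eq_cvg; apply: nearW => k; rewrite ?fctE /=.
  by rewrite /kappa_term -/(weight t n); ring.
have [_] := hassum_dominated_cvg eventually_filter D (nearW _ ZD) Zcv.
rewrite (hassum_rsum (hassum0 _)) => Zs.
apply/cvgr0Pnorm_le => e e0.
have /cvgr0Pnorm_le/(_ _ e0) := Zs; apply: filterS => k.
apply: le_trans; apply: le_trans (ler_norm _).
have /andP[M0 _] := mass_range (- Posz k).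
have X := part_sum k t01.
have Y := hassumZ M0 (kappa_term_hassum pm ml a0 t01).
exact: (hassum_dist X Y (hassum_dom D (ZD k)).1).
Qed.

Lemma kappa_minimal : exists c, forall x, nu x = c * kappa a x.
Proof.
pose G := kappa_transform p m lam a.
have t2 : 0 < (2^-1 : R) <= 1 by rewrite invr_gt0 ltr0n/= invf_le1 ?ler1n ?ltr0n.
have G0 := hassum_ge0 (kappa_transform_hassum pm ml a0 t2).
move: G0; rewrite le_eqVlt => /predU1P[G0|G0].
  exists 0 => x; rewrite mul0r.
  have n0 : 0 < none (2^-1 : R) x.
    by apply: none_gt0; rewrite invr_ge0 ler0n/= invf_lt1 ?ltr1n ?ltr0n.
  have := hassum_term x (kappa_transform_hassum pm ml a0 t2).
  rewrite -G0 pmulr_lle0// => k0; apply/eqP; rewrite eq_le nu0 andbT.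
  by apply: le_trans (nu_kappa x) _; rewrite mulr_ge0_le0.
pose c := N (2^-1) / G (2^-1).
(* Increments tending to 0 do not make the masses converge; their limit comes from [N_approx] at t =
   1/2. *)
have mc : mass (- Posz k) @[k --> \oo] --> c.
  have c1 := @cvgMr_tmp _ _ _ eventually_filter _ _ (G 2^-1)^-1 (N_approx t2).
  rewrite mul0r in c1.
  rewrite -[X in _ --> X](subr0 c); apply: cvg_trans (cvgB (cvg_cst c) c1).
  apply: near_eq_cvg; apply: nearW => k; rewrite ?fctE /=.
  by rewrite /c mulrBl mulfK ?gt_eqF//; ring.
have NG t : 0 < t <= 1 -> N t = c * G t.
  move=> t01.
  have c1 : mass (- Posz k) * G t @[k --> \oo] --> c * G t by exact: cvgMr_tmp.
  have c2 : mass (- Posz k) * G t @[k --> \oo] --> N t.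
    rewrite -[X in _ --> X](subr0 (N t)); apply: cvg_trans (cvgB (cvg_cst (N t)) (N_approx t01)).
    apply: near_eq_cvg; apply: nearW => k; rewrite ?fctE /=.
    by rewrite subKr.
  exact: (cvg_unique _ c2 c1).
have c0 : 0 <= c.
  by rewrite divr_ge0 ?(ltW G0)//; exact: hassum_ge0 (N_hassum t2).
exists c; apply: (@Npos_power_series_inj _ nu (fun x => c * kappa a x) N) => t /andP[t0 t1].
  by apply: N_hassum; rewrite t0 ltW.
have t01 : 0 < t <= 1 by rewrite t0 ltW.
rewrite NG//; apply: hassum_eq (hassumZ c0 (kappa_transform_hassum pm ml a0 t01)) => x.
by rewrite mulrA.
Qed.

End Minimality.

(** * Compactifications and quotients *)

Lemma cluster_continuous_eq (X Y : topologicalType) (f : X -> Y) (p q : X) :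
  hausdorff_space Y -> continuous f -> cluster (nbhs p) q -> f p = f q.
Proof.
move=> hY fc pq; apply: hY => A B nA nB.
by have [x [Ax Bx]] := pq _ _ (fc p _ nA) (fc q _ nB); exists (f x).
Qed.

Lemma hausdorff_pair (X Y : topologicalType) :
  hausdorff_space X -> hausdorff_space Y -> hausdorff_space (X * Y)%type.
Proof.
move=> hX hY [p1 p2] [q1 q2] pq.
have := cluster_continuous_eq hX (fun x => @cvg_fst _ _ _ _ _) pq.
have := cluster_continuous_eq hY (fun x => @cvg_snd _ _ _ _ _) pq.
by move=> /= -> ->.
Qed.

Lemma hausdorff_set_type (X : topologicalType) (A : set X) :
  hausdorff_space X -> hausdorff_space (set_type A).
Proof.
move=> hX p q /(cluster_continuous_eq hX (@initial_continuous _ _ set_val)).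
exact: val_inj.
Qed.

Lemma compact_set_type (X : topologicalType) (A : set X) :
  compact A -> compact [set: set_type A].
Proof.
move=> cA F PF _.
have [|a [Aa cl]] := cA (fmap (@set_val _ A) F) _.
  by rewrite /fmap /=; apply: filterE => x; exact: set_valP.
exists (exist _ a (mem_set Aa)); split => // B U FB.
move=> [_ [[V oV <-] /= Va VU]].
have FVB : F (@set_val _ A @^-1` (@set_val _ A @` B)).
  by apply: (filterS _ FB) => b Bb; exists b.
have [_ [[b Bb <-] Vb]] := cl _ _ FVB (open_nbhs_nbhs (conj oV Va)).
by exists b; split => //; exact: VU.
Qed.

Lemma dense_eq (X D Y : topologicalType) (i : D -> X) (f g : X -> Y) :
  hausdorff_space Y -> dense (range i) -> continuous f -> continuous g ->
  (forall d, f (i d) = g (i d)) -> f =1 g.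
Proof.
move=> hY di fc gc fg x; apply: hY => A B nA nB.
have nx : nbhs x (f @^-1` A `&` g @^-1` B).
  by apply: filterI; [exact: fc|exact: gc].
have [|w [nd [d _ dw]]] := di ((f @^-1` A `&` g @^-1` B)°) _ (open_interior _).
  by exists x.
have [] := interior_subset nd; rewrite -dw => Ad Bd.
by exists (f (i d)); split => //=; rewrite fg.
Qed.

Lemma compact_dense_surjective (X D Y : topologicalType) (j : D -> X) (i : D -> Y)
    (f : X -> Y) : compact [set: X] -> hausdorff_space Y -> dense (range i) ->
  continuous f -> (forall d, f (j d) = i d) -> forall y, exists x, f x = y.
Proof.
move=> cX hY di fc fj y.
have cl : closed (range f).
  apply: compact_closed => //; apply: continuous_compact => //.
  exact: continuous_subspaceT.
apply: contrapT => yf.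
have [|w [nd [d _ dw]]] := di (~` range f) _ (closed_openC cl).
  by exists y => -[x _ xy]; apply: yf; exists x.
by apply: nd; exists (j d) => //; rewrite fj.
Qed.

(** A continuous surjection from a compact space onto a Hausdorff one is closed, hence a quotient
    map; two quotients with the same fibres agree. *)
Lemma homeomorphic_quotients (K X Y : topologicalType) (phi : K -> X) (psi : K -> Y) :
  compact [set: K] -> hausdorff_space X -> hausdorff_space Y ->
  continuous phi -> continuous psi ->
  (forall x, exists k, phi k = x) -> (forall y, exists k, psi k = y) ->
  (forall k l, phi k = phi l <-> psi k = psi l) -> homeomorphic X Y.
Proof.
move=> cK hX hY cphi cpsi sphi spsi fib.
have quotient (U V : topologicalType) (u : K -> U) (v : K -> V) (f : U -> V) :
  hausdorff_space U -> continuous u -> continuous v ->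
  (forall x, exists k, u k = x) -> (forall k, f (u k) = v k) -> continuous f.
  move=> hU cu cv su fu; apply/continuous_closedP => C cC.
  have -> : f @^-1` C = u @` (v @^-1` C).
    apply/seteqP; split => [x /= Cx|_ [k Ck <-]]; last by rewrite /= fu.
    by have [k kx] := su x; exists k => //=; rewrite -fu kx.
  apply: compact_closed => //; apply: continuous_compact.
    exact: continuous_subspaceT.
  by apply: (subclosed_compact _ cK) => //; move/continuous_closedP: cv; apply.
have /choice[s sP] := sphi; have /choice[r rP] := spsi.
have f1 k : psi (s (phi k)) = psi k by apply/fib; rewrite sP.
have f2 k : phi (r (psi k)) = phi k by apply/fib; rewrite rP.
exists (psi \o s), (phi \o r); split.
- exact: (quotient _ _ phi psi).
- exact: (quotient _ _ psi phi).
- by move=> x /=; rewrite f2 sP.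
- by move=> y /=; rewrite f1 rP.
Qed.

Lemma inv_window (R : realType) (x z : R) : 1 <= x -> 1 <= z ->
  ((x + 2^-1)^-1 < z^-1 < (x - 2^-1)^-1) = (x - 2^-1 < z < x + 2^-1).
Proof.
move=> x1 z1; have a0 : 0 < x + 2^-1 by lra.
have b0 : 0 < x - 2^-1 by lra.
have z0 : 0 < z by lra.
by rewrite !ltf_pV2 ?posrE// andbC.
Qed.

Lemma natr_window (R : realType) (x z : nat) :
  x%:R - 2^-1 < (z%:R : R) < x%:R + 2^-1 -> z = x.
Proof.
move=> /andP[h1 h2]; apply/eqP; rewrite eqn_leq; apply/andP.
by split; rewrite -ltnS -(ltr_nat R) -natr1; lra.
Qed.

Lemma cvg_invn (R : realType) : (n%:R : R)^-1 @[n --> \oo] --> (0 : R).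
Proof. by rewrite -(cvg_shiftn 1); under eq_fun do rewrite addn1; exact: cvg_harmonic. Qed.

(** * Boundary points through the closure of a graph *)

Section BoundaryStructure.
Variables (R : realType) (Y M : topologicalType) (f : Npos -> Y) (i : Npos -> M)
  (fhat : M -> Y).
Hypothesis hY : hausdorff_space Y.
Hypothesis Mmin : smallest_compactification_extending f i.
Hypothesis fext : continuous_extension i f fhat.

(* The closure of the graph of [f] over the compactification {1/x} U {0} of
   [Npos]; by minimality it is homeomorphic to [M], but only a surjection onto
   [M] is needed. *)
Definition graph_map (x : Npos) : R * Y := (((\val x)%:R)^-1, f x).

Definition graph_closure : set (R * Y) := closure (range graph_map).

Let hRY : hausdorff_space (R * Y)%type.
Proof. exact: hausdorff_pair (@Rhausdorff R) hY. Qed.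

Let fst_cont : continuous (@fst R Y).
Proof. by move=> x; exact: cvg_fst. Qed.

Let snd_cont : continuous (@snd R Y).
Proof. by move=> x; exact: cvg_snd. Qed.

Let graph_closure_compact : compact graph_closure.
Proof.
have [[cM _ _ _] _ _] := Mmin; have [cf fi] := fext.
have cB : compact (`[(0:R), 1] `*` range fhat).
  apply: compact_setX; first exact: segment_compact.
  by apply: continuous_compact => //; exact: continuous_subspaceT.
apply: (subclosed_compact _ cB); first exact: closed_closure.
have -> : `[(0:R), 1] `*` range fhat = closure (`[(0:R), 1] `*` range fhat).
  by apply/closure_id; exact: (compact_closed hRY cB).
apply: closure_subset => _ [x _ <-]; split => /=; last by exists (i x); rewrite ?fi.
by rewrite in_itv/= invr_ge0 ler0n/= invf_le1 ?ltr0n ?ler1n ?Npos_gt0.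
Qed.

Local Notation M' := (set_type graph_closure).

Definition graph_point (x : Npos) : M' :=
  exist _ (graph_map x) (mem_set (subset_closure (imageT graph_map x))).

(** A strip that isolates the abscissa 1/x among all 1/z; the half-integers keep both bounds
    positive at x = 1. *)
Let window (x : Npos) : set (R * Y) :=
  fst @^-1` [set r : R | ((\val x)%:R + 2^-1)^-1 < r < ((\val x)%:R - 2^-1)^-1].

Let xge1 (x : Npos) : 1 <= (\val x)%:R :> R.
Proof. by rewrite ler1n Npos_gt0. Qed.

Let window_open x : open (window x).
Proof.
rewrite /window; have /continuousP H := fst_cont; apply: H.
rewrite (_ : [set r : R | _] = [set` `](((\val x)%:R : R) + 2^-1)^-1, ((\val x)%:R - 2^-1)^-1[]).
  exact: interval_open.
by apply/seteqP; split => r /=; rewrite in_itv.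
Qed.

Let window_graph x z : window x (graph_map z) -> z = x.
Proof. by rewrite /window /= inv_window ?xge1// => /natr_window/val_inj. Qed.

Let window_self x : window x (graph_map x).
Proof. by rewrite /window /= inv_window ?xge1// gtrBl ltrDl invr_gt0 ltr0n. Qed.

Let set_val_cont : continuous (@set_val _ graph_closure).
Proof. exact: initial_continuous. Qed.

Let Npos_nbhs (x : Npos) (U : set Npos) : U x -> nbhs x U.
Proof.
move=> Ux; exists [set x]; split => //; last by move=> _ ->.
exists [set \val x]; first exact: discrete_open.
by apply/seteqP; split => y /=; [exact: val_inj|move=> ->].
Qed.

Let graph_point_embedding : topological_embedding graph_point.
Proof.
split.
  move=> x z /(congr1 set_val) xz; apply/esym/window_graph.
  by rewrite -[graph_map z]xz; exact: window_self.
apply/funext => x; apply/seteqP; split => U nU.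
  by apply: Npos_nbhs; exact: nbhs_singleton nU.
have Ux := nbhs_singleton nU.
exists [set x]; split => //; last by move=> _ ->.
exists (@set_val _ graph_closure @^-1` window x).
  by have /continuousP H := set_val_cont; apply: H; exact: window_open.
apply/seteqP; split => z /=; first exact: window_graph.
by move=> ->; exact: window_self.
Qed.

Let graph_point_dense : dense (range graph_point).
Proof.
move=> O [a Oa] [V oV VO]; have [/= Va] : (set_val @^-1` V) a /\ True by rewrite VO.
have aA : graph_closure (set_val a) := set_valP a.
have [_ [[x _ <-] Vx]] := aA V (open_nbhs_nbhs (conj oV Va)).
by exists (graph_point x); split; [rewrite -VO|exists x].
Qed.

Let graph_compactification : compactification graph_point.
Proof.
split => //; first exact: compact_set_type.
exact: hausdorff_set_type.
Qed.

(** The second coordinate extends f to the graph closure, so minimality of M yields [pi]; the last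
    identity holds on the dense graph. *)
Lemma graph_collapse : exists pi : M' -> M,
  [/\ continuous pi, forall x, pi (graph_point x) = i x &
      forall a, fhat (pi a) = (set_val a).2].
Proof.
have [_ _ Mle] := Mmin.
have sc : continuous (fun a : M' => (set_val a).2).
  by move=> a; apply: continuous_comp; [exact: set_val_cont|exact: snd_cont].
have [|pi [pic pii]] := Mle _ _ graph_compactification.
  by exists (fun a : M' => (set_val a).2); split.
exists pi; split => //; have [fc fi] := fext.
apply: (dense_eq hY graph_point_dense) => [a|//|x].
  by apply: continuous_comp; [exact: pic|exact: fc].
by rewrite pii fi.
Qed.

Section Collapse.
Variable pi : M' -> M.
Hypothesis pi_cont : continuous pi.
Hypothesis pi_graph : forall x, pi (graph_point x) = i x.
Hypothesis fhat_pi : forall a, fhat (pi a) = (set_val a).2.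

(** i x is isolated in the range of i. Were [pi a] equal to i x, every graph point close to a would
    be that of x, yet some of them have first coordinate below 1/x. *)
Lemma collapse_boundary a : (set_val a).1 = 0 -> ~ range i (pi a).
Proof.
move=> a0 [x _ xa]; have [[_ _ [_ iN] _] _ _] := Mmin.
have : nbhs x [set x] by exact: Npos_nbhs.
rewrite -iN => -[_ [[V oV <-] /= Vx Vsub]].
rewrite xa in Vx.
have nV : nbhs a (pi @^-1` V) by apply: pi_cont; exact: open_nbhs_nbhs.
have x1 := xge1 x.
have nw : nbhs a [set b : M' | (set_val b).1 < (\val x)%:R^-1].
  have c1 : (fun b : M' => (set_val b).1) @ a --> (set_val a).1.
    by apply: continuous_comp; [exact: set_val_cont|exact: fst_cont].
  rewrite a0 in c1; apply: (cvgr_lt 0 c1).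
  by rewrite invr_gt0; exact: lt_le_trans x1.
have na := filterI nV nw.
have [|b [nb [z _ zb]]] := graph_point_dense _ (open_interior
    (pi @^-1` V `&` [set b : M' | (set_val b).1 < (\val x)%:R^-1])).
  by exists a; exact: na.
have [/= Vb bx] := interior_subset nb; rewrite -zb in Vb bx.
rewrite pi_graph in Vb; have zx := Vsub _ Vb; rewrite zx in bx.
by rewrite /= ltxx in bx.
Qed.

(** F is the trace on Npos of the neighbourhoods of a along the graph. If a is not on the graph, any
    finite set of states can be removed from a neighbourhood, so F tends to infinity. *)
Let val_cvg (a : M') : exists F : set_system Npos, [/\ ProperFilter F,
  graph_map @ F --> set_val a &
  (forall x, graph_point x <> a) -> \val @ F --> \oo].
Proof.
pose F : set_system Npos := fun S => nbhs (set_val a) [set q | forall x, graph_map x = q -> S x].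
have FiF : Filter F.
  split; first by apply: (@filterE _ (nbhs (set_val a))) => q x _.
    move=> A B; apply: (@filterS2 _ (nbhs (set_val a))) => q qA qB x xq.
    by split; [exact: qA|exact: qB].
  move=> A B AB; apply: (@filterS _ (nbhs (set_val a))) => q qA x xq.
  by apply: AB; exact: qA.
have FF : ProperFilter F.
  apply: Build_ProperFilter_ex => S nS.
  have [_ [[x _ <-] Sx]] := set_valP a _ nS.
  by exists x; exact: Sx.
exists F; split => //.
  by move=> B; apply: (@filterS _ (nbhs (set_val a))) => q Bq x /= ->.
move=> a_ngraph A [n _ nA].
suff : F [set x | (n <= \val x)%N] by apply: filterS => x; exact: nA.
elim: n {A nA} => [|n IH]; first by apply: filterE => x.
case: n IH => [_|n IH]; first by apply: filterE => x; exact: Npos_gt0.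
have ne : F [set~ npos n].
  have : nbhs (set_val a) [set~ graph_map (npos n)].
    apply: open_nbhs_nbhs; split.
      apply: closed_openC; apply: accessible_closed_set1.
      exact: hausdorff_accessible.
    by move=> /= e; apply: (a_ngraph (npos n)); exact/val_inj/esym.
  by apply: (@filterS _ (nbhs (set_val a))) => q qn x xq xn; apply: qn; rewrite -xq xn.
apply: filterS2 IH ne => x /= nx xn; rewrite ltn_neqAle nx andbT.
by apply/eqP => e; apply: xn; apply: val_inj.
Qed.

(** [pi] is onto, so xi = [pi a]; as xi is not in the range of i, a is off the graph, and its filter
    goes to infinity with abscissa tending to 0. *)
Lemma boundary_filter xi : ~ range i xi -> exists (a : M') (F : set_system Npos),
  [/\ pi a = xi, (set_val a).1 = 0, ProperFilter F, \val @ F --> \oo &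
      f @ F --> fhat xi].
Proof.
move=> xiB; have [[cM hM _ di] _ _] := Mmin.
have [a axi] := compact_dense_surjective (compact_set_type graph_closure_compact)
  hM di pi_cont pi_graph xi.
have [F [FF cF ooF]] := val_cvg a.
have {}ooF : \val @ F --> \oo.
  by apply: ooF => x xa; apply: xiB; exists x => //; rewrite -pi_graph xa.
exists a, F; split => //.
  have c1 : fst (graph_map x) @[x --> F] --> (set_val a).1.
    exact: (cvg_comp _ _ cF (@fst_cont (set_val a))).
  have c2 : fst (graph_map x) @[x --> F] --> (0 : R).
    exact: (cvg_comp _ _ ooF (@cvg_invn R)).
  exact: (cvg_unique _ c1 c2).
rewrite -axi fhat_pi.
exact: (cvg_comp _ _ cF (@snd_cont (set_val a))).
Qed.

End Collapse.

End BoundaryStructure.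

Arguments graph_map {R Y} f x.
Arguments graph_closure {R Y} f.

(** * The circle *)

Section Circle.
Variable R : realType.

Definition circle_point (t : R) : R * R := (cos (2 * pi * t), sin (2 * pi * t)).

Let cos2p : cos (2 * pi : R) = 1. Proof. by rewrite mulr_natl cos2pi. Qed.

Let sin2p : sin (2 * pi : R) = 0.
Proof. by rewrite mulr_natl mulr2n sinD sinpi mul0r mulr0 addr0. Qed.

Lemma cos_eq1 (z : R) : 0 <= z <= 2 * pi -> cos z = 1 -> z = 0 \/ z = 2 * pi.
Proof.
move=> /andP[z0 z2] cz; have pi0 := @pi_gt0 R.
have c_inj (w : R) : 0 <= w <= pi -> cos w = 1 -> w = 0.
  move=> w01 cw; apply: (@cos_inj R); rewrite ?in_itv/= ?w01 ?cos0//.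
  by rewrite lexx ltW.
have [zp|/ltW zp] := leP z pi; first by left; apply: c_inj => //; rewrite z0.
right; apply/eqP; rewrite eq_sym -subr_eq0; apply/eqP; apply: c_inj.
  by apply/andP; split; lra.
by rewrite cosB cos2p sin2p cz mul0r mulr1 addr0.
Qed.

Lemma circle_pointP t : @circle R (circle_point t).
Proof. by rewrite /circle /circle_point /= cos2Dsin2. Qed.

Lemma circle_point_fiber (s t : R) : 0 <= s <= 1 -> 0 <= t <= 1 ->
  circle_point s = circle_point t <-> s = t \/ (s = 0 /\ t = 1) \/ (s = 1 /\ t = 0).
Proof.
have pi0 := @pi_gt0 R.
have cp0 : circle_point 0 = circle_point 1.
  by rewrite /circle_point mulr0 mulr1 cos0 sin0 cos2p sin2p.
suff H (s' t' : R) : 0 <= s' -> s' <= t' -> t' <= 1 -> circle_point s' = circle_point t' ->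
    s' = t' \/ (s' = 0 /\ t' = 1).
  move=> /andP[s0 s1] /andP[t0 t1]; split => [st|].
    have [le|/ltW le] := leP s t.
      by have [->|] := H _ _ s0 le t1 st; [left|right; left].
    by have [->|[-> ->]] := H _ _ t0 le s1 (esym st); [left|right; right].
  by move=> [->//|[[-> ->]|[-> ->]]].
move=> s0 st t1 [ec es].
have c1 : cos (2 * pi * t' - 2 * pi * s') = 1.
  by rewrite cosB -ec -es -!expr2 cos2Dsin2.
have d0 : 0 <= t' - s' <= 1 by apply/andP; split; lra.
have dE : 2 * pi * t' - 2 * pi * s' = 2 * pi * (t' - s') by ring.
have pi20 : 2 * pi != 0 :> R by rewrite gt_eqF// mulr_gt0.
rewrite dE in c1.
have [|e|e] := cos_eq1 _ c1.
- by case/andP: d0 => d0 d1; rewrite mulr_ge0 ?mulr_ge0 ?(ltW pi0)//= ler_piMr ?mulr_ge0 ?(ltW pi0).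
- left; apply/eqP; rewrite eq_sym -subr_eq0; apply/eqP.
  by apply: (mulfI pi20); rewrite mulr0.
- have e1 : t' - s' = 1 by apply: (mulfI pi20); rewrite mulr1.
  by right; split; lra.
Qed.

Lemma circle_point_surj (z : R * R) : @circle R z ->
  exists2 t, 0 <= t <= 1 & circle_point t = z.
Proof.
case: z => x y; rewrite /circle /= => xy.
have pi0 := @pi_gt0 R.
have x1 : -1 <= x <= 1 by apply/andP; split; nra.
have a0 := acos_ge0 x1; have a1 := acos_lepi x1.
have y2 : 1 - x ^+ 2 = y ^+ 2 by rewrite -xy addrAC subrr add0r.
have [y0|y0] := leP 0 y.
  exists (acos x / (2 * pi)).
    by rewrite divr_ge0//= ?ler_pdivrMr; lra.
  rewrite /circle_point mulrC divfK; last by lra.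
  by rewrite acosK ?in_itv// sin_acos// y2 sqrtr_sqr ger0_norm.
(* Lower half of the circle: [acos] only reaches the upper half, so the angle is reflected. *)
exists (1 - acos x / (2 * pi)).
  have : 0 <= acos x / (2 * pi) <= 1.
    by rewrite divr_ge0//= ?ler_pdivrMr; lra.
  lra.
have e : 2 * pi * (1 - acos x / (2 * pi)) = 2 * pi - acos x by field; lra.
rewrite /circle_point e cosB sinB.
rewrite cos2p sin2p acosK ?in_itv// sin_acos// y2 sqrtr_sqr ltr0_norm//.
by congr (_, _); ring.
Qed.

Lemma circle_point_continuous : continuous circle_point.
Proof.
move=> t; have c : 2 * pi * u @[u --> t] --> 2 * pi * t.
  by apply: cvgMl_tmp; exact: cvg_id.
have A : cos (2 * pi * u) @[u --> t] --> cos (2 * pi * t).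
  by apply: (@continuous_cvg _ R R _ _ _ cos _ _ c); exact: continuous_cos.
have B : sin (2 * pi * u) @[u --> t] --> sin (2 * pi * t).
  by apply: (@continuous_cvg _ R R _ _ _ sin _ _ c); exact: continuous_sin.
exact: (cvg_pair A B).
Qed.

End Circle.

(** * The boundary *)

Lemma eq_div_cross (R : realType) (a b c d : R) : 0 < b ->
  a / b = c / d -> a = b / d * c.
Proof. by move=> b0 /(congr1 ( *%R b)); rewrite mulrCA divff ?gt_eqF// mulr1 mulrCA mulrC. Qed.

Section NormalizedKappa.
Context {R : realType} {p : nat -> R} {m lam : R} {o : Npos}.
Hypothesis pm : subcritical p m.
Hypothesis ml : m < lam.
Hypothesis green_o : forall x, (0 < green (killed (BGW_transition p)) lam x o)%E.

Let p_law := subcritical_law pm.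
Let m01 := subcritical_m01 pm.
Let HT := survival_survival_map p_law (subcritical_mean pm) m01.
Let m0 : 0 < m. Proof. by case/andP: m01. Qed.
Let lam0 : 0 < lam. Proof. exact: lt_trans ml. Qed.

Local Notation P := (killed (BGW_transition p)).
Local Notation T := (survival p).
Local Notation kappa := (kappa p m lam).
Local Notation G := (real_green p lam).

Lemma kappa_steps_le b k x y : 0 < b ->
  kappa b x * steps p k x y <= lam ^+ k * kappa b y.
Proof.
move=> b0; have kx0 := kappa_ge0 pm ml x b0.
elim: k y => [|k IH] y.
  rewrite expr0 mul1r /steps /=; case: eqP => [->|_]; first by rewrite mulr1.
  by rewrite mulr0 (kappa_ge0 pm ml).
have lk : 0 <= lam ^+ k by rewrite exprn_ge0// ltW.
rewrite exprSr -mulrA.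
apply: (hassum_le (hassumZ kx0 (steps_succ pm k x y))
  (hassumZ lk (kappa_invariant pm ml y b0))) => z.
by rewrite !mulrA ler_wpM2r// (BGW_ge0 pm).
Qed.

(** Positivity of the Green kernel means that o is reached from every x; so kappa_b(o) = 0 would
    make kappa_b vanish, against the masses of [past b k], which tend to 1. *)
Lemma kappa_gt0 b : 0 < b -> 0 < kappa b o.
Proof.
move=> b0; rewrite lt_neqAle (kappa_ge0 pm ml o b0) andbT; apply/eqP => ko.
have k0 x : kappa b x = 0.
  apply: contrapT => /eqP kx; have {}kx : 0 < kappa b x.
    by rewrite lt_neqAle eq_sym kx (kappa_ge0 pm ml).
  have s0 k : steps p k x o = 0.
    apply/eqP; rewrite eq_le (steps_ge0 pm) andbT.
    by have := kappa_steps_le k x o b0; rewrite -ko mulr0 pmulr_rle0.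
  have := green_o x; rewrite (green_real pm ml) lte_fin.
  suff -> : G x o = 0 by rewrite ltxx.
  apply: (hassum_uniq (real_green_hassum pm ml x o)).
  by apply: hassum_eq (hassum0 _) => k; rewrite s0 mulr0.
have past0 k : rsum (past p m b k) = 0.
  apply: hassum_rsum; apply: hassum_eq (hassum0 _) => x.
  apply/eqP; rewrite eq_le (past_ge0 pm k x b0) /=.
  have := kappa_ge_past pm ml k x b0.
  by rewrite k0 pmulr_rle0// exprn_gt0.
have := past_mass_cvg1 pm b0; under eq_fun do rewrite past0.
move=> c1; have c0 : (0 : R) @[_ --> \oo] --> (0 : R) by exact: cvg_cst.
have z1 : (0 : R) = 1 by exact: (cvg_unique _ c0 c1).
by move/eqP: z1; rewrite eq_sym oner_eq0.
Qed.

Definition nkappa (b : R) : {ptws Npos -> R} := fun y => kappa b y / kappa b o.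

Lemma nkappa_shift b (n : int) : 0 < b -> nkappa (b * m ^ n) = nkappa b.
Proof.
move=> b0; apply/funext => y; rewrite /nkappa !(kappa_shift pm ml)//.
by rewrite invfM mulrACA divff ?mul1r// gt_eqF// exprz_gt0.
Qed.

Lemma nkappa_continuous (b : R) : 0 < b -> nkappa @ b --> nkappa b.
Proof.
move=> b0; have FF : Filter (fmap nkappa (nbhs b)) by exact: fmap_filter.
apply: (iffRL (pointwise_cvgP (nkappa b) FF)) => y.
have k0 : kappa b o != 0 by rewrite gt_eqF// kappa_gt0.
have c1 : kappa c y @[c --> b] --> kappa b y by exact: (kappa_continuous pm ml b0).
have c2 : kappa c o @[c --> b] --> kappa b o by exact: (kappa_continuous pm ml b0).
suff c : kappa c y / kappa c o @[c --> b] --> kappa b y / kappa b o by exact: c.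
by apply: cvgM => //; exact: cvgV.
Qed.

Lemma nkappa_normalized b : 0 < b -> normalized_invariant P lam o (nkappa b).
Proof.
move=> b0; have k0 := kappa_gt0 b0; have ki : 0 <= (kappa b o)^-1 by rewrite invr_ge0 ltW.
split; last by rewrite /nkappa divff// gt_eqF.
split => [x|y]; first by rewrite /nkappa mulr_ge0 ?(kappa_ge0 pm ml).
have := (hassumZr ki (kappa_invariant pm ml y b0)).2.
rewrite /nkappa mulrA => <-; apply: eq_esum => x _.
by rewrite mulrAC.
Qed.

Lemma normalized_le_nkappa b c nu : 0 < b -> 0 < c ->
  normalized_invariant P lam o nu -> (forall x, c * nu x <= nkappa b x) ->
  nu = nkappa b.
Proof.
move=> b0 c0 [[nu0 nuP] nuo] nu_le; have k0 := kappa_gt0 b0.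
have ck : 0 <= (c * kappa b o)^-1 by rewrite invr_ge0 mulr_ge0 ?ltW.
have nuP' y : hassum (fun x => nu x * P x y) (lam * nu y).
  split => [x|]; first by rewrite mulr_ge0 ?(BGW_ge0 pm).
  exact: nuP.
have nu_kappa x : nu x <= (c * kappa b o)^-1 * kappa b x.
  have := nu_le x; rewrite /nkappa -ler_pdivlMl// => /le_trans; apply.
  by rewrite invfM mulrCA mulrC.
have [r rE] := kappa_minimal pm ml b0 ck nu0 nuP' nu_kappa.
have ro : r * kappa b o = 1 by rewrite -rE.
apply/funext => x; rewrite rE /nkappa.
have -> : r = (kappa b o)^-1 by rewrite -[RHS]mul1r -ro mulfK// gt_eqF.
exact: mulrC.
Qed.

Lemma nkappa_extremal b : 0 < b -> extremal_invariant P lam o (nkappa b).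
Proof.
move=> b0; split; first exact: nkappa_normalized.
move=> nu1 nu2 t n1 n2 /andP[t0 t1] nuE.
have t1' : 0 < 1 - t by rewrite subr_gt0.
have [[nu10 _] _] := n1; have [[nu20 _] _] := n2.
rewrite (normalized_le_nkappa b0 t0 n1) => [|x]; last first.
  by rewrite nuE lerDl mulr_ge0// ltW.
by rewrite (normalized_le_nkappa b0 t1' n2) => [//|x]; rewrite nuE lerDr mulr_ge0// ltW.
Qed.

Lemma martin_kernelE x y : martin_kernel P lam o x y = G x y / G x o.
Proof. by rewrite /martin_kernel !(green_real pm ml). Qed.

Lemma martin_map_cvg (I : Type) (F : set_system I) (x : I -> Npos) (k : I -> nat)
    (b : R) : ProperFilter F -> 0 < b -> k @ F --> \oo ->
  (\val (x i))%:R * iter (k i) T 1 @[i --> F] --> b ->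
  martin_map P lam o (x i) @[i --> F] --> nkappa b.
Proof.
move=> FF b0 koo xk; have FF' : Filter (fmap (fun i => martin_map P lam o (x i)) F).
  exact: fmap_filter.
apply: (iffRL (pointwise_cvgP (nkappa b) FF')) => y.
have c1 z : lam ^+ k i * G (x i) z @[i --> F] --> kappa b z.
  exact: (green_cvg pm ml b0 koo xk).
have k0 : kappa b o != 0 by rewrite gt_eqF// kappa_gt0.
have E i : martin_map P lam o (x i) y =
    (lam ^+ k i * G (x i) y) * (lam ^+ k i * G (x i) o)^-1.
  rewrite /martin_map martin_kernelE invfM mulrACA divff ?mul1r//.
  by rewrite expf_neq0// gt_eqF.
suff c : martin_map P lam o (x i) y @[i --> F] --> nkappa b y by exact: c.
under eq_cvg do rewrite E.
by apply: cvgM => //; exact: cvgV.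
Qed.

Lemma critical_time_ex (x : Npos) : exists k, (\val x)%:R * iter k T 1 <= 1 :> R.
Proof.
have o01 : 0 <= (1 : R) <= 1 by lra.
have x0 : 0 < (\val x)%:R :> R by rewrite ltr0n Npos_gt0.
have xi : 0 < ((\val x)%:R : R)^-1 by rewrite invr_gt0.
have /cvgrPdist_le/(_ _ xi)[k _ /(_ k (leqnn k))] := iter_cvg0 HT m01 o01.
have /andP[s0 _] := iter_gt0 HT k one_in01.
by rewrite /= sub0r normrN gtr0_norm// => h; exists k; rewrite -ler_pdivlMl// mulr1.
Qed.

Definition critical_time (x : Npos) : nat := ex_minn (critical_time_ex x).

(** Before the critical time x T^k(1) > 1, and one more step multiplies it by at least T(1), because
    T(c) >= c T(1). Time 0 is covered by T(1) <= 1 <= x. *)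
Lemma critical_time_range x :
  T 1 <= (\val x)%:R * iter (critical_time x) T 1 <= 1.
Proof.
have o01 : 0 <= (1 : R) <= 1 by lra.
have x1 : 1 <= (\val x)%:R :> R by rewrite ler1n Npos_gt0.
rewrite /critical_time; case: ex_minnP => k kP kmin; rewrite kP andbT.
case: k kP kmin => [|k] kP kmin.
  rewrite /= mulr1; have /andP[_ le] := surv_range HT o01; exact: le_trans x1.
have big : 1 < (\val x)%:R * iter k T 1.
  by rewrite ltNge; apply/negP => /kmin; rewrite ltnn.
have star := surv_star HT (iter_range HT k o01) o01; rewrite mulr1 in star.
have /andP[T0 _] := iter_gt0 HT 1 one_in01.
rewrite iterS; apply: le_trans (ler_wpM2l (le_trans ler01 x1) star).
by rewrite mulrA -[leLHS]mul1r ler_wpM2r ?ltW.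
Qed.

(** T^k(1) is nonincreasing in k, so a critical time below N forces x T^N(1) <= 1 and bounds x. *)
Lemma critical_time_cvg (F : set_system Npos) : Filter F ->
  \val @ F --> \oo -> critical_time @ F --> \oo.
Proof.
move=> FF voo A [N _ NA].
have o01 : 0 <= (1 : R) <= 1 by lra.
have /andP[sN _] := iter_gt0 HT N one_in01.
pose K := Num.truncn (iter N T 1)^-1.
have big : F [set x | (K < \val x)%N] by exact: (voo _ (nbhs_infty_gt K)).
suff : F [set x | A (critical_time x)] by [].
apply: filterS big => x /= xN; apply: NA => /=; rewrite leqNgt; apply/negP => kN.
have /andP[_ le] := critical_time_range x.
have dec : iter N T 1 <= iter (critical_time x) T 1.
  rewrite -(subnK (ltnW kN)) iterD.
  have u01 := iter_range HT (critical_time x) o01; have /andP[u0 u1] := u01.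
  have /andP[mm0 mm1] := m01.
  apply: le_trans (iter_le HT m01 _ u01) _.
  by rewrite ler_piMl// exprn_ile1 ?(ltW mm0) ?(ltW mm1).
have xgt : (iter N T 1)^-1 < (\val x)%:R.
  apply: lt_le_trans (Num.Theory.truncnS_gt _) _.
  by rewrite ler_nat.
have x0 : 0 <= (\val x)%:R :> R by [].
have gt1 : 1 < (\val x)%:R * iter N T 1 by rewrite -ltr_pdivrMr// mul1r.
have := lt_le_trans gt1 (le_trans (ler_wpM2l x0 dec) le).
by rewrite ltxx.
Qed.

(** On an ultrafilter finer than F, x T^k(1) at the critical time k converges to some b >= T(1) > 0,
    which determines the limit of the Martin kernel. *)
Lemma martin_limit (F : set_system Npos) (u : {ptws Npos -> R}) : ProperFilter F ->
  \val @ F --> \oo -> martin_map P lam o @ F --> u ->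
  exists2 b, 0 < b & u = nkappa b.
Proof.
move=> FF voo Fu.
have [U [UU FU]] := ultraFilterLemma FF.
have [b cb] := ultra_bounded_cvg UU critical_time_range.
have /andP[T0 _] := iter_gt0 HT 1 one_in01.
have b0 : 0 < b.
  apply: lt_le_trans T0 _; apply: cvgr_to_ge cb _; apply: nearW => x.
  by case/andP: (critical_time_range x).
exists b => //.
have kU : critical_time @ U --> \oo.
  by apply: cvg_trans (cvg_app _ FU) _; exact: critical_time_cvg.
have PU : ProperFilter U by exact: ultra_proper.
have c1 : martin_map P lam o @ U --> nkappa b.
  exact: (@martin_map_cvg _ U id critical_time b PU b0 kU cb).
have c2 : martin_map P lam o @ U --> u by exact: cvg_trans (cvg_app _ FU) Fu.
have hY : hausdorff_space {ptws Npos -> R}.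
  by apply: hausdorff_product => _; exact: Rhausdorff.
exact: (@cvg_unique _ hY _ (fmap_proper_filter _ PU) _ _ c2 c1).
Qed.

Definition phase (t : R) : R := expR (t * ln m).

Lemma phase_gt0 t : 0 < phase t. Proof. exact: expR_gt0. Qed.

Lemma phase1 : phase 1 = m. Proof. by rewrite /phase mul1r lnK. Qed.

Lemma phase0 : phase 0 = 1. Proof. by rewrite /phase mul0r expR0. Qed.

Lemma phase_lt s t : s < t -> phase t < phase s.
Proof. by move=> st; rewrite ltr_expR ltr_nM2r// ln_lt0. Qed.

Lemma phaseD s t : phase (s + t) = phase s * phase t.
Proof. by rewrite /phase mulrDl expRD. Qed.

Lemma phase_int (n : int) : phase n%:~R = m ^ n.
Proof.
have nat_case k : phase k%:R = m ^+ k by rewrite /phase expRM_natl lnK.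
case: n => n; first exact: nat_case.
by rewrite NegzE mulrNz /phase mulNr expRN -[expR _]/(phase n.+1%:R) nat_case -exprnN.
Qed.

Lemma nkappa_phase b : 0 < b -> exists2 t, 0 <= t <= 1 & nkappa b = nkappa (phase t).
Proof.
move=> b0; have lm : ln m != 0 by rewrite lt_eqF// ln_lt0.
have [s ->] : exists s, b = phase s.
  by exists (ln b / ln m); rewrite /phase divfK//; apply/esym; exact: lnK.
have [n /andP[n0 n1]] : exists n : int, 0 <= s - n%:~R <= 1.
  exists (Num.floor s); have := Num.Theory.floor_itv s.
  by rewrite intrD /= => /andP[? ?]; apply/andP; split; lra.
exists (s - n%:~R); first by rewrite n0.
have <- := nkappa_shift n (phase_gt0 (s - n%:~R)).
by rewrite -phase_int -phaseD subrK.
Qed.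

Lemma phase_gap s (n : int) :
  phase s * m ^ n <= phase (s + 1) \/ phase s <= phase s * m ^ n.
Proof.
have lm : ln m < 0 by exact: ln_lt0.
rewrite -phase_int -phaseD /phase !ler_expR !(ler_nM2r lm).
have [n0|n0] := leP n 0.
  by right; rewrite gerDl (ler_int _ n 0).
by left; rewrite lerD2l (ler_int _ 1 n).
Qed.

Lemma nkappa_phase_inj s t : 0 <= s -> s < t -> t <= 1 ->
  nkappa (phase s) = nkappa (phase t) -> s = 0 /\ t = 1.
Proof.
move=> s0 st t1 e; apply: contrapT => nst.
have ts : t < s + 1.
  rewrite lt_neqAle; apply/andP; split; last by lra.
  by apply/eqP => ts; apply: nst; split; lra.
have ks := kappa_gt0 (phase_gt0 s); have kt := kappa_gt0 (phase_gt0 t).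
have r0 := divr_gt0 ks kt.
have eq x : kappa (phase s) x = kappa (phase s) o / kappa (phase t) o * kappa (phase t) x.
  have ex : kappa (phase s) x / kappa (phase s) o = kappa (phase t) x / kappa (phase t) o.
    by have := congr1 (fun f => f x) e.
  exact: (eq_div_cross ks ex).
(* m^t lies strictly between m^(s+1) and m^s, where the orbit of m^s has no point. *)
exact: (kappa_separated pm ml (phase_gt0 s) (phase_gt0 t) r0
  (phase_lt ts) (phase_lt st) (phase_gap s) eq).
Qed.

Lemma nkappa_phase_fiber s t : 0 <= s <= 1 -> 0 <= t <= 1 ->
  nkappa (phase s) = nkappa (phase t) <->
  s = t \/ (s = 0 /\ t = 1) \/ (s = 1 /\ t = 0).
Proof.
move=> /andP[s0 s1] /andP[t0 t1].
have e01 : nkappa (phase 0) = nkappa (phase 1).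
  have e1 := nkappa_shift 1 ltr01; rewrite expr1z mul1r in e1.
  rewrite phase0 phase1; exact: (esym e1).
split => [e|].
  have [st|st|->] := ltgtP s t; last by left.
    by right; left; exact: (nkappa_phase_inj s0 st t1 e).
  have [t00 s11] := nkappa_phase_inj t0 st s1 (esym e); right; right.
  exact: (conj s11 t00).
move=> [->|[[-> ->]|[-> ->]]]; first exact: erefl.
  exact: e01.
exact: (esym e01).
Qed.

End NormalizedKappa.

Arguments phase {R} m t.
Arguments nkappa {R} p m lam o b.

(** * The normalized kappa as points over abscissa 0 *)

Section Boundary.
Context {R : realType} {p : nat -> R} {m lam : R} {o : Npos}.
Hypothesis pm : subcritical p m.
Hypothesis ml : m < lam.
Hypothesis green_o : forall x, (0 < green (killed (BGW_transition p)) lam x o)%E.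

Let HT := survival_survival_map (subcritical_law pm) (subcritical_mean pm) (subcritical_m01 pm).

Local Notation P := (killed (BGW_transition p)).
 Notation nkappa := (nkappa p m lam o).
Local Notation martin_graph_closure := (@graph_closure R _ (martin_map P lam o)).

Lemma critical_size_inv_cvg b : 0 < b ->
  ((\val (critical_size p b k))%:R : R)^-1 @[k --> \oo] --> (0 : R).
Proof.
move=> b0; have c := critical_size_cvg pm b0.
have o01 : 0 <= (1 : R) <= 1 by rewrite ler01 lexx.
have cT := iter_cvg0 HT (subcritical_m01 pm) o01.
rewrite -[X in _ --> X](mul0r b^-1).
have E k : ((\val (critical_size p b k))%:R : R)^-1 =
    iter k (survival p) 1 * ((\val (critical_size p b k))%:R * iter k (survival p) 1)^-1.
  have /andP[s0 _] := iter_gt0 HT k one_in01.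
  by rewrite invfM mulrCA divff ?mulr1 ?gt_eqF.
under eq_cvg do rewrite E.
by apply: cvgM => //; apply: cvgV => //; rewrite gt_eqF.
Qed.

(** Approached along [critical_size b k], which goes to infinity with x T^k(1) -> b. *)
Lemma nkappa_graph_closure b : 0 < b -> martin_graph_closure (0, nkappa b).
Proof.
move=> b0.
have c1 := critical_size_inv_cvg b0.
have c2 : martin_map P lam o (critical_size p b k) @[k --> \oo] --> nkappa b.
  exact: (martin_map_cvg pm ml green_o (k := id) _ b0 cvg_id (critical_size_cvg pm b0)).
have c : graph_map (martin_map P lam o) (critical_size p b k) @[k --> \oo] -->
    ((0, nkappa b) : R * {ptws Npos -> R}) by exact: (cvg_pair c1 c2).
move=> U nU.
have [k kU] : exists k, U (graph_map (martin_map P lam o) (critical_size p b k)).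
  exact: (@filter_ex _ \oo _ _ (c U nU)).
exists (graph_map (martin_map P lam o) (critical_size p b k)).
split; [exact: imageT | exact: kU].
Qed.

Lemma nkappa_phase_continuous : continuous (fun t => nkappa (phase m t)).
Proof.
move=> t.
have c1 : s * ln m @[s --> t] --> t * ln m by apply: cvgMr_tmp; exact: cvg_id.
have c2 : phase m s @[s --> t] --> phase m t.
  exact: (cvg_comp _ _ c1 (@continuous_expR R _)).
exact: (cvg_comp _ _ c2 (nkappa_continuous pm ml green_o (phase_gt0 _))).
Qed.

End Boundary.

Local Notation I01 R := (set_type (`[0, 1] : set R)).

Theorem corollary17 (R : realType) (p : nat -> R) (m lam : R) (o : Npos)
    (M : topologicalType) (i : Npos -> M) (Khat : M -> {ptws Npos -> R}) :
  let P := killed (BGW_transition p) in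
  offspring_law p -> has_mean p m -> 0 < m < 1 -> m < lam ->
  (forall x, (0 < green P lam x o)%E) ->
  martin_entrance_compactification P lam o i ->
  continuous_extension i (martin_map P lam o) Khat ->
  homeomorphic
    (set_type (minimal_martin_entrance_boundary P lam o i Khat))
    (set_type (@circle R)).
Proof.
move=> P hlaw hmean m01 ml green_o Mmin Kext.
have pm := Subcritical hlaw hmean m01.
have hY : hausdorff_space {ptws Npos -> R}.
  by apply: hausdorff_product => _; exact: Rhausdorff.
have [pi [pi_cont pi_graph Khat_pi]] := graph_collapse R hY Mmin Kext.
have K01 (k : I01 R) : 0 <= set_val k <= 1 by have := set_valP k; rewrite /= in_itv.
pose v (t : R) : R * {ptws Npos -> R} := (0, nkappa p m lam o (phase m t)).
have vA t : graph_closure (martin_map P lam o) (v t).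
  by apply: (nkappa_graph_closure pm ml green_o); exact: phase_gt0.
pose g (k : I01 R) : set_type (graph_closure (martin_map P lam o)) :=
  exist _ (v (set_val k)) (mem_set (vA (set_val k))).
have v_cont : continuous v.
  move=> t; have c0 : (0 : R) @[_ --> t] --> (0 : R) by exact: cvg_cst.
  by apply: (cvg_pair c0 (@nkappa_phase_continuous _ _ _ _ o pm ml green_o t)).
have val_cont : continuous (@set_val _ (`[0, 1] : set R)) by exact: initial_continuous.
have g_cont : continuous g.
  apply: continuous_comp_initial => k.
  exact: (continuous_comp (val_cont k) (v_cont (set_val k))).
have gB k : minimal_martin_entrance_boundary P lam o i Khat (pi (g k)).
  split; first exact: (collapse_boundary Mmin pi_cont pi_graph).
  rewrite Khat_pi; exact: (nkappa_extremal pm ml green_o (phase_gt0 _)).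
have [[_ hM _ _] _ _] := Mmin.
pose phi (k : I01 R) : set_type (minimal_martin_entrance_boundary P lam o i Khat) :=
  exist _ (pi (g k)) (mem_set (gB k)).
pose psi (k : I01 R) : set_type (@circle R) :=
  exist _ (circle_point (set_val k)) (mem_set (circle_pointP (set_val k))).
apply: (@homeomorphic_quotients (I01 R) _ _ phi psi).
- by apply: compact_set_type; exact: segment_compact.
- exact: hausdorff_set_type.
- apply: hausdorff_set_type; exact: hausdorff_pair (@Rhausdorff R) (@Rhausdorff R).
- apply: continuous_comp_initial => k.
  exact: (continuous_comp (g_cont k) (pi_cont (g k))).
- apply: continuous_comp_initial => k.
  exact: (continuous_comp (val_cont k) (@circle_point_continuous R _)).
(* A boundary point is [pi a] with a of coordinates 0 and [Khat xi]; the latter is some [nkappa], so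
   a is g at the corresponding parameter. *)
- move=> xi; have [xiB _] := set_valP xi.
  have [a [F [axi a0 FF Foo Fcvg]]] := boundary_filter hY Mmin Kext pi_cont pi_graph Khat_pi xiB.
  have [b b0 Kb] := martin_limit pm ml green_o FF Foo Fcvg.
  have [t t01 bt] := nkappa_phase pm ml b0 (o := o).
  have tK : [set` `[(0 : R), 1]] t by rewrite /= in_itv.
  exists (exist _ t (mem_set tK)); apply: val_inj => /=.
  rewrite -axi; congr pi; apply: val_inj => /=.
  rewrite [RHS]surjective_pairing a0 -Khat_pi axi Kb bt.
  exact: erefl.
- move=> z; have [t t01 tz] := circle_point_surj (set_valP z).
  have tK : [set` `[(0 : R), 1]] t by rewrite /= in_itv.
  by exists (exist _ t (mem_set tK)); exact: val_inj.
- move=> k l.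
  have fib1 := nkappa_phase_fiber pm ml green_o (K01 k) (K01 l).
  have fib2 := circle_point_fiber (K01 k) (K01 l).
  (* [Khat] recovers the second coordinate of g k from [pi (g k)], so [pi] makes no further
     identification. *)
  split => [e|e].
    apply: val_inj; apply: (iffRL fib2); apply: (iffLR fib1).
    have e1 : pi (g k) = pi (g l) := congr1 val e.
    have e2 := congr1 Khat e1; rewrite !Khat_pi in e2; exact: e2.
  apply: val_inj; have e1 := iffLR fib2 (congr1 val e).
  suff e2 : g k = g l by exact: (congr1 pi e2).
  by apply: val_inj; exact: (congr1 (pair 0) (iffRL fib1 e1)).
Qed.
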